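(* Let $1<p<\infty$. For any two measurable functions $\theta_1,\theta_2:\mathbb{R}_+\to(0,\pi)$, the integral operator $$ \mathcal S_{\theta_1(\cdot),\theta_2(\cdot)} f(x)=\int_0^\infty \frac{f(y)}{x e^{i\theta_1(x)}-y e^{-i\theta_2(y)}}\,dy ,\qquad x\in\mathbb{R}_+, $$ is bounded in $L^p(\mathbb{R}_+)$. Moreover, there exists a norm bound common to all pairs: there is a constant $K_5(p)$, depending only on $p$, such that for all measurable $\theta_1,\theta_2:\mathbb{R}_+\to(0,\pi)$ and all $f\in L^p(\mathbb{R}_+)$, $$ \|\mathcal S_{\theta_1(\cdot),\theta_2(\cdot)} f\|_{p}\le K_5(p)\,\|f\|_{p}. $$
   Context: Here $\mathbb{R}_+=(0,\infty)$ with Lebesgue measure, functions in $L^p(\mathbb{R}_+)$ are complex-valued, and $\|\cdot\|_p$ is the norm of $L^p(\mathbb{R}_+)$. *)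

(* Defs.v *)
From HB Require Import structures.
From mathcomp Require Import all_boot all_order all_algebra.
From mathcomp Require Import all_classical all_reals all_analysis.
From mathcomp Require Import complex.

Set Implicit Arguments.
Unset Strict Implicit.
Unset Printing Implicit Defensive.

Import Order.TTheory GRing.Theory Num.Theory.
Import numFieldNormedType.Exports.

Local Open Scope classical_set_scope.
Local Open Scope ring_scope.
Local Open Scope complex_scope.

(* A copy of R with the sigma-algebra of Lebesgue measurable sets, which
   properly contains the Borel sets that R carries by default. *)
Definition lebesgueR (R : realType) : measurableType _ :=
  caratheodory_type ((@wlength R idfun)^*)%mu.

Definition lebesgue (R : realType) : {measure set (lebesgueR R) -> \bar R} :=
  @completed_lebesgue_measure R.

Definition Rplus (R : realType) : set (lebesgueR R) :=
  [set x | 0 < (x : R)].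
Arguments Rplus : clear implicits.

Definition cmeasurable (R : realType) (D : set (lebesgueR R))
    (f : lebesgueR R -> R[i]) : Prop :=
  measurable_fun D (fun x => complex.Re (f x)) /\
  measurable_fun D (fun x => complex.Im (f x)).

Definition cintegrable (R : realType) (D : set (lebesgueR R))
    (f : lebesgueR R -> R[i]) : Prop :=
  (lebesgue R).-integrable D (fun x => (complex.Re (f x))%:E) /\
  (lebesgue R).-integrable D (fun x => (complex.Im (f x))%:E).

Definition cintegral (R : realType) (D : set (lebesgueR R))
    (f : lebesgueR R -> R[i]) : R[i] :=
  (\int[lebesgue R]_(x in D) complex.Re (f x)) +i*
  (\int[lebesgue R]_(x in D) complex.Im (f x)).

(* Elements of L^p(R_+) are represented by functions on the whole line whose
   values outside R_+ are irrelevant: the norm is that of f extended by 0. *)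
Definition Lpnorm (R : realType) (p : R) (f : lebesgueR R -> R[i]) : \bar R :=
  'N[lebesgue R]_p%:E[(fun x => (ComplexField.Normc.normc (f x))%:E) \_ (Rplus R)]%E.

Definition inLp (R : realType) (p : R) (f : lebesgueR R -> R[i]) : Prop :=
  cmeasurable (Rplus R) f /\ (Lpnorm p f < +oo)%E.

(* Compatibility with a.e. equality is a consequence of linearity and of the
   norm bound, so that T does act on equivalence classes. *)
Definition bounded_operator_Lp (R : realType) (p : R)
    (T : (lebesgueR R -> R[i]) -> lebesgueR R -> R[i]) : Prop :=
  [/\ forall f, inLp p f -> inLp p (T f),
      forall (a : R[i]) f g, inLp p f -> inLp p g ->
        {ae lebesgue R, forall x, Rplus R x ->
          T (fun y => a * f y + g y) x = a * T f x + T g x}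
    & exists K : R, forall f, inLp p f ->
        (Lpnorm p (T f) <= K%:E * Lpnorm p f)%E].

Definition expi (R : realType) (t : R) : R[i] := cos t +i* sin t.

Definition angle (R : realType) (theta : lebesgueR R -> R) : Prop :=
  measurable_fun (Rplus R) theta /\
  forall x, Rplus R x -> 0 < theta x < pi.

Definition integrand (R : realType) (theta1 theta2 : lebesgueR R -> R)
    (f : lebesgueR R -> R[i]) (x y : lebesgueR R) : R[i] :=
  f y / ((x : R)%:C * expi (theta1 x) - (y : R)%:C * expi (- theta2 y)).

Definition Sop (R : realType) (theta1 theta2 : lebesgueR R -> R)
    (f : lebesgueR R -> R[i]) (x : lebesgueR R) : R[i] :=
  cintegral (Rplus R) (integrand theta1 theta2 f x).

(* Main.v *)
Require Import Defs.
From mathcomp Require Import all_boot all_order all_algebra.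
From mathcomp Require Import all_classical all_reals all_analysis.
From mathcomp Require Import complex.
From mathcomp Require Import measurable_realfun ring lra.

Set Implicit Arguments.
Unset Strict Implicit.
Unset Printing Implicit Defensive.

Import Order.TTheory GRing.Theory Num.Theory.
Import numFieldNormedType.Exports.

Local Open Scope classical_set_scope.
Local Open Scope ring_scope.

(** Why the theorem holds.  Put z(x) = x e^(i theta1(x)) and w(y) = y e^(i theta2(y)), two
    families of points of the upper half plane.  The kernel is 1/(z(x) - conj w(y)), and with
    A = Re z - Re w and B = Im z + Im w one has 1/(A + iB) = cpoi A B - i poi A B, where
    poi A B = B/(A^2 + B^2) and cpoi A B = A/(A^2 + B^2) are the Poisson kernel and its
    conjugate.  Hence everything reduces to two real operators, [cauchy_op] for poi and for
    cpoi.  Of the points z(x) and w(y) only one property is used, [admissible]: z(x) lies in a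
    fixed cone above x or above -x.

    A Cauchy integral passes through the real line.  For f >= 0, f not 0, let
    Phi(t + is) = u + iv = \int f(y) i/(t + is - conj w(y)) dy  (u is [transform] of poi, v is
    [transform] of cpoi).  This is holomorphic with positive real part in s >= 0.

    - Along an admissible family the Poisson extension of g at z(x) is at most a constant times
      the maximal function of g at x or at -x ([poisson_le_HL]).  The maximal inequality and
      the layer cake formula make it bounded from L^q(dt) to L^q(dx), for every q > 1, with a
      constant that depends on q alone ([poisson_ext_bounded]).
    - By duality, \int u(t, 0)^p dt <= C \int f^p ([poi_transform_bound]).
    - For 1 < p <= 2, |v|^p <= C1 u^p - C2 Re(Phi^p) wherever u > 0 ([essen_inequality]), and
      the integral of Re(Phi^p) over the real line is 0, by moving the contour to infinity
      ([contour_power]).  So \int |v|^p <= C1 \int u^p ([conjugate_transform_le]).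
    - Poisson integrals reproduce holomorphic functions ([reproducing_poi],
      [reproducing_cpoi]): the operators at x are the Poisson extensions of u(., 0) and v(., 0)
      at z(x), divided by pi, and the first point bounds them once more.
    - For p > 2, [duality] exchanges the roles of z and w, and of p and its conjugate exponent.

    All this is done for bounded f and for families in a compact part of the half plane, where
    the integrals converge and Phi decays like 1/|t + is|, but with constants that do not see
    the truncation ([truncated_bound]); Fatou's lemma removes it ([cauchy_op_nonneg_bound]).
    The sign of f and its real and imaginary parts are dealt with by the triangle inequality. *)

(** * Shifting the line of integration *)

Section contour.
Context {R : realType}.
Notation mu := (@lebesgue_measure R).

Lemma continuous_itv_integrable (f : R -> R) (a b : R) : continuous f ->
  mu.-integrable `[a, b] (EFin \o f).
Proof.
move=> cf; apply: continuous_compact_integrable; first exact: segment_compact.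
by apply: continuous_subspaceT => x; exact: cf.
Qed.

(** Cauchy's theorem on the rectangle with vertices -T, T, T + iT, -T + iT.  The hypotheses on the
    derivatives are the Cauchy-Riemann equation U_s = - V_t, W being the common value; so the
    integral I(s) of U over [-T, T] at height s has derivative - (V(T, s) - V(-T, s)).  The three
    other sides have total length 4T, and there both parts are at most C (1 + T)^-p. *)
Lemma contour_shift (U V W : R -> R -> R) (eta M C p : R) :
  0 < eta ->
  (forall t s : R, - eta < s -> is_derive s (1 : R) (U t) (- W t s)) ->
  (forall t s : R, 0 <= s -> is_derive t (1 : R) (V ^~ s) (W t s)) ->
  (forall s : R, - eta < s -> continuous (U ^~ s)) ->
  (forall s : R, 0 <= s -> continuous (W ^~ s)) ->
  (forall t s : R, - eta < s -> `|W t s| <= M) ->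
  (forall t s : R, 0 <= s -> `|U t s| <= C * (1 + `|t| + s) `^ (- p)) ->
  (forall t s : R, 0 <= s -> `|V t s| <= C * (1 + `|t| + s) `^ (- p)) ->
  0 <= C -> 0 < p ->
  forall T : R, 0 < T ->
  `|\int[mu]_(t in `[- T, T]) U t 0| <= 4 * C * T * (1 + T) `^ (- p).
Proof.
move=> eta0 dU dV cU cW WM UC VC C0 p0 T T0.
have NTT : - T < T by lra.
set c := C * (1 + T) `^ (- p).
have decay (t s : R) : 0 <= s -> 0 <= `|t| -> T <= `|t| + s ->
    C * (1 + `|t| + s) `^ (- p) <= c.
  move=> s0 t0 Tts; rewrite ler_wpM2l// !powRN lef_pV2 ?posrE ?powR_gt0//; try lra.
  by rewrite ge0_ler_powR ?nnegrE //; lra.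
pose I s := \int[mu]_(t in `[- T, T]) U t s.
(* differentiation under the integral sign, then the fundamental theorem of calculus in t; the
   room eta below the real line makes the derivative at s = 0 two-sided *)
have dI (s : R) : 0 <= s <= T -> is_derive s (1 : R) I (- (V T s - V (- T) s)).
  move=> /andP[s0 sT].
  have hs : (`] - eta, T + 1[%classic : set R) s by rewrite /= in_itv/=; lra.
  have mTT : measurable (`[- T, T]%classic : set R) by exact: measurable_itv.
  have int1 x : `] - eta, T + 1[%classic x ->
      mu.-integrable `[- T, T] (EFin \o (U ^~ x)).
    rewrite /= in_itv/= => /andP[h _]; exact/continuous_itv_integrable/cU.
  have der1 x y : `] - eta, T + 1[%classic x -> `[- T, T]%classic y ->
      derivable (U y) x 1.
    by rewrite /= in_itv/= => /andP[h _] _; have [] := dU y x h.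
  have intM : mu.-integrable `[- T, T] (EFin \o (cst `|M|)).
    by apply: continuous_itv_integrable; exact: cst_continuous.
  have dWE x y : - eta < x -> partial1of2 (fun s t => U t s) x y = - W y x.
    by move=> h; rewrite partial1of2E; have [_ ->] := dU y x h.
  have bnd x y : `] - eta, T + 1[%classic x -> `[- T, T]%classic y ->
      `|partial1of2 (fun s t => U t s) x y| <= cst `|M| y.
    rewrite /= in_itv/= => /andP[h _] _; rewrite dWE// normrN.
    by rewrite (le_trans (WM _ _ h))// ler_norm.
  have M0 (y : R) : 0 <= cst `|M| y by rewrite /=.
  split.
    by apply: (@derivable_under_integral R _ _ mu (fun s t => U t s) _ mTT s _ _ hs int1 der1 _ M0 intM bnd).
  have := @differentiation_under_integral R _ _ mu (fun s t => U t s) _ mTT s _ _ hs int1 der1 _ M0 intM bnd.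
  rewrite derive1E => ->.
  have FTC : (\int[mu]_(t in `[(- T)%R, T]) (W t s)%:E = (V T s)%:E - (V (- T)%R s)%:E)%E.
    apply: (@continuous_FTC2 _ (W ^~ s) (V ^~ s)) => //.
    - by apply: continuous_subspaceT => x; exact: cW.
    - split.
      + by move=> x _; have [] := dV x s s0.
      + apply: cvg_at_right_filter; apply: differentiable_continuous.
        by apply/derivable1_diffP; have [] := dV (- T) s s0.
      + apply: cvg_at_left_filter; apply: differentiable_continuous.
        by apply/derivable1_diffP; have [] := dV T s s0.
    - by move=> x _; rewrite derive1E; have [_ ->] := dV x s s0.
  transitivity (\int[mu]_(t in `[- T, T]) (- 1 * W t s)).
    by apply: eq_Rintegral => y _; rewrite dWE ?mulN1r//; lra.
  rewrite RintegralZl//; last exact/continuous_itv_integrable/cW.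
  by rewrite mulN1r /Rintegral FTC.
have I_T : `|I T| <= 2 * T * c.
  rewrite /I; have cUT := cU T.
  have h : - eta < T by lra.
  rewrite (le_trans (le_normr_Rintegral _ _))//; first exact/continuous_itv_integrable/cU.
  apply: (@le_trans _ _ (\int[mu]_(t in `[- T, T]) c)).
    apply: le_Rintegral => //.
    - apply: continuous_itv_integrable => x; apply: continuous_comp; first exact/cU.
      exact: norm_continuous.
    - by apply: continuous_itv_integrable => x; exact: cst_continuous.
    - by move=> x _; apply: (le_trans (UC x T (ltW T0))); apply: decay => //; [lra|rewrite lerDr].
  have muT : mu `[- T, T]%classic = (T - (- T))%:E.
    by rewrite lebesgue_measure_itv/= lte_fin NTT EFinB.
  rewrite Rintegral_cst//.
  have -> : fine (mu `[- T, T]%classic) = T - (- T) := congr1 fine muT.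
  rewrite /c; lra.
(* I(0) = I(T) - I'(s) T for some s: the two vertical sides *)
have [||s s0T] := @MVT R I (fun s => - (V T s - V (- T) s)) 0 T T0.
- by move=> s sT; apply: dI; move: sT; rewrite in_itv/=; lra.
- by apply: derivable_within_continuous => s; rewrite in_itv/= => /dI [].
- rewrite subr0 => E.
  have sT : 0 < s < T by move: s0T; rewrite in_itv.
  have s0 : 0 <= s by lra.
  have V1 : `|V T s| <= c.
    by apply: (le_trans (VC _ _ s0)); apply: decay => //; rewrite gtr0_norm//; lra.
  have V2 : `|V (- T) s| <= c.
    by apply: (le_trans (VC _ _ s0)); apply: decay => //; rewrite normrN gtr0_norm//; lra.
  rewrite -/(I 0); have -> : I 0 = I T - (- (V T s - V (- T) s) * T) by rewrite -E; lra.
  have h : `|- (V T s - V (- T) s) * T| <= 2 * c * T.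
    rewrite normrM normrN (gtr0_norm T0) ler_wpM2r ?(ltW T0)//.
    rewrite (le_trans (ler_normB _ _))//; lra.
  rewrite (le_trans (ler_normB _ _))//.
  rewrite (le_trans (lerD I_T h))// /c; lra.
Qed.

End contour.

(** * Real powers in the right half plane *)

Section complex_power.
Context {R : realType}.
Implicit Types (p u v x : R).

(** [powre p u v] and [powim p u v] are the real and imaginary parts of the principal power
    (u + iv)^p; the argument is an arctangent, so they have this meaning for u > 0. *)
Definition lnmod u v : R := ln (u ^+ 2 + v ^+ 2) / 2.
Definition argm u v : R := atan (v / u).
Definition powre p u v : R := expR (p * lnmod u v) * cos (p * argm u v).
Definition powim p u v : R := expR (p * lnmod u v) * sin (p * argm u v).

Lemma sqrD_gt0 u v : 0 < u -> 0 < u ^+ 2 + v ^+ 2.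
Proof. by move=> u0; rewrite ltr_pwDl ?exprn_gt0 ?sqr_ge0. Qed.

Lemma is_derive_lnmod (u v : R -> R) x (u' v' : R) : 0 < u x ->
  is_derive x (1 : R) u u' -> is_derive x (1 : R) v v' ->
  is_derive x (1 : R) (fun x => lnmod (u x) (v x))
    ((u x * u' + v x * v') / (u x ^+ 2 + v x ^+ 2)).
Proof.
move=> u0 du dv; have r0 := sqrD_gt0 (v x) u0.
have dq : is_derive x (1 : R) (fun x => u x ^+ 2 + v x ^+ 2)
    (2 * (u x * u' + v x * v')).
  apply: is_derive_eq; rewrite /GRing.scale/=; lra.
have dl := @is_derive1_comp R (@ln R) _ x _ _ (is_derive1_ln r0) dq.
have := is_deriveM dl (is_derive_cst (2^-1 : R) x (1 : R)).
move=> /is_derive_eq; apply.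
by rewrite scaler0 add0r /cst /GRing.scale/=; field; lra.
Qed.

Lemma is_derive_argm (u v : R -> R) x (u' v' : R) : 0 < u x ->
  is_derive x (1 : R) u u' -> is_derive x (1 : R) v v' ->
  is_derive x (1 : R) (fun x => argm (u x) (v x))
    ((u x * v' - v x * u') / (u x ^+ 2 + v x ^+ 2)).
Proof.
move=> u0 du dv; have r0 := sqrD_gt0 (v x) u0.
have un0 : u x != 0 by rewrite gt_eqF.
have dV := is_deriveM dv (is_deriveV un0 du).
have := @is_derive1_comp R (@atan R) _ x _ _ (is_derive1_atan _) dV.
move=> /is_derive_eq; apply.
rewrite mulrfctE /GRing.scale/=; field; rewrite un0/=; nra.
Qed.

Lemma is_derive_powre p (u v : R -> R) x (u' v' : R) : 0 < u x ->
  is_derive x (1 : R) u u' -> is_derive x (1 : R) v v' ->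
  is_derive x (1 : R) (fun x => powre p (u x) (v x))
   (p * (powre p (u x) (v x) * ((u x * u' + v x * v') / (u x ^+ 2 + v x ^+ 2))
     - powim p (u x) (v x) * ((u x * v' - v x * u') / (u x ^+ 2 + v x ^+ 2)))).
Proof.
move=> u0 du dv.
have dL := is_derive_lnmod u0 du dv; have dA := is_derive_argm u0 du dv.
have dpL := is_deriveZ p dL; have dpA := is_deriveZ p dA.
have dE := @is_derive1_comp R (@expR R) _ x _ _ (is_derive_expR _) dpL.
have dC := @is_derive1_comp R (@cos R) _ x _ _ (is_derive_cos _) dpA.
have := is_deriveM dE dC.
move=> /is_derive_eq; apply.
rewrite /powre /powim /GRing.scale/=; ring.
Qed.

Lemma is_derive_powim p (u v : R -> R) x (u' v' : R) : 0 < u x ->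
  is_derive x (1 : R) u u' -> is_derive x (1 : R) v v' ->
  is_derive x (1 : R) (fun x => powim p (u x) (v x))
   (p * (powim p (u x) (v x) * ((u x * u' + v x * v') / (u x ^+ 2 + v x ^+ 2))
     + powre p (u x) (v x) * ((u x * v' - v x * u') / (u x ^+ 2 + v x ^+ 2)))).
Proof.
move=> u0 du dv.
have dL := is_derive_lnmod u0 du dv; have dA := is_derive_argm u0 du dv.
have dpL := is_deriveZ p dL; have dpA := is_deriveZ p dA.
have dE := @is_derive1_comp R (@expR R) _ x _ _ (is_derive_expR _) dpL.
have dC := @is_derive1_comp R (@sin R) _ x _ _ (is_derive_sin _) dpA.
have := is_deriveM dE dC.
move=> /is_derive_eq; apply.
rewrite /powre /powim /GRing.scale/=; ring.
Qed.

Lemma expR_lnmod p u v : 0 < u -> expR (p * lnmod u v) = (u ^+ 2 + v ^+ 2) `^ (p / 2).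
Proof.
move=> u0; rewrite /powR gt_eqF ?sqrD_gt0//; congr expR; rewrite /lnmod; lra.
Qed.

Lemma cos_argm u v : 0 < u -> cos (argm u v) = u / Num.sqrt (u ^+ 2 + v ^+ 2).
Proof.
move=> u0; rewrite cos_atan.
have -> : 1 + (v / u) ^+ 2 = (u ^+ 2 + v ^+ 2) / u ^+ 2 by field; lra.
by rewrite sqrtrM ?ltW ?sqrD_gt0// sqrtrV ?sqr_ge0// sqrtr_sqr gtr0_norm// invfM invrK mulrC.
Qed.

Lemma cos_argm_powR p u v : 0 < u ->
  (u ^+ 2 + v ^+ 2) `^ (p / 2) * cos (argm u v) `^ p = u `^ p.
Proof.
move=> u0; have r0 := sqrD_gt0 v u0.
rewrite cos_argm// powRM ?invr_ge0 ?sqrtr_ge0// ?ltW//.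
have -> : (Num.sqrt (u ^+ 2 + v ^+ 2))^-1 `^ p = ((u ^+ 2 + v ^+ 2) `^ (p / 2))^-1.
  rewrite -(powR_inv1 (sqrtr_ge0 _)) -(powR12_sqrt (ltW r0)) -!powRrM -powRN.
  by congr (_ `^ _); lra.
by rewrite mulrCA divff ?mulr1// gt_eqF// powR_gt0.
Qed.

Lemma ler_cos : {in `[0, pi] &, {mono (@cos R) : x y /~ x <= y}}.
Proof. by move=> x y xI yI; rewrite !leNgt ltr_cos. Qed.

(** The inequality on the unit circle.  Since pi/2 < p pi/2 <= pi, cos(p a) is negative near
    a = +-pi/2, and there a multiple of - cos(p a) exceeds 1; away from +-pi/2, cos(a)^p is bounded
    below and a large multiple of it compensates for the other term. *)
Lemma essen_cos_inequality p : 1 < p <= 2 -> exists A B : R, [/\ 0 <= A, 0 <= B &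
  forall a, - (pi / 2) < a < pi / 2 -> 1 <= A * cos a `^ p - B * cos (p * a)].
Proof.
move=> /andP[p1 p2].
have pi0 := pi_gt0 R.
(* the angle that separates the two regimes: p a1 is the midpoint of pi/2 and p pi/2 *)
pose a1 := pi / 2 * ((1 + p) / (2 * p)).
have pa1 : p * a1 = pi * (1 + p) / 4 by rewrite /a1; field; lra.
have a10 : 0 < a1 by rewrite /a1 mulr_gt0 ?divr_gt0//; lra.
have a1pi : a1 < pi / 2.
  by rewrite /a1 -[ltRHS]mulr1 ltr_pM2l ?divr_gt0// ltr_pdivrMr; lra.
have pa1pi : pi / 2 < p * a1 <= pi.
  rewrite pa1; apply/andP; split.
    by rewrite ltr_pdivlMr//; nra.
  by rewrite ler_pdivrMr//; nra.
pose c := - cos (p * a1).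
have c0 : 0 < c.
  rewrite /c oppr_gt0 -(@cos_pihalf R) ltr_cos ?in_itv/=; lra.
have k0 : 0 < cos a1 by rewrite cos_gt0_pihalf//; lra.
have kp0 : 0 < cos a1 `^ p by rewrite powR_gt0.
have C : forall a, 0 <= a < pi / 2 ->
    1 <= (1 + c^-1) / cos a1 `^ p * cos a `^ p - c^-1 * cos (p * a).
  move=> a /andP[a0 api].
  have [aa1|a1a] := leP a a1.
    have h : cos a1 `^ p <= cos a `^ p.
      by rewrite ge0_ler_powR ?nnegrE ?cos_ge0_pihalf//; [lra|lra|lra|rewrite ler_cos ?in_itv/=; lra].
    have h1 : 1 + c^-1 <= (1 + c^-1) / cos a1 `^ p * cos a `^ p.
      rewrite -mulrA -[leLHS]mulr1 ler_pM2l ?ltr_wpDl ?invr_gt0//.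
      by rewrite ler_pdivlMl// mulr1.
    have h2 : c^-1 * cos (p * a) <= c^-1.
      by rewrite -[leRHS]mulr1 ler_pM2l ?invr_gt0// cos_le1.
    lra.
  have h : c <= - cos (p * a).
    rewrite /c lerN2 ler_cos ?in_itv/=; nra.
  have h1 : 1 <= c^-1 * - cos (p * a) by rewrite ler_pdivlMl// mulr1.
  have h2 : 0 <= (1 + c^-1) / cos a1 `^ p * cos a `^ p.
    by rewrite !mulr_ge0 ?powR_ge0 ?invr_ge0 ?powR_ge0// addr_ge0// invr_ge0 ltW.
  lra.
exists ((1 + c^-1) / cos a1 `^ p), c^-1; split.
- by rewrite divr_ge0 ?powR_ge0// addr_ge0// invr_ge0 ltW.
- by rewrite invr_ge0 ltW.
- move=> a /andP[a_l a_r].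
  have [a0|a0] := leP 0 a; first by apply: C; lra.
  by have := C (- a); rewrite mulrN !cosN; apply; lra.
Qed.

(** Both sides are homogeneous of degree p in (u, v), so this is the inequality on the circle. *)
Lemma essen_inequality p : 1 < p <= 2 -> exists A B : R, [/\ 0 < A, 0 <= B &
  forall u v, 0 < u -> `|v| `^ p <= A * u `^ p - B * powre p u v].
Proof.
move=> p12; have [A [B [A0 B0 AB]]] := essen_cos_inequality p12.
exists (A + 1), B; split; [lra|by []|] => u v u0.
have /andP[p1 p2] := p12.
have r0 := sqrD_gt0 v u0.
set r := (u ^+ 2 + v ^+ 2) `^ (p / 2).
have up0 := powR_ge0 u p.
suff : `|v| `^ p <= A * u `^ p - B * powre p u v by lra.
have -> : A * u `^ p - B * powre p u v =
    r * (A * cos (argm u v) `^ p - B * cos (p * argm u v)).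
  rewrite -(cos_argm_powR p v u0) /powre expR_lnmod// -/r; ring.
have vr : `|v| `^ p <= r.
  rewrite (_ : `|v| `^ p = (v ^+ 2) `^ (p / 2)); last first.
    by rewrite -real_normK ?num_real// -powR_mulrn// -powRrM; congr (_ `^ _); lra.
  by rewrite /r ge0_ler_powR ?nnegrE ?sqr_ge0 ?(ltW r0)// ?lerDr ?sqr_ge0//; lra.
apply: (le_trans vr); rewrite -[leLHS]mulr1 ler_wpM2l ?powR_ge0//.
by apply: AB; rewrite atan_gtNpi2 atan_ltpi2.
Qed.

Lemma norm_powre_le p u v : 0 < u -> `|powre p u v| <= (u ^+ 2 + v ^+ 2) `^ (p / 2).
Proof.
move=> u0; rewrite /powre expR_lnmod// normrM ger0_norm ?powR_ge0//.
by rewrite -[leRHS]mulr1 ler_wpM2l ?powR_ge0// ler_norml cos_le1 cos_geN1.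
Qed.

Lemma norm_powim_le p u v : 0 < u -> `|powim p u v| <= (u ^+ 2 + v ^+ 2) `^ (p / 2).
Proof.
move=> u0; rewrite /powim expR_lnmod// normrM ger0_norm ?powR_ge0//.
by rewrite -[leRHS]mulr1 ler_wpM2l ?powR_ge0// ler_norml sin_le1 sin_geN1.
Qed.

End complex_power.

(** * The Poisson kernel and its conjugate *)

Section kernels.
Context {R : realType}.
Implicit Types (A B t s : R).

(** i/(A + iB) = poi A B + i cpoi A B.  Its derivative with respect to A is dpoi + i dcpoi, and by
    the Cauchy-Riemann equations the derivative with respect to B is - dcpoi + i dpoi. *)
Definition poi A B : R := B / (A ^+ 2 + B ^+ 2).
Definition cpoi A B : R := A / (A ^+ 2 + B ^+ 2).
Definition dpoi A B : R := - (2 * A * B) / (A ^+ 2 + B ^+ 2) ^+ 2.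
Definition dcpoi A B : R := (B ^+ 2 - A ^+ 2) / (A ^+ 2 + B ^+ 2) ^+ 2.

Lemma sqrD_gt0r A B : 0 < B -> 0 < A ^+ 2 + B ^+ 2.
Proof. by move=> B0; rewrite ltr_wpDl ?exprn_gt0 ?sqr_ge0. Qed.

Section derivatives.
Variables (a b t s : R).
Let qt t := (t - a) ^+ 2 + (s + b) ^+ 2.
Let qs s := (t - a) ^+ 2 + (s + b) ^+ 2.
Hypothesis B0 : 0 < s + b.

Let r0 : (t - a) ^+ 2 + (s + b) ^+ 2 != 0.
Proof. by rewrite gt_eqF ?sqrD_gt0r. Qed.

Let dA : is_derive t (1 : R) (fun t => t - a) 1.
Proof. by apply: is_derive_eq; rewrite subr0. Qed.

Let dB : is_derive s (1 : R) (fun s => s + b) 1.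
Proof. by apply: is_derive_eq; rewrite addr0. Qed.

Let dqt : is_derive t (1 : R) qt (2 * (t - a)).
Proof. by rewrite /qt /qs; apply: is_derive_eq; rewrite /GRing.scale/=; ring. Qed.

Let dqs : is_derive s (1 : R) qs (2 * (s + b)).
Proof. by rewrite /qt /qs; apply: is_derive_eq; rewrite /GRing.scale/=; ring. Qed.

Lemma is_derive_poi1 : is_derive t (1 : R) (fun t => poi (t - a) (s + b))
  (dpoi (t - a) (s + b)).
Proof.
have := is_deriveM (is_derive_cst (s + b) t (1 : R)) (is_deriveV (f := qt) r0 dqt).
move=> /is_derive_eq; apply; rewrite /dpoi /qt /qs /GRing.scale/= /cst; field.
exact: r0.
Qed.

Lemma is_derive_poi2 : is_derive s (1 : R) (fun s => poi (t - a) (s + b))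
  (- dcpoi (t - a) (s + b)).
Proof.
have := is_deriveM dB (is_deriveV (f := qs) r0 dqs).
move=> /is_derive_eq; apply; rewrite /dcpoi /qt /qs /GRing.scale/=; field.
exact: r0.
Qed.

Lemma is_derive_cpoi1 : is_derive t (1 : R) (fun t => cpoi (t - a) (s + b))
  (dcpoi (t - a) (s + b)).
Proof.
have := is_deriveM dA (is_deriveV (f := qt) r0 dqt).
move=> /is_derive_eq; apply; rewrite /dcpoi /qt /qs /GRing.scale/=; field.
exact: r0.
Qed.

Lemma is_derive_cpoi2 : is_derive s (1 : R) (fun s => cpoi (t - a) (s + b))
  (dpoi (t - a) (s + b)).
Proof.
have := is_deriveM (is_derive_cst (t - a) s (1 : R)) (is_deriveV (f := qs) r0 dqs).
move=> /is_derive_eq; apply; rewrite /dpoi /qt /qs /GRing.scale/= /cst; field.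
exact: r0.
Qed.

Lemma continuous_dpoi1 : {for t, continuous (fun t => dpoi (t - a) (s + b))}.
Proof.
have c1 : {for t, continuous (fun t => t - a)}.
  by apply/differentiable_continuous/derivable1_diffP; case: dA.
have c2 : {for t, continuous qt}.
  by apply/differentiable_continuous/derivable1_diffP; case: dqt.
rewrite /dpoi; apply: cvgM.
  apply: cvgN; apply: cvgM; last exact: cvg_cst.
  by apply: cvgM; first exact: cvg_cst.
apply: cvgV; first by rewrite expf_neq0.
by rewrite exprS expr1; apply: cvgM.
Qed.

Lemma continuous_dcpoi1 : {for t, continuous (fun t => dcpoi (t - a) (s + b))}.
Proof.
have c1 : {for t, continuous (fun t => t - a)}.
  by apply/differentiable_continuous/derivable1_diffP; case: dA.
have c2 : {for t, continuous qt}.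
  by apply/differentiable_continuous/derivable1_diffP; case: dqt.
rewrite /dcpoi; apply: cvgM.
  by apply: cvgB; [exact: cvg_cst|apply: cvgM].
apply: cvgV; first by rewrite expf_neq0.
by apply: cvgM.
Qed.

End derivatives.

Lemma poi_ge0 A B : 0 <= B -> 0 <= poi A B.
Proof. by move=> B0; rewrite divr_ge0 ?addr_ge0 ?sqr_ge0. Qed.

Section bounds.
Variables (A B : R).
Hypothesis B0 : 0 < B.
Let r0 := sqrD_gt0r A B0.

Lemma norm_poi_le : `|poi A B| <= B^-1.
Proof.
rewrite ger0_norm ?poi_ge0 ?(ltW B0)// /poi ler_pdivrMr// ler_pdivlMl//.
by rewrite -expr2 lerDr sqr_ge0.
Qed.

Lemma norm_cpoi_le : `|cpoi A B| <= B^-1.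
Proof.
rewrite /cpoi normrM normfV (gtr0_norm r0) ler_pdivrMr// ler_pdivlMl//.
rewrite -(real_normK (num_real A)).
have := sqr_ge0 (`|A| - B); have := normr_ge0 A; nra.
Qed.

Lemma norm_dpoi_le : `|dpoi A B| <= B ^- 2.
Proof.
rewrite /dpoi normrM normfV normrN (ger0_norm (sqr_ge0 _)) ler_pdivrMr ?exprn_gt0//.
rewrite ler_pdivlMl ?exprn_gt0// !normrM (gtr0_norm B0) normr_nat.
rewrite -(real_normK (num_real A)).
have := sqr_ge0 (`|A| - B); have := normr_ge0 A.
move: (`|A|) => C C0 CB.
have h : 2 * C * B <= C ^+ 2 + B ^+ 2 by nra.
have h0 : 0 <= 2 * C * B by rewrite !mulr_ge0// (ltW B0).
by rewrite [leRHS]expr2 ler_pM ?sqr_ge0// lerDr sqr_ge0.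
Qed.

Lemma norm_dcpoi_le : `|dcpoi A B| <= B ^- 2.
Proof.
rewrite /dcpoi normrM normfV (ger0_norm (sqr_ge0 _)) ler_pdivrMr ?exprn_gt0//.
rewrite ler_pdivlMl ?exprn_gt0// [leRHS]expr2 ler_pM// ?sqr_ge0//.
  by rewrite lerDr sqr_ge0.
by rewrite ler_norml; have := sqr_ge0 A; have := sqr_ge0 B; lra.
Qed.

Lemma poi_le_sum : `|poi A B| <= 2 / (`|A| + B).
Proof.
have h : 0 < `|A| + B by rewrite ltr_wpDl.
rewrite ger0_norm ?poi_ge0 ?(ltW B0)// /poi ler_pdivrMr// mulrAC ler_pdivlMr//.
rewrite -(real_normK (num_real A)).
have := sqr_ge0 (`|A| - B); have := normr_ge0 A; nra.
Qed.

Lemma cpoi_le_sum : `|cpoi A B| <= 2 / (`|A| + B).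
Proof.
have h : 0 < `|A| + B by rewrite ltr_wpDl.
rewrite /cpoi normrM normfV (gtr0_norm r0) ler_pdivrMr// mulrAC ler_pdivlMr//.
rewrite -(real_normK (num_real A)).
have := sqr_ge0 (`|A| - B); have := normr_ge0 A; nra.
Qed.

End bounds.

(** Dominates both 1/B and 1/B^2, hence the kernels and their derivatives, at heights B >= eta. *)
Definition height_bound (eta : R) := eta^-1 + eta ^- 2.

Section height.
Variables (A B eta : R).
Hypotheses (eta0 : 0 < eta) (etaB : eta <= B).

Let B0 : 0 < B. Proof. exact: lt_le_trans etaB. Qed.

Let inv_le : B^-1 <= height_bound eta.
Proof.
rewrite (@le_trans _ _ eta^-1)//; last by rewrite lerDl invr_ge0 sqr_ge0.
by rewrite lef_pV2 ?posrE.
Qed.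

Let inv_sqr_le : B ^- 2 <= height_bound eta.
Proof.
rewrite (@le_trans _ _ (eta ^- 2))//; last by rewrite lerDr invr_ge0 ltW.
by rewrite lef_pV2 ?posrE ?exprn_gt0// lerXn2r ?nnegrE ?(ltW eta0) ?(ltW B0).
Qed.

Lemma poi_le_height : `|poi A B| <= height_bound eta.
Proof. exact: le_trans (norm_poi_le _ B0) inv_le. Qed.

Lemma cpoi_le_height : `|cpoi A B| <= height_bound eta.
Proof. exact: le_trans (norm_cpoi_le _ B0) inv_le. Qed.

Lemma dpoi_le_height : `|dpoi A B| <= height_bound eta.
Proof. exact: le_trans (norm_dpoi_le _ B0) inv_sqr_le. Qed.

Lemma dcpoi_le_height : `|dcpoi A B| <= height_bound eta.
Proof. exact: le_trans (norm_dcpoi_le _ B0) inv_sqr_le. Qed.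

End height.

Definition decay_const (N delta : R) := 2 * (1 + N + delta) / delta.

(** The kernels decay like 1/(|t - a| + s + b); this makes the decay in t + is uniform over
    the poles with |a| <= N and b >= delta. *)
Lemma decay_sum (N delta a b t s : R) : 0 < delta -> 0 <= N ->
  `|a| <= N -> delta <= b -> 0 <= s ->
  2 / (`|t - a| + (s + b)) <= decay_const N delta * (1 + `|t| + s)^-1.
Proof.
move=> d0 N0 aN db s0.
have h1 : 0 < `|t - a| + (s + b) by rewrite ltr_wpDl//; lra.
have t0 := normr_ge0 t.
have h2 : 0 < 1 + `|t| + s by lra.
rewrite ler_pdivrMr// mulrAC ler_pdivlMr// /decay_const mulrAC ler_pdivlMr//.
have h3 : `|t| - N <= `|t - a|.
  by have := lerB_dist t a; lra.
have := normr_ge0 (t - a).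
move: (`|t - a|) (`|t|) t0 h3 {h1 h2} => X T T0 XT X0.
have [TN|NT] := leP T N; nra.
Qed.

End kernels.

Section measurability.
Context {R : realType} d (T : measurableType d) (D : set T).

Lemma measurable_funV (f : T -> R) : measurable_fun D f ->
  measurable_fun D (fun x => (f x)^-1).
Proof.
move=> mf.
have -> : (fun x => (f x)^-1) = (fun x => f x * (f x ^+ 2) `^ (- 1)).
  apply/funext => x; rewrite powR_inv1 ?sqr_ge0//.
  have [->|fx0] := eqVneq (f x) 0; first by rewrite mul0r invr0.
  by rewrite expr2 invfM mulrA divff// mul1r.
apply: measurable_funM => //.
apply: (@measurableT_comp _ _ _ _ _ _ (@powR R ^~ (- 1))); first exact: measurable_powR.
exact: measurable_funX.
Qed.

Lemma measurable_fun_poi (A B : T -> R) : measurable_fun D A -> measurable_fun D B ->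
  measurable_fun D (fun x => poi (A x) (B x)).
Proof.
move=> mA mB; apply: measurable_funM => //; apply: measurable_funV.
by apply: measurable_funD; exact: measurable_funX.
Qed.

Lemma measurable_fun_cpoi (A B : T -> R) : measurable_fun D A -> measurable_fun D B ->
  measurable_fun D (fun x => cpoi (A x) (B x)).
Proof.
move=> mA mB; apply: measurable_funM => //; apply: measurable_funV.
by apply: measurable_funD; exact: measurable_funX.
Qed.

Lemma measurable_fun_dpoi (A B : T -> R) : measurable_fun D A -> measurable_fun D B ->
  measurable_fun D (fun x => dpoi (A x) (B x)).
Proof.
move=> mA mB; apply: measurable_funM.
  apply: measurable_funN; apply: measurable_funM => //; exact: measurable_funM.
apply: measurable_funV; apply: measurable_funX.
by apply: measurable_funD; exact: measurable_funX.
Qed.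

Lemma measurable_fun_dcpoi (A B : T -> R) : measurable_fun D A -> measurable_fun D B ->
  measurable_fun D (fun x => dcpoi (A x) (B x)).
Proof.
move=> mA mB; apply: measurable_funM.
  by apply: measurable_funB; exact: measurable_funX.
apply: measurable_funV; apply: measurable_funX.
by apply: measurable_funD; exact: measurable_funX.
Qed.

End measurability.

(** * Integrals of a kernel against a weight *)

Lemma measurable_powR_comp {R : realType} d (T : measurableType d) (D : set T) (p : R) (h : T -> R) :
  measurable_fun D h -> measurable_fun D (fun x => h x `^ p).
Proof.
by apply: (@measurableT_comp _ _ _ _ _ _ (@powR R ^~ p)); exact: measurable_powR.
Qed.

Lemma bounded_integrable {R : realType} d (T : measurableType d)
    (nu : {measure set T -> \bar R}) (D : set T) (f : T -> R) (M : R) :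
  measurable D -> (nu D < +oo)%E -> measurable_fun D f -> (forall x, D x -> `|f x| <= M) ->
  nu.-integrable D (EFin \o f).
Proof.
move=> mD Dfin mf fM; apply: measurable_bounded_integrable => //.
exists M; split; first exact: num_real.
by move=> x Mx y Dy; exact: le_trans (fM _ Dy) (ltW Mx).
Qed.

Lemma measurable_gt_fun {R : realType} d (T : measurableType d) (f g : T -> R) :
  measurable_fun setT f -> measurable_fun setT g -> measurable [set x | f x < g x].
Proof.
move=> mf mg; have := measurable_fun_ltr mf mg measurableT (_ : measurable [set true]).
by rewrite setTI; apply.
Qed.

Section weighted_integral.
Context {R : realType} d (Y : measurableType d) (nu : {measure set Y -> \bar R}).
Variables (D : set Y) (mD : measurable D) (f : Y -> R).
Hypothesis intf : nu.-integrable D (EFin \o f).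

Lemma integrable_weight (k : Y -> R) (M : R) : measurable_fun D k ->
  (forall y, D y -> `|k y| <= M) -> nu.-integrable D (EFin \o (fun y => f y * k y)).
Proof.
move=> mk kM.
have -> : EFin \o (fun y => f y * k y) = ((EFin \o f) \* (EFin \o k))%E.
  by apply/funext => y /=.
apply: integrableMl => //; exists M; split; first exact: num_real.
by move=> x Mx y Dy; exact: le_trans (kM _ Dy) (ltW Mx).
Qed.

Lemma norm_weight_le (k : Y -> R) (M : R) : measurable_fun D k ->
  (forall y, D y -> 0 <= f y) -> (forall y, D y -> `|k y| <= M) ->
  `|\int[nu]_(y in D) (f y * k y)| <= (\int[nu]_(y in D) f y) * M.
Proof.
move=> mk f0 kM; have ik := integrable_weight mk kM.
rewrite (le_trans (le_normr_Rintegral mD ik))// -RintegralZr//.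
apply: le_Rintegral => //.
- exact: integrable_norm.
- exact: (@integrable_weight (cst M) `|M|).
- by move=> y Dy; rewrite normrM ger0_norm ?f0// ler_wpM2l ?f0// kM.
Qed.

Lemma is_derive_weight (k k' : R -> Y -> R) (x u v M : R) :
  u < x < v ->
  (forall t y, u < t < v -> D y -> is_derive t (1 : R) (k ^~ y) (k' t y)) ->
  (forall t, u < t < v -> measurable_fun D (k t)) ->
  (forall t y, u < t < v -> D y -> `|k t y| <= M) ->
  (forall t y, u < t < v -> D y -> `|k' t y| <= M) ->
  is_derive x (1 : R) (fun t => \int[nu]_(y in D) (f y * k t y))
    (\int[nu]_(y in D) (f y * k' x y)).
Proof.
move=> uxv dk mk kM k'M.
have hx : (`]u, v[%classic : set R) x by rewrite /= in_itv.
have int1 t : `]u, v[%classic t ->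
    nu.-integrable D (EFin \o (fun y => f y * k t y)).
  by rewrite /= in_itv/= => ht; apply: (integrable_weight (mk _ ht)) => y; exact: kM.
have dfk t y : u < t < v -> D y ->
    is_derive t (1 : R) (fun t => f y * k t y) (f y * k' t y).
  move=> ht Dy; have h := dk _ _ ht Dy.
  by have := is_deriveZ (f y) h.
have der1 t y : `]u, v[%classic t -> D y -> derivable (fun t => f y * k t y) t 1.
  by rewrite /= in_itv/= => ht Dy; have [] := dfk _ _ ht Dy.
have dE t y : u < t < v -> D y ->
    partial1of2 (fun t y => f y * k t y) t y = f y * k' t y.
  by move=> ht Dy; rewrite partial1of2E; have [_ ->] := dfk _ _ ht Dy.
have intM : nu.-integrable D (EFin \o (fun y => `|f y| * `|M|)).
  have -> : EFin \o (fun y => `|f y| * `|M|) = abse \o (EFin \o (fun y => f y * M)).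
    by apply/funext => y /=; rewrite normrM.
  by apply: integrable_abse; apply: (@integrable_weight (cst M) `|M|).
have bnd t y : `]u, v[%classic t -> D y ->
    `|partial1of2 (fun t y => f y * k t y) t y| <= `|f y| * `|M|.
  rewrite /= in_itv/= => ht Dy; rewrite dE// normrM ler_wpM2l//.
  by rewrite (le_trans (k'M _ _ ht Dy))// ler_norm.
have M0 y : 0 <= `|f y| * `|M| by rewrite mulr_ge0.
split.
  exact: (@derivable_under_integral R _ _ nu (fun t y => f y * k t y) _ mD x _ _ hx int1 der1 _ M0 intM bnd).
have := @differentiation_under_integral R _ _ nu (fun t y => f y * k t y) _ mD x _ _ hx int1 der1 _ M0 intM bnd.
rewrite derive1E => ->.
by apply: eq_Rintegral => y /set_mem Dy; rewrite dE.
Qed.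

Lemma continuous_weight (k : R -> Y -> R) (M : R) :
  (forall t y, D y -> {for t, continuous (k ^~ y)}) ->
  (forall t, measurable_fun D (k t)) ->
  (forall t y, D y -> `|k t y| <= M) ->
  continuous (fun t => \int[nu]_(y in D) (f y * k t y)).
Proof.
move=> ck mk kM x.
have hx : x \in (`]x - 1, x + 1[%classic : set R) by rewrite inE/= in_itv/=; lra.
have int1 t : `]x - 1, x + 1[%classic t ->
    nu.-integrable D (EFin \o (fun y => f y * k t y)).
  by move=> _; apply: (integrable_weight (mk _)) => y; exact: kM.
have intM : nu.-integrable D (EFin \o (fun y => `|f y| * `|M|)).
  have -> : EFin \o (fun y => `|f y| * `|M|) = abse \o (EFin \o (fun y => f y * M)).
    by apply/funext => y /=; rewrite normrM.
  by apply: integrable_abse; apply: (@integrable_weight (cst M) `|M|).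
have cf : {ae nu, forall y, D y ->
    {in (`]x - 1, x + 1[%classic : set R), continuous (fun t => f y * k t y)}}.
  apply: aeW => y Dy t _; apply: cvgM; first exact: cvg_cst.
  exact: ck.
have bnd t : `]x - 1, x + 1[%classic t ->
    {ae nu, forall y, D y -> `|f y * k t y| <= `|f y| * `|M|}.
  move=> _; apply: aeW => y Dy; rewrite normrM ler_wpM2l//.
  by rewrite (le_trans (kM _ _ Dy))// ler_norm.
exact: (@continuity_under_integral R _ _ nu (fun t y => f y * k t y) _ mD _ _ int1 cf _ intM bnd).
Qed.

End weighted_integral.

(** * Limits of integrals over growing intervals *)

Section limit_lemma.
Context {R : realType}.

Lemma le_cvg_error (F : nat -> \bar R) (e : nat -> R) (L X : \bar R) :
  F n @[n --> \oo] --> L -> e n @[n --> \oo] --> (0 : R) ->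
  (forall n, (F n <= X + (e n)%:E)%E) -> (L <= X)%E.
Proof.
move=> FL e0 FX; case: X FX => [r| |] FX; last 2 first.
- exact: leey.
- have LN : F = cst -oo%E by apply/funext => n; apply/eqP; rewrite -leeNy_eq FX.
  by rewrite -(cvg_lim _ FL)// LN lim_cst.
rewrite -(cvg_lim _ FL)//; have h : (r%:E + (e n)%:E)%E @[n --> \oo] --> r%:E.
  rewrite -[X in _ --> X]adde0; apply: cvgeD => //; first exact: cvg_cst.
  exact: cvg_EFin (nearW _) e0 || by apply/fine_cvgP; split => //; exact: nearW.
rewrite -[leRHS](cvg_lim _ h)//; apply: lee_lim.
- by apply/cvg_ex; exists L.
- by apply/cvg_ex; exists r%:E.
- exact: nearW.
Qed.

(** The bound of [contour_shift] vanishes at infinity: its order is T^(1 - p), and p > 1. *)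
Lemma cvg_decay (c p : R) : 1 < p ->
  c * n.+1%:R * (1 + n.+1%:R) `^ (- p) @[n --> \oo] --> (0 : R).
Proof.
move=> p1; pose g n : R := ((1 + n.+1%:R) `^ (p - 1))^-1.
have p10 : 0 < p - 1 by rewrite subr_gt0.
have g0 n : 0 < (1 + n.+1%:R : R) `^ (p - 1) by rewrite powR_gt0// ltr_wpDr.
have cg : g n @[n --> \oo] --> (0 : R).
  have h : \forall n \near \oo, 0 < (1 + n.+1%:R : R) `^ (p - 1) by exact: nearW.
  suff H : (1 + n.+1%:R : R) `^ (p - 1) @[n --> \oo] --> +oo by exact: ((gtr0_cvgV0 h).2 H).
  apply/cvgryPge => A; near=> n.
  pose B : R := (Num.max A 1) `^ (p - 1)^-1.
  have Am : 0 <= Num.max A 1 by rewrite le_max ler01 orbT.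
  apply: (@le_trans _ _ (B `^ (p - 1))).
    by rewrite /B -powRrM mulVf ?gt_eqF// powRr1// le_max lexx.
  apply: ge0_ler_powR; rewrite ?nnegrE ?powR_ge0 ?(ltW p10) ?addr_ge0//.
  rewrite (@le_trans _ _ n%:R)//; last by rewrite -natr1; lra.
  by near: n; exact: nbhs_infty_ger.
have bnd n : `|c * n.+1%:R * (1 + n.+1%:R) `^ (- p)| <= `|c| * g n.
  rewrite normrM normrM -mulrA ler_wpM2l// ger0_norm ?ler0n// ger0_norm ?powR_ge0//.
  have n0 : 0 < 1 + n.+1%:R :> R by rewrite ltr_wpDr.
  rewrite powRN -(@mulr_powRB1 _ _ p) ?(ltW n0)//; last by lra.
  rewrite invfM mulrA.
  rewrite ler_piMl ?invr_ge0 ?powR_ge0//.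
  by rewrite ler_pdivrMr// mul1r lerDr.
apply/norm_cvg0P; apply: (@squeeze_cvgr _ _ _ _ (cst 0) (fun n => `|c| * g n)).
- by apply: nearW => n; rewrite normr_ge0 bnd.
- exact: cvg_cst.
- by rewrite -(mulr0 `|c|); apply: cvgM => //; exact: cvg_cst.
Unshelve. all: by end_near. Qed.

Lemma cvg_integral_itvNn (f : R -> R) : measurable_fun setT f -> (forall x, 0 <= f x) ->
  (\int[lebesgue_measure]_(t in `[(- n.+1%:R)%R, n.+1%:R]) (f t)%:E)%E @[n --> \oo] -->
  (\int[@lebesgue_measure R]_t (f t)%:E)%E.
Proof.
move=> mf f0; pose I n : set R := `[- n.+1%:R, n.+1%:R]%classic.
have IT : \bigcup_n I n = setT.
  apply/seteqP; split => // x _.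
  have := @bigcup_itvT R true false; rewrite -subTset => /(_ x Logic.I) [n _].
  rewrite /= in_itv/= => /andP[h1 h2]; exists n => //; rewrite /I /= in_itv/=.
  have nn : n%:R <= n.+1%:R :> R by rewrite ler_nat.
  by rewrite (le_trans h2)// (le_trans _ h1)// lerN2.
have := @ge0_nondecreasing_set_cvg_integral _ (measurableTypeR R) R I (EFin \o f) (@lebesgue_measure R).
rewrite IT; apply => //.
- move=> n m nm; rewrite subsetEset => x; rewrite /I /= !in_itv/= => /andP[h1 h2].
  have h : n.+1%:R <= m.+1%:R :> R by rewrite ler_nat.
  by rewrite (le_trans h2)// (le_trans _ h1)// lerN2.
- by move=> n; rewrite /I; exact: measurable_itv.
- by move=> n; apply: measurable_funTS; apply/measurable_EFinP.
- by move=> n x _; rewrite /= lee_fin.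
Qed.

End limit_lemma.

(** With Phi = u + iv and Phi' = e1 + i e2 the left-hand side is the imaginary part of (Phi^p)',
    of modulus at most p |Phi|^(p-1) |Phi'|; as p > 1 it stays bounded near Phi = 0. *)
Lemma power_derivative_le {R : realType} (p u v e1 e2 m : R) : 1 < p -> 0 < u ->
  `|u| <= m -> `|v| <= m -> `|e1| <= m -> `|e2| <= m ->
  `|p * (powim p u v * ((u * e1 + v * e2) / (u ^+ 2 + v ^+ 2))
     + powre p u v * ((u * e2 - v * e1) / (u ^+ 2 + v ^+ 2)))|
   <= p * (4 * m * (2 * m ^+ 2) `^ ((p - 1) / 2)).
Proof.
move=> p1 u0 um vm e1m e2m.
set q := u ^+ 2 + v ^+ 2; have q0 : 0 < q by exact: sqrD_gt0.
have m0 : 0 <= m by exact: le_trans um.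
have qm : q <= 2 * m ^+ 2.
  have hu : u ^+ 2 <= m ^+ 2 by rewrite -[leLHS]real_normK ?num_real// lerXn2r ?nnegrE.
  have hv : v ^+ 2 <= m ^+ 2 by rewrite -[leLHS]real_normK ?num_real// lerXn2r ?nnegrE.
  by rewrite /q; lra.
have sq (w : R) : w ^+ 2 <= q -> `|w| <= q `^ (2^-1).
  move=> wq; rewrite powR12_sqrt ?(ltW q0)// -sqrtr_sqr ler_wsqrtr//.
have uq : `|u| <= q `^ (2^-1) by apply: sq; rewrite /q lerDl sqr_ge0.
have vq : `|v| <= q `^ (2^-1) by apply: sq; rewrite /q lerDr sqr_ge0.
have E : q `^ (p / 2) * (2 * m * q `^ 2^-1 / q) = 2 * m * q `^ ((p - 1) / 2).
  have -> : q `^ (p / 2) = q `^ ((p - 1) / 2) * q `^ 2^-1.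
    by rewrite -powRD; [congr (_ `^ _); lra|rewrite (gt_eqF q0) implybT].
  have qq : q `^ 2^-1 * q `^ 2^-1 = q.
    rewrite -powRD; last by rewrite (gt_eqF q0) implybT.
    by have -> : 2^-1 + 2^-1 = 1 :> R; [lra|rewrite powRr1 ?(ltW q0)].
  transitivity (2 * m * q `^ ((p - 1) / 2) * ((q `^ 2^-1 * q `^ 2^-1) / q)); first ring.
  by rewrite qq divff ?mulr1// gt_eqF.
have term (w z : R) : `|w| <= q `^ (p / 2) -> `|z| <= 2 * m * q `^ 2^-1 ->
    `|w * (z / q)| <= 2 * m * (2 * m ^+ 2) `^ ((p - 1) / 2).
  move=> hw hz; rewrite normrM normrM normfV (gtr0_norm q0).
  apply: (@le_trans _ _ (q `^ (p / 2) * (2 * m * q `^ 2^-1 / q))).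
    by rewrite ler_pM ?mulr_ge0 ?invr_ge0 ?(ltW q0)// ler_wpM2r ?invr_ge0 ?(ltW q0).
  rewrite E ler_wpM2l ?mulr_ge0// ge0_ler_powR ?nnegrE ?divr_ge0 ?(ltW q0) ?mulr_ge0 ?sqr_ge0//.
  by lra.
have sumle (w1 w2 : R) : `|w1| <= m -> `|w2| <= m ->
    `|u * w1 + v * w2| <= 2 * m * q `^ 2^-1.
  move=> h1 h2; rewrite (le_trans (ler_normD _ _))// !normrM.
  have : `|u| * `|w1| <= q `^ 2^-1 * m by rewrite ler_pM.
  have : `|v| * `|w2| <= q `^ 2^-1 * m by rewrite ler_pM.
  by lra.
have t1 := term _ _ (norm_powim_le p v u0) (sumle _ _ e1m e2m).
have Ne1m : `|- e1| <= m by rewrite normrN.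
have t2 := term _ _ (norm_powre_le p v u0) (sumle _ _ e2m Ne1m).
rewrite mulrN in t2.
rewrite normrM gtr0_norm ?(lt_trans _ p1)// ler_wpM2l//; first by lra.
rewrite (le_trans (ler_normD _ _))//; lra.
Qed.

(** * The conjugate of a positive Poisson transform *)

Section cauchy_transform.
Context {R : realType} d (Y : measurableType d) (nu : {measure set Y -> \bar R}).
Variables (D : set Y) (mD : measurable D) (f a b : Y -> R) (N delta : R).
Hypothesis intf : nu.-integrable D (EFin \o f).
Hypothesis f0 : forall y, D y -> 0 <= f y.
Hypotheses (ma : measurable_fun D a) (mb : measurable_fun D b).
Hypothesis aN : forall y, D y -> `|a y| <= N.
Hypothesis bN : forall y, D y -> delta <= b y <= N.
Hypotheses (N0 : 0 <= N) (delta0 : 0 < delta).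
Notation mu := (@lebesgue_measure R).

(** For k = poi and cpoi: the real and imaginary parts of Phi(t + is) =
    \int f(y) i/(t + is - (a y - i b y)) dy, whose poles a y - i b y have height at most - delta. *)
Definition transform (k : R -> R -> R) (t s : R) : R :=
  \int[nu]_(y in D) (f y * k (t - a y) (s + b y)).

Let eta := delta / 2.
Let eta0 : 0 < eta. Proof. by rewrite /eta divr_gt0. Qed.

Let B_ge s y : - eta < s -> D y -> eta <= s + b y.
Proof. by move=> hs /bN; rewrite /eta in hs *; lra. Qed.

Let B_gt0 s y : - eta < s -> D y -> 0 < s + b y.
Proof. by move=> hs Dy; exact: lt_le_trans (B_ge hs Dy). Qed.

Let K := height_bound eta.

Let mta t : measurable_fun D (fun y => t - a y).
Proof. exact: measurable_funB. Qed.

Let msb s : measurable_fun D (fun y => s + b y).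
Proof. exact: measurable_funD. Qed.

Let u := transform poi.
Let v := transform cpoi.
Let d1 := transform dpoi.
Let d2 := transform dcpoi.

Let F := \int[nu]_(y in D) f y.

Let F0 : 0 <= F. Proof. exact: Rintegral_ge0. Qed.

Let near_s s : - eta < s -> - eta < s < s + 1.
Proof. by lra. Qed.

Lemma is_derive_transform_poi1 t s : - eta < s ->
  is_derive t (1 : R) (u ^~ s) (d1 t s).
Proof.
move=> hs; rewrite /u /d1 /transform.
apply: (@is_derive_weight _ _ _ nu D mD f intf (fun t y => poi (t - a y) (s + b y))
  (fun t y => dpoi (t - a y) (s + b y)) t (t - 1) (t + 1) K); first by lra.
- by move=> x y _ Dy; apply: is_derive_poi1; exact: B_gt0.
- by move=> x _; exact: measurable_fun_poi.
- by move=> x y _ Dy; exact: poi_le_height (B_ge hs Dy).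
- by move=> x y _ Dy; exact: dpoi_le_height (B_ge hs Dy).
Qed.

Lemma is_derive_transform_cpoi1 t s : - eta < s ->
  is_derive t (1 : R) (v ^~ s) (d2 t s).
Proof.
move=> hs; rewrite /v /d2 /transform.
apply: (@is_derive_weight _ _ _ nu D mD f intf (fun t y => cpoi (t - a y) (s + b y))
  (fun t y => dcpoi (t - a y) (s + b y)) t (t - 1) (t + 1) K); first by lra.
- by move=> x y _ Dy; apply: is_derive_cpoi1; exact: B_gt0.
- by move=> x _; exact: measurable_fun_cpoi.
- by move=> x y _ Dy; exact: cpoi_le_height (B_ge hs Dy).
- by move=> x y _ Dy; exact: dcpoi_le_height (B_ge hs Dy).
Qed.

Lemma is_derive_transform_poi2 t s : - eta < s ->
  is_derive s (1 : R) (u t) (- d2 t s).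
Proof.
move=> hs; have -> : - d2 t s = \int[nu]_(y in D) (f y * - dcpoi (t - a y) (s + b y)).
  rewrite /d2 /transform -mulN1r -RintegralZl//; last first.
    apply: (@integrable_weight _ _ _ nu D mD f intf _ K).
      exact: measurable_fun_dcpoi.
    by move=> y Dy; exact: dcpoi_le_height (B_ge hs Dy).
  by apply: eq_Rintegral => y _; rewrite mulrN mulN1r.
rewrite /u /transform.
apply: (@is_derive_weight _ _ _ nu D mD f intf (fun s y => poi (t - a y) (s + b y))
  (fun s y => - dcpoi (t - a y) (s + b y)) s (- eta) (s + 1) K); first exact: near_s.
- by move=> x y /andP[hx _] Dy; apply: is_derive_poi2; exact: B_gt0.
- by move=> x _; exact: measurable_fun_poi.
- by move=> x y /andP[hx _] Dy; exact: poi_le_height (B_ge hx Dy).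
- by move=> x y /andP[hx _] Dy; rewrite normrN; exact: dcpoi_le_height (B_ge hx Dy).
Qed.

Lemma is_derive_transform_cpoi2 t s : - eta < s ->
  is_derive s (1 : R) (v t) (d1 t s).
Proof.
move=> hs; rewrite /v /d1 /transform.
apply: (@is_derive_weight _ _ _ nu D mD f intf (fun s y => cpoi (t - a y) (s + b y))
  (fun s y => dpoi (t - a y) (s + b y)) s (- eta) (s + 1) K); first exact: near_s.
- by move=> x y /andP[hx _] Dy; apply: is_derive_cpoi2; exact: B_gt0.
- by move=> x _; exact: measurable_fun_cpoi.
- by move=> x y /andP[hx _] Dy; exact: cpoi_le_height (B_ge hx Dy).
- by move=> x y /andP[hx _] Dy; exact: dpoi_le_height (B_ge hx Dy).
Qed.

Lemma continuous_transform_dpoi s : - eta < s -> continuous (d1 ^~ s).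
Proof.
move=> hs; apply: (@continuous_weight _ _ _ nu D mD f intf
  (fun t y => dpoi (t - a y) (s + b y)) K).
- by move=> t y Dy; apply: continuous_dpoi1; exact: B_gt0.
- by move=> t; exact: measurable_fun_dpoi.
- by move=> t y Dy; exact: dpoi_le_height (B_ge hs Dy).
Qed.

Lemma continuous_transform_dcpoi s : - eta < s -> continuous (d2 ^~ s).
Proof.
move=> hs; apply: (@continuous_weight _ _ _ nu D mD f intf
  (fun t y => dcpoi (t - a y) (s + b y)) K).
- by move=> t y Dy; apply: continuous_dcpoi1; exact: B_gt0.
- by move=> t; exact: measurable_fun_dcpoi.
- by move=> t y Dy; exact: dcpoi_le_height (B_ge hs Dy).
Qed.

Lemma continuous_transform_poi s : - eta < s -> continuous (u ^~ s).
Proof.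
move=> hs t; apply/differentiable_continuous/derivable1_diffP.
by have [] := is_derive_transform_poi1 t hs.
Qed.

Lemma continuous_transform_cpoi s : - eta < s -> continuous (v ^~ s).
Proof.
move=> hs t; apply/differentiable_continuous/derivable1_diffP.
by have [] := is_derive_transform_cpoi1 t hs.
Qed.

Lemma transform_bounds t s : - eta < s ->
  [/\ `|u t s| <= F * K, `|v t s| <= F * K, `|d1 t s| <= F * K & `|d2 t s| <= F * K].
Proof.
move=> hs; split; apply: (norm_weight_le mD intf) => //.
- exact: measurable_fun_poi.
- by move=> y Dy; exact: poi_le_height (B_ge hs Dy).
- exact: measurable_fun_cpoi.
- by move=> y Dy; exact: cpoi_le_height (B_ge hs Dy).
- exact: measurable_fun_dpoi.
- by move=> y Dy; exact: dpoi_le_height (B_ge hs Dy).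
- exact: measurable_fun_dcpoi.
- by move=> y Dy; exact: dcpoi_le_height (B_ge hs Dy).
Qed.

Let H := decay_const N delta.

Lemma transform_decay t s : 0 <= s ->
  `|u t s| <= F * H * (1 + `|t| + s)^-1 /\ `|v t s| <= F * H * (1 + `|t| + s)^-1.
Proof.
move=> s0; have hs : - eta < s by rewrite (lt_le_trans _ s0)// oppr_lt0.
have db y : D y -> 2 / (`|t - a y| + (s + b y)) <= H * (1 + `|t| + s)^-1.
  by move=> Dy; have /andP[b1 b2] := bN Dy; exact: (decay_sum _ delta0 N0 (aN Dy) b1 s0).
rewrite -(mulrA F H); split; apply: (norm_weight_le mD intf) => //.
- exact: measurable_fun_poi.
- by move=> y Dy; rewrite (le_trans (poi_le_sum (t - a y) (B_gt0 hs Dy)))// db.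
- exact: measurable_fun_cpoi.
- by move=> y Dy; rewrite (le_trans (cpoi_le_sum (t - a y) (B_gt0 hs Dy)))// db.
Qed.

(** On D the poles stay in a compact set, so the Poisson kernel has a positive minimum c there and
    u >= c \int f.  Strict positivity keeps Phi in the domain of the principal power. *)
Lemma transform_poi_gt0 t s : 0 < F -> - eta < s -> 0 < u t s.
Proof.
move=> Fpos hs; pose c := eta / ((`|t| + N) ^+ 2 + (`|s| + N) ^+ 2).
have [N00|NN0] := eqVneq N 0.
  have D0 : D = set0.
    by apply/seteqP; split => // y Dy; have := bN Dy; rewrite N00; have := delta0; lra.
  by move: Fpos; rewrite /F D0 Rintegral_set0 ltxx.
have Npos : 0 < N by rewrite lt_neqAle eq_sym NN0.
have q0 : 0 < (`|t| + N) ^+ 2 + (`|s| + N) ^+ 2.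
  by rewrite addr_gt0// exprn_gt0// ltr_wpDl.
have c0 : 0 < c by rewrite divr_gt0.
have ik : nu.-integrable D (EFin \o (fun y => f y * poi (t - a y) (s + b y))).
  apply: (integrable_weight mD intf (M := K)); first exact: measurable_fun_poi.
  by move=> y Dy; exact: poi_le_height (B_ge hs Dy).
apply: (@lt_le_trans _ _ (F * c)); first exact: mulr_gt0.
rewrite /F -RintegralZr//.
apply: le_Rintegral => //; first exact: (@integrable_weight _ _ _ nu D mD f intf (cst c) `|c|).
move=> y Dy; rewrite ler_wpM2l ?f0// /c /poi.
have Bge := B_ge hs Dy; have Bgt := B_gt0 hs Dy.
rewrite ler_pM ?invr_ge0 ?(ltW q0) ?(ltW eta0)//.
rewrite lef_pV2 ?posrE ?q0 ?(sqrD_gt0r _ Bgt)//; apply: lerD.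
  rewrite -[leLHS]real_normK ?num_real// lerXn2r ?nnegrE ?addr_ge0//.
  by rewrite (le_trans (ler_normB _ _))// lerD2l aN.
rewrite lerXn2r ?nnegrE ?(ltW Bgt) ?addr_ge0//.
by have /andP[_ h] := bN Dy; rewrite lerD// ler_norm.
Qed.

Section power.
Variable p : R.
Hypothesis p12 : 1 < p <= 2.
Hypothesis Fpos : 0 < F.

Let p1 : 1 < p. Proof. by case/andP: p12. Qed.
Let U t s := powre p (u t s) (v t s).
Let V t s := powim p (u t s) (v t s).
Let q t s := u t s ^+ 2 + v t s ^+ 2.
Let W t s := p * (V t s * ((u t s * d1 t s + v t s * d2 t s) / q t s)
   + U t s * ((u t s * d2 t s - v t s * d1 t s) / q t s)).

Let q_gt0 t s : - eta < s -> 0 < q t s.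
Proof. by move=> hs; rewrite sqrD_gt0// transform_poi_gt0. Qed.

Let dU t s : - eta < s -> is_derive s (1 : R) (U t) (- W t s).
Proof.
move=> hs; have u0 := transform_poi_gt0 t Fpos hs.
apply: is_derive_eq (is_derive_powre p u0 (is_derive_transform_poi2 t hs) (is_derive_transform_cpoi2 t hs)) _.
by rewrite /W /U /V /q; ring.
Qed.

Let dU1 t s : - eta < s -> derivable (U ^~ s) t 1.
Proof.
move=> hs; have u0 := transform_poi_gt0 t Fpos hs.
by have [] := @is_derive_powre _ p (u ^~ s) (v ^~ s) t _ _ u0 (is_derive_transform_poi1 t hs) (is_derive_transform_cpoi1 t hs).
Qed.

Let dV t s : - eta < s -> is_derive t (1 : R) (V ^~ s) (W t s).
Proof.
move=> hs; have u0 := transform_poi_gt0 t Fpos hs.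
exact: (@is_derive_powim _ p (u ^~ s) (v ^~ s) t _ _ u0 (is_derive_transform_poi1 t hs) (is_derive_transform_cpoi1 t hs)).
Qed.

Let cU s : - eta < s -> continuous (U ^~ s).
Proof. by move=> hs t; apply/differentiable_continuous/derivable1_diffP/dU1. Qed.

Let cV s : - eta < s -> continuous (V ^~ s).
Proof.
by move=> hs t; apply/differentiable_continuous/derivable1_diffP; have [] := dV t hs.
Qed.

Let cW s : - eta < s -> continuous (W ^~ s).
Proof.
move=> hs t; have cu : {for t, continuous (u ^~ s)} by exact: continuous_transform_poi.
have cv : {for t, continuous (v ^~ s)} by exact: continuous_transform_cpoi.
have c1 : {for t, continuous (d1 ^~ s)} by exact: continuous_transform_dpoi.
have c2 : {for t, continuous (d2 ^~ s)} by exact: continuous_transform_dcpoi.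
have cq : (q x s)^-1 @[x --> t] --> (q t s)^-1.
  apply: cvgV; first by rewrite gt_eqF// q_gt0.
  by rewrite /q; apply: cvgD; rewrite expr2; apply: cvgM.
rewrite /W; apply: cvgM; first exact: cvg_cst.
apply: cvgD; apply: cvgM; [exact: cV| |exact: cU|].
  by apply: cvgM => //; apply: cvgD; apply: cvgM.
by apply: cvgM => //; apply: cvgB; apply: cvgM.
Qed.

Let W_le t s : - eta < s ->
  `|W t s| <= p * (4 * (F * K) * (2 * (F * K) ^+ 2) `^ ((p - 1) / 2)).
Proof.
move=> hs; have [ub vb d1b d2b] := transform_bounds t hs.
exact: power_derivative_le (transform_poi_gt0 t Fpos hs) ub vb d1b d2b.
Qed.

Let C := (2 * (F * H) ^+ 2) `^ (p / 2).

(* |Phi|^p decays like |t + is|^-p, which is what [contour_shift] asks for *)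
Let q_le t s : 0 <= s -> (q t s) `^ (p / 2) <= C * (1 + `|t| + s) `^ (- p).
Proof.
move=> s0; have [ub vb] := transform_decay t s0.
set X := 1 + `|t| + s in ub vb *.
have X0 : 0 < X by rewrite /X -addrA ltr_pwDl// addr_ge0.
have hs : - eta < s by rewrite (lt_le_trans _ s0)// oppr_lt0.
have H0 : 0 <= H by rewrite /H /decay_const !mulr_ge0 ?addr_ge0 ?invr_ge0 ?(ltW delta0).
have FX0 : 0 <= F * H * X^-1 by apply: (mulr_ge0 (mulr_ge0 F0 H0)); rewrite invr_ge0 ltW.
have -> : C * X `^ (- p) = (2 * (F * H * X^-1) ^+ 2) `^ (p / 2).
  have -> : 2 * (F * H * X^-1) ^+ 2 = (2 * (F * H) ^+ 2) * X^-1 ^+ 2 by rewrite exprMn mulrA.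
  have h2 (w : R) : 0 <= 2 * w ^+ 2 by rewrite mulr_ge0 ?sqr_ge0.
  rewrite powRM ?h2 ?sqr_ge0// /C; congr (_ * _).
  rewrite -powR_mulrn ?invr_ge0 ?(ltW X0)// -(powR_inv1 (ltW X0)) -!powRrM.
  by congr (_ `^ _); field.
apply: ge0_ler_powR; rewrite ?nnegrE ?(ltW (q_gt0 t hs)) ?(mulr_ge0 _ (sqr_ge0 _))//.
  by move: p1; lra.
have hu : u t s ^+ 2 <= (F * H * X^-1) ^+ 2.
  by rewrite -[leLHS]real_normK ?num_real// lerXn2r ?nnegrE.
have hv : v t s ^+ 2 <= (F * H * X^-1) ^+ 2.
  by rewrite -[leLHS]real_normK ?num_real// lerXn2r ?nnegrE.
by rewrite /q; lra.
Qed.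

(** Cauchy's theorem for Phi^p. *)
Lemma contour_power T : 0 < T ->
  `|\int[mu]_(t in `[- T, T]) powre p (u t 0) (v t 0)| <= 4 * C * T * (1 + T) `^ (- p).
Proof.
apply: (@contour_shift R U V W eta _ C p) => //.
- by move=> t s s0; apply: dV; rewrite (lt_le_trans _ s0)// oppr_lt0.
- by move=> s s0; apply: cW; rewrite (lt_le_trans _ s0)// oppr_lt0.
- exact: W_le.
- move=> t s s0; have hs : - eta < s by rewrite (lt_le_trans _ s0)// oppr_lt0.
  by rewrite (le_trans (norm_powre_le _ _ (transform_poi_gt0 _ _ _)))// q_le.
- move=> t s s0; have hs : - eta < s by rewrite (lt_le_trans _ s0)// oppr_lt0.
  by rewrite (le_trans (norm_powim_le _ _ (transform_poi_gt0 _ _ _)))// q_le.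
- exact: powR_ge0.
- by move: p1; lra.
Qed.

End power.

(** Integrate the pointwise inequality over [-T, T]: the integral of Re(Phi^p) is an error term
    that disappears as T tends to infinity. *)
Lemma conjugate_transform_le (p A B : R) : 1 < p <= 2 -> 0 < A -> 0 <= B ->
  (forall u v, 0 < u -> `|v| `^ p <= A * u `^ p - B * powre p u v) ->
  (\int[mu]_t (`|v t 0| `^ p)%:E <= A%:E * \int[mu]_t (u t 0 `^ p)%:E)%E.
Proof.
move=> p12 A0 B0 AB; have /andP[p1 p2] := p12.
have h0 : - eta < 0 by rewrite oppr_lt0.
have cu : continuous (u ^~ 0) by exact: continuous_transform_poi.
have cv : continuous (v ^~ 0) by exact: continuous_transform_cpoi.
have mup : measurable_fun setT (fun t => u t 0 `^ p).
  by apply: measurable_powR_comp; exact: continuous_measurable_fun.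
have mvp : measurable_fun setT (fun t => `|v t 0| `^ p).
  apply: measurable_powR_comp.
  by apply: measurableT_comp => //; exact: continuous_measurable_fun.
have bnd t : `|u t 0| <= F * K /\ `|v t 0| <= F * K by have [] := transform_bounds t h0.
have up_ge0 : (0 <= \int[mu]_t (u t 0 `^ p)%:E)%E.
  by apply: integral_ge0 => t _; rewrite lee_fin powR_ge0.
(* if \int f = 0 the power is not defined, but then v = 0 *)
move: F0; rewrite le_eqVlt => /predU1P[F00|Fpos].
  rewrite (eq_integral (cst 0%E)) ?integral0 ?mule_ge0 ?lee_fin ?(ltW A0)// => t _.
  have [_] := bnd t; rewrite -F00 mul0r normr_le0 => /eqP ->.
  by rewrite normr0 powR0// gt_eqF//; lra.
pose C := (2 * (F * H) ^+ 2) `^ (p / 2).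
apply: (le_cvg_error (cvg_integral_itvNn mvp (fun t => powR_ge0 _ _))
  (@cvg_decay R (B * (4 * C)) p p1)) => n.
set T : R := n.+1%:R; have T0 : 0 < T by rewrite ltr0n.
have mI : measurable (`[- T, T]%classic : set (measurableTypeR R)) by exact: measurable_itv.
have muI : (mu (`[(- T)%R, T]%classic : set R) < +oo)%E.
  by rewrite [X in (X < _)%E]lebesgue_measure_itv/= -EFinD; case: ifP; rewrite ltry.
have FK0 : 0 <= F * K by rewrite (le_trans _ (bnd 0).1).
have iu : mu.-integrable `[- T, T] (EFin \o (fun t => u t 0 `^ p)).
  apply: (bounded_integrable (M := (F * K) `^ p)) => //; first exact: measurable_funTS.
  move=> t _; rewrite ger0_norm ?powR_ge0//.
  have u0 := transform_poi_gt0 t Fpos h0.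
  rewrite ge0_ler_powR ?nnegrE ?(ltW u0)//; first by lra.
  by rewrite (le_trans (ler_norm _))// (bnd t).1.
have iv : mu.-integrable `[- T, T] (EFin \o (fun t => `|v t 0| `^ p)).
  apply: (bounded_integrable (M := (F * K) `^ p)) => //; first exact: measurable_funTS.
  move=> t _; rewrite ger0_norm ?powR_ge0//.
  by rewrite ge0_ler_powR ?nnegrE// ?(bnd t).2//; lra.
have iU : mu.-integrable `[- T, T] (EFin \o (fun t => powre p (u t 0) (v t 0))).
  apply: continuous_itv_integrable => t.
  apply/differentiable_continuous/derivable1_diffP.
  by have [] := @is_derive_powre _ p (u ^~ 0) (v ^~ 0) t _ _ (transform_poi_gt0 t Fpos h0)
    (is_derive_transform_poi1 t h0) (is_derive_transform_cpoi1 t h0).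
have iAu : mu.-integrable `[- T, T] (EFin \o (fun t => A * u t 0 `^ p)).
  by apply: (eq_integrable mI _ _ _ (integrableZl mI A iu)) => t _; rewrite /= EFinM.
have iBU : mu.-integrable `[- T, T] (EFin \o (fun t => B * powre p (u t 0) (v t 0))).
  by apply: (eq_integrable mI _ _ _ (integrableZl mI B iU)) => t _; rewrite /= EFinM.
apply: (@le_trans _ _ (\int[mu]_(t in `[(- T)%R, T])
    ((A * u t 0 `^ p)%:E - (B * powre p (u t 0) (v t 0))%:E))%E).
  apply: le_integral => //; first exact: (integrableB mI iAu iBU).
  move=> t _; rewrite -EFinB lee_fin; apply: AB; exact: transform_poi_gt0.
rewrite (integralB_EFin mI iAu iBU); apply: leeD.
  under eq_integral do rewrite EFinM.
  rewrite ge0_integralZl_EFin ?(ltW A0)//; last first.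
  - by apply/measurable_EFinP; exact: measurable_funTS.
  - by move=> t _; rewrite lee_fin powR_ge0.
  rewrite lee_wpmul2l ?lee_fin ?(ltW A0)//; apply: ge0_subset_integral => //.
  - by apply/measurable_EFinP.
  - by move=> t _; rewrite lee_fin powR_ge0.
have := contour_power p12 Fpos T0.
have -> : (\int[mu]_(t in `[(- T)%R, T]) (B * powre p (u t 0) (v t 0))%:E)%E =
    (B * \int[mu]_(t in `[- T, T]) powre p (u t 0) (v t 0))%:E.
  rewrite -RintegralZl// fineK//.
  exact: (integrable_fin_num mI iBU).
rewrite ler_norml => /andP[h _]; rewrite -EFinN lee_fin; cbv beta.
rewrite -mulrN (_ : B * (4 * C) * T * _ = B * (4 * C * T * (1 + T) `^ (- p))); last by ring.
by rewrite ler_wpM2l// lerNl.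
Qed.

End cauchy_transform.

(** * From weak type to strong type *)

Section power_integral.
Context {R : realType}.
Notation mu := (@lebesgue_measure R).

Lemma integral_powR (b q : R) : 0 <= b -> 0 < q ->
  (\int[mu]_(l in `]0%R, b[) (l `^ (q - 1))%:E = (b `^ q / q)%:E)%E.
Proof.
move=> b0 q0; move: b0; rewrite le_eqVlt => /predU1P[<-|b0].
  by rewrite set_itvoo0 integral_set0 powR0 ?mul0r// gt_eqF.
pose e n : R := b / n.+2%:R.
have e0 n : 0 < e n by rewrite divr_gt0.
have eb n : e n < b by rewrite /e ltr_pdivrMr// ltr_pMr// ltr1n.
pose I n : set (measurableTypeR R) := `[e n, b[%classic.
have IE : \bigcup_n I n = `]0%R, b[%classic.
  apply/seteqP; split => [x [n _]|x].
    by rewrite /I /= !in_itv/= => /andP[h ->]; rewrite andbT (lt_le_trans _ h).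
  rewrite /= in_itv/= => /andP[x0 xb].
  exists (Num.truncn (b / x)) => //; rewrite /I /= in_itv/= xb andbT.
  rewrite /e ler_pdivrMr// mulrC -ler_pdivrMr//.
  have := truncnS_gt (b / x) => /ltW h; apply: (le_trans h).
  by rewrite ler_nat.
have intI n : (\int[mu]_(l in I n) (l `^ (q - 1))%:E = (b `^ q / q - e n `^ q / q)%:E)%E.
  rewrite /I integral_itv_bndo_bndc; last first.
    apply: measurable_funTS; apply/measurable_EFinP; exact: measurable_powR.
  have dF x : e n <= x -> is_derive x (1 : R) (fun x => x `^ q / q) (x `^ (q - 1)).
    move=> ex; have x0 : 0 < x by exact: lt_le_trans ex.
    have h := is_derive1_powR q x0.
    have := is_deriveM h (is_derive_cst (q^-1 : R) x (1 : R)).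
    move=> /is_derive_eq; apply.
    by rewrite /cst /GRing.scale/=; field; rewrite gt_eqF.
  apply: (@continuous_FTC2 _ (fun x => x `^ (q - 1)) (fun x => x `^ q / q)) => //.
  - apply: derivable_within_continuous => x; rewrite in_itv/= => /andP[ex _].
    by apply: derivable_powR; rewrite in_itv/= andbT (lt_le_trans _ ex).
  - split.
    + by move=> x; rewrite in_itv/= => /andP[/ltW ex _]; have [] := dF x ex.
    + apply: cvg_at_right_filter.
      suff : {for e n, continuous (fun x => x `^ q / q)} by [].
      by apply/differentiable_continuous/derivable1_diffP; have [] := dF (e n) (lexx _).
    + apply: cvg_at_left_filter.
      suff : {for b, continuous (fun x => x `^ q / q)} by [].
      by apply/differentiable_continuous/derivable1_diffP; have [] := dF b (ltW (eb n)).
  - move=> x; rewrite in_itv/= => /andP[/ltW ex _].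
    by rewrite derive1E; have [_ ->] := dF x ex.
have c1 : (\int[mu]_(l in I n) (l `^ (q - 1))%:E)%E @[n --> \oo] -->
    (\int[mu]_(l in `]0%R, b[) (l `^ (q - 1))%:E)%E.
  rewrite -IE; apply: ge0_nondecreasing_set_cvg_integral => //.
  - move=> n m nm; rewrite subsetEset => x; rewrite /I /= !in_itv/= => /andP[h ->].
    rewrite andbT (le_trans _ h)// /e ler_pM2l// lef_pV2 ?posrE// ler_nat.
    by rewrite !ltnS.
  - move=> n; exact: measurable_itv.
  - move=> n; apply: measurable_funTS; apply/measurable_EFinP; exact: measurable_powR.
  - by move=> n x _; rewrite lee_fin powR_ge0.
have ce : e n @[n --> \oo] --> (0 : R).
  rewrite -(mulr0 b); apply: cvgM; first exact: cvg_cst.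
  have := @cvg_harmonic R; rewrite -(cvg_shiftn 1) /=.
  by under eq_fun do rewrite addn1.
have ceq : e n `^ q @[n --> \oo] --> (0 : R).
  exact: ((cvg_at_rightP _ _ _).1 (powR_cvg0 q0) e (conj e0 ce)).
rewrite -(cvg_lim _ c1)//; apply/cvg_lim => //.
under eq_fun do rewrite intI.
apply: cvg_EFin; first exact: nearW.
rewrite -[X in _ --> X]subr0; apply: cvgB; first exact: cvg_cst.
by rewrite -(mul0r q^-1); apply: cvgM => //; exact: cvg_cst.
Qed.

Lemma integral_powR_indic (b q : R) : 0 <= b -> 0 < q ->
  (\int[mu]_l (\1_`]0%R, b[ l * l `^ (q - 1))%:E = (b `^ q / q)%:E)%E.
Proof.
move=> b0 q0; rewrite -(integral_powR b0 q0) [RHS]integral_mkcond.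
apply: eq_integral => l _; rewrite patchE indicE.
by case: ifPn => _; rewrite ?mul1r ?mul0r.
Qed.

End power_integral.

Section weak_to_strong.
Context {R : realType}.
Context d1 (X : measurableType d1) (muX : {sigma_finite_measure set X -> \bar R}).
Context d2 (Y : measurableType d2) (muY : {sigma_finite_measure set Y -> \bar R}).
Notation mu := (@lebesgue_measure R).
Variables (h : X -> R) (g : Y -> R) (A c q : R).
Hypotheses (mh : measurable_fun setT h) (mg : measurable_fun setT g).
Hypotheses (h0 : forall x, 0 <= h x) (g0 : forall y, 0 <= g y).
Hypotheses (A0 : 0 <= A) (c0 : 0 < c) (q1 : 1 < q).
Hypothesis weak : forall l : R, 0 < l ->
  (muX [set x | (l < h x)%R] <= (A / l)%:E * \int[muY]_(y in [set y | (c * l < g y)%R]) (g y)%:E)%E.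

Let measurable_hypograph d (T : measurableType d) (k : T -> R) : measurable_fun setT k ->
  measurable [set z : T * measurableTypeR R | 0 < z.2 < k z.1].
Proof.
move=> mk; have -> : [set z : T * measurableTypeR R | 0 < z.2 < k z.1] =
    [set z | 0 < z.2] `&` [set z | z.2 < k z.1].
  by apply/seteqP; split => z /= => [/andP[]|[-> ->]].
have m1 : measurable_fun setT (fun z : T * measurableTypeR R => z.2 : R) by exact: measurable_snd.
have m2 : measurable_fun setT (fun z : T * measurableTypeR R => k z.1).
  by apply: (measurableT_comp mk); exact: measurable_fst.
apply: measurableI.
  exact: (measurable_gt_fun (measurable_cst (0 : R)) m1).
exact: measurable_gt_fun.
Qed.

(** Integrate the hypothesis against q l^(q-1) dl.  By the layer cake formula, Fubini's theorem for
    the regions under the graphs of h and of g/c, the left-hand side becomes \int h^q; on the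
    right the integral in l of l^(q-2) over 0 < l < g/c leaves a multiple of g (g/c)^(q-1). *)
Lemma weak_to_strong : (\int[muX]_x (h x `^ q)%:E <=
  (q / (q - 1) * A * c `^ (1 - q))%:E * \int[muY]_y (g y `^ q)%:E)%E.
Proof.
have q0 : 0 < q := lt_trans ltr01 q1.
have q10 : 0 < q - 1 by rewrite subr_gt0.
pose E := [set z : X * measurableTypeR R | 0 < z.2 < h z.1].
pose G := [set z : Y * measurableTypeR R | 0 < z.2 < g z.1 / c].
have mE : measurable E by exact: measurable_hypograph.
have mG : measurable G by apply: (@measurable_hypograph _ _ (fun y => g y / c)); apply: measurable_funM.
pose phi (z : X * measurableTypeR R) := (q * (\1_E z * z.2 `^ (q - 1)))%:E.
pose psi (z : Y * measurableTypeR R) := (q * A * g z.1 * (\1_G z * z.2 `^ (q - 1 - 1)))%:E.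
have mpow d (T : measurableType d) r :
    measurable_fun setT (fun z : T * measurableTypeR R => z.2 `^ r).
  by apply: measurable_powR_comp; exact: measurable_snd.
have mphi : measurable_fun setT phi.
  apply/measurable_EFinP; apply: measurable_funM => //.
  by apply: measurable_funM; [exact: measurable_indic|exact: mpow].
have mpsi : measurable_fun setT psi.
  apply/measurable_EFinP; apply: measurable_funM.
    apply: measurable_funM => //; apply: (measurableT_comp mg); exact: measurable_fst.
  by apply: measurable_funM; [exact: measurable_indic|exact: mpow].
have phi0 z : (0 <= phi z)%E.
  by rewrite lee_fin !mulr_ge0 ?powR_ge0 ?(ltW q0)// indicE.
have psi0 z : (0 <= psi z)%E.
  by rewrite lee_fin !mulr_ge0 ?powR_ge0 ?(ltW q0)// indicE.
have -> : (\int[muX]_x (h x `^ q)%:E = \int[muX]_x \int[mu]_l phi (x, l))%E.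
  apply: eq_integral => x _.
  have := integral_powR_indic (h0 x) q0.
  rewrite (_ : (h x `^ q)%:E = (q%:E * (h x `^ q / q)%:E)%E); last first.
    by rewrite -EFinM; congr EFin; field; rewrite gt_eqF.
  move=> <-; rewrite -ge0_integralZl_EFin ?(ltW q0)//.
  - by move=> l _; rewrite lee_fin mulr_ge0 ?powR_ge0// indicE.
  - apply/measurable_EFinP; apply: measurable_funM; last exact: measurable_powR.
    by apply: measurable_indic; exact: measurable_itv.
rewrite (fubini_tonelli phi)//.
apply: (@le_trans _ _ (\int[mu]_l \int[muY]_y psi (y, l))%E).
  apply: ge0_le_integral => //.
  - by move=> l _; apply: integral_ge0.
  - exact: measurable_fun_fubini_tonelli_G.
  - exact: measurable_fun_fubini_tonelli_G.
  move=> l _.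
  have [l0|l0] := leP l 0.
    rewrite integral0_eq; first by apply: integral_ge0.
    move=> x _; rewrite /phi indicE (_ : _ \in E = false) ?mul0r ?mulr0//.
    by apply/negbTE; rewrite notin_setE /E /= ltNge l0.
  have -> : (\int[muX]_x phi (x, l) = (q * l `^ (q - 1))%:E * muX [set x | (l < h x)%R])%E.
    have mlh := measurable_gt_fun (measurable_cst l) mh.
    rewrite -[X in (_ * muX X)%E]setIT -integral_indic// -ge0_integralZl_EFin ?mulr_ge0 ?powR_ge0 ?(ltW q0)//.
      apply: eq_integral => x _; rewrite /phi -EFinM; congr EFin.
      have Ex : ((x, l) \in E) = (x \in [set x | l < h x]).
        by apply/idP/idP; rewrite !inE /E /= l0.
      by rewrite !indicE Ex; ring.
    by apply/measurable_EFinP; exact: measurable_indic.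
  have mlg := measurable_gt_fun (measurable_cst (c * l)) mg.
  have -> : (\int[muY]_y psi (y, l) = (q * l `^ (q - 1))%:E *
      ((A / l)%:E * \int[muY]_(y in [set y | (c * l < g y)%R]) (g y)%:E))%E.
    have k0 : 0 <= q * l `^ (q - 1) * (A / l).
      by rewrite !mulr_ge0 ?powR_ge0 ?invr_ge0 ?(ltW q0) ?(ltW l0).
    rewrite muleA -EFinM [in RHS]integral_mkcond -ge0_integralZl_EFin ?k0//.
    - apply: eq_integral => y _; rewrite /psi patchE.
    have E1 : l `^ (q - 1) = l * l `^ (q - 1 - 1).
      by rewrite -{2}(powRr1 (ltW l0)) -powRD; [congr (_ `^ _); lra|rewrite (gt_eqF l0) implybT].
    have G1 : ((y, l) \in G) = (c * l < g y).
      by apply/idP/idP; rewrite inE /G /= l0/= ltr_pdivlMr// mulrC.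
    case: ifPn => [|]; rewrite indicE G1.
      rewrite inE /= => ->; rewrite mul1r -EFinM; congr EFin.
      by rewrite E1; field; rewrite gt_eqF.
    by rewrite notin_setE /= => /negP/negbTE ->; rewrite mul0r !mulr0 mule0.
    - by move=> y _; rewrite patchE; case: ifP => _; rewrite ?lee_fin.
    - by apply/(measurable_restrictT _ _).1 => //; apply/measurable_EFinP; exact: measurable_funTS.
  by rewrite lee_pmul2l ?lte_fin ?mulr_gt0 ?powR_gt0//; exact: weak.
rewrite -(fubini_tonelli psi)//.
rewrite -ge0_integralZl_EFin//.
- apply: ge0_le_integral => //.
  + by move=> y _; apply: integral_ge0.
  + exact: measurable_fun_fubini_tonelli_F.
  + apply: measurable_funeM; apply/measurable_EFinP; exact: measurable_powR_comp.
  move=> y _.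
  have gc0 : 0 <= g y / c by rewrite divr_ge0 ?(ltW c0).
  have := integral_powR_indic gc0 q10 => H.
  rewrite (_ : (\int[mu]_l psi (y, l))%E = ((q * A * g y)%:E * ((g y / c) `^ (q - 1) / (q - 1))%:E)%E).
    rewrite -!EFinM lee_fin le_eqVlt; apply/orP; left; apply/eqP.
    rewrite powRM ?invr_ge0 ?(ltW c0)//.
    rewrite -(mulr_powRB1 (g0 y) q0).
    have -> : c^-1 `^ (q - 1) = c `^ (1 - q).
      by rewrite -(powR_inv1 (ltW c0)) -powRrM; congr (_ `^ _); lra.
    by field; lra.
  rewrite -H -ge0_integralZl_EFin ?mulr_ge0 ?(ltW q0)//.
  + by move=> l _; rewrite lee_fin mulr_ge0 ?powR_ge0// indicE.
  + apply/measurable_EFinP; apply: measurable_funM; last exact: measurable_powR.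
    by apply: measurable_indic; exact: measurable_itv.
- by move=> y _; rewrite lee_fin powR_ge0.
- apply/measurable_EFinP; exact: measurable_powR_comp.
- by rewrite !mulr_ge0 ?powR_ge0 ?invr_ge0 ?(ltW q0) ?(ltW q10).
Qed.

End weak_to_strong.

(** * Poisson integrals and the maximal function *)

Section poisson_maximal.
Context {R : realType}.
Notation mu := (@lebesgue_measure R).
Implicit Type g : R -> R.

Lemma integral_ball_le_HL g (x r : R) : 0 < r ->
  (\int[mu]_(t in ball x r) `|(g t)%:E| <= (r *+ 2)%:E * HL_maximal g x)%E.
Proof.
move=> r0.
have r20 : 0 < r *+ 2 by rewrite pmulrn_lgt0.
have mub : mu (ball x r) = (r *+ 2)%:E.
  by apply: lebesgue_measure_ball; exact: ltW.
have : (iavg g (ball x r) <= HL_maximal g x)%E.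
  by apply: ereal_sup_ubound; exists r => //=; rewrite in_itv/= r0.
rewrite /iavg [X in (X^-1 * _)%E]mub inver gt_eqF// => h.
rewrite -[leLHS]mul1e -(@divff _ (r *+ 2)) ?gt_eqF// EFinM -muleA.
by rewrite lee_pmul2l ?lte_fin.
Qed.

(** The k in question is the least one with |x - t| < 2^k b.  If k > 0, then 2^(k-1) b <= |x - t| and
    |x - t| <= |t - a| + b, so that (t - a)^2 + b^2 >= 4^k b^2 / 8. *)
Lemma poi_dyadic (a b x t : R) : 0 < b -> `|a - x| <= b ->
  exists k : nat, `|x - t| < 2 ^+ k * b /\ poi (t - a) b <= 8 / b / 4 ^+ k.
Proof.
move=> b0 axb.
have [m mE] : exists m : nat, `|x - t| < 2 ^+ m * b.
  exists (Num.truncn (`|x - t| / b)).+1.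
  rewrite -ltr_pdivrMr//; apply: (lt_trans (truncnS_gt _)).
  by rewrite -natrX ltr_nat ltn_expl.
have Pm : exists m : nat, `|x - t| < 2 ^+ m * b by exists m.
case: (ex_minnP Pm) => k hk kmin; exists k; split => //.
have q0 : 0 < (t - a) ^+ 2 + b ^+ 2 by exact: sqrD_gt0r.
rewrite /poi ler_pdivrMr//.
have P4 : 0 < 4 ^+ k :> R by rewrite exprn_gt0.
have -> : 8 / b / 4 ^+ k * ((t - a) ^+ 2 + b ^+ 2) =
   8 * ((t - a) ^+ 2 + b ^+ 2) / (b * 4 ^+ k) by field; rewrite !gt_eqF.
rewrite ler_pdivlMr ?mulr_gt0// mulrA -expr2.
case: k hk kmin P4 => [|k] hk kmin P4.
  by rewrite expr0 mulr1; have := sqr_ge0 (t - a); have := sqr_ge0 b; lra.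
have h1 : 2 ^+ k * b <= `|x - t|.
  by rewrite leNgt; apply/negP => /kmin; rewrite ltnn.
have h2 : `|x - t| <= `|t - a| + b.
  have -> : x - t = - (t - a) - (a - x) by ring.
  by rewrite (le_trans (ler_normB _ _))// normrN lerD2l.
have e4 : 4 ^+ k.+1 = 4 * (2 ^+ k) ^+ 2 :> R.
  by rewrite exprS -[in LHS](_ : 2 * 2 = 4 :> R) ?exprMn ?expr2//; ring.
rewrite e4 -[(t - a) ^+ 2]real_normK ?num_real//.
have p0 : 0 <= 2 ^+ k :> R by rewrite exprn_ge0.
move: (2 ^+ k) p0 h1 {hk kmin P4 e4 mE Pm} => w w0 h1.
have h3 : (w * b) ^+ 2 <= (`|t - a| + b) ^+ 2.
  by rewrite lerXn2r ?nnegrE ?mulr_ge0 ?addr_ge0 ?(ltW b0)//; exact: le_trans h2.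
have := sqr_ge0 (`|t - a| - b); nra.
Qed.

(** Over the ball of radius 2^k b around x the kernel is at most 8/(b 4^k) and the length is
    2 * 2^k b: the k-th ball contributes 16/2^k times the maximal function, and these add to 32. *)
Lemma poisson_le_HL g (a b x : R) : measurable_fun setT g -> (forall t, 0 <= g t) ->
  locally_integrable setT g -> 0 < b -> `|a - x| <= b ->
  (\int[mu]_t (g t * poi (t - a) b)%:E <= 32%:E * HL_maximal g x)%E.
Proof.
move=> mg g0 lg b0 axb.
have H0 : (0 <= HL_maximal g x)%E by exact: HL_maximalT_ge0.
pose u k (t : R) : \bar R := (8 / b / 4 ^+ k * ((\1_(ball x (2 ^+ k * b)) t) * g t))%:E.
have cst0 k : 0 <= 8 / b / 4 ^+ k.
  by rewrite !divr_ge0 ?exprn_ge0// ltW.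
have u0 k t : (0 <= u k t)%E by rewrite lee_fin mulr_ge0 ?cst0 ?mulr_ge0 ?indicE ?ler0n.
have mu_ k : measurable_fun setT (u k).
  apply/measurable_EFinP; apply: measurable_funM => //; apply: measurable_funM => //.
  by apply: measurable_indic; exact: measurable_ball.
apply: (@le_trans _ _ (\int[mu]_t \sum_(k <oo) u k t)%E).
  apply: ge0_le_integral => //.
  - by move=> t _; rewrite lee_fin mulr_ge0// poi_ge0// ltW.
  - apply/measurable_EFinP; apply: measurable_funM => //.
    by apply: measurable_fun_poi => //; apply: measurable_funB.
  - by apply: (@ge0_emeasurable_sum _ _ _ _ u xpredT) => // k t _ _; exact: u0.
  move=> t _; have [k [hk1 hk2]] := poi_dyadic t b0 axb.
  apply: (@le_trans _ _ (u k t)).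
    rewrite /u indicE mem_set/=; last by rewrite /ball/=.
    by rewrite lee_fin mul1r mulrC ler_wpM2r.
  apply: (@le_trans _ _ (\sum_(0 <= i < k.+1) u i t)%E); last first.
    by apply: nneseries_lim_ge => i _ _; exact: u0.
  by rewrite big_nat_recr//= leeDr// sume_ge0.
rewrite integral_nneseries//.
have term k : (\int[mu]_t u k t <= (16 / 2 ^+ k)%:E * HL_maximal g x)%E.
  have r0 : 0 < 2 ^+ k * b by rewrite mulr_gt0// exprn_gt0.
  have -> : (\int[mu]_t u k t = (8 / b / 4 ^+ k)%:E * \int[mu]_(t in ball x (2 ^+ k * b)) `|(g t)%:E|)%E.
    rewrite [in RHS]integral_mkcond -ge0_integralZl_EFin//; last 2 first.
    - by move=> t _; rewrite patchE; case: ifP.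
    - apply/(measurable_restrictT _ _).1; first exact: measurable_ball.
      by apply: measurableT_comp => //; apply/measurable_EFinP; exact: measurable_funTS.
    apply: eq_integral => t _; rewrite /u EFinM patchE indicE; congr (_ * _)%E.
    by case: ifPn; rewrite ?mul1r ?mul0r//= ger0_norm.
  apply: (@le_trans _ _ ((8 / b / 4 ^+ k)%:E * (((2 ^+ k * b) *+ 2)%:E * HL_maximal g x))%E).
    by rewrite lee_wpmul2l ?lee_fin//; exact: integral_ball_le_HL.
  rewrite muleA -EFinM (_ : 8 / b / 4 ^+ k * _ = 16 / 2 ^+ k)//.
  have -> : 4 ^+ k = 2 ^+ k * 2 ^+ k :> R by rewrite -exprMn; congr (_ ^+ k); ring.
  by field; rewrite ?expf_neq0 ?(gt_eqF b0).
apply: (@le_trans _ _ (\sum_(k <oo) (16 / 2 ^+ k)%:E * HL_maximal g x)%E).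
  by apply: lee_nneseries => // k _ _; exact: integral_ge0.
apply: lime_le.
  by apply: is_cvg_nneseries => k _ _; rewrite mule_ge0// lee_fin divr_ge0// exprn_ge0.
apply: nearW => n; rewrite -ge0_sume_distrl; last by move=> k _; rewrite lee_fin divr_ge0// exprn_ge0.
rewrite lee_wpmul2r// sumEFin lee_fin.
suff -> : \sum_(0 <= k < n) (16 / 2 ^+ k) = 32 - 32 / 2 ^+ n :> R.
  by rewrite lerBlDr lerDl divr_ge0// exprn_ge0.
elim: n => [|n IH]; first by rewrite big_nil expr0; lra.
rewrite big_nat_recr//= IH exprS; field; rewrite expf_neq0//.
Qed.

End poisson_maximal.

(** * Poisson extensions along points in a cone *)

Section lebesgue_borel.
Context {R : realType}.

Lemma borel_lebesgueR (A : set R) : measurable (A : set (measurableTypeR R)) ->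
  measurable (A : set (lebesgueR R)).
Proof. exact: sub_caratheodory. Qed.

Lemma measurable_id_lebesgueR :
  measurable_fun setT (id : lebesgueR R -> measurableTypeR R).
Proof. by move=> _ A mA; rewrite setTI; exact: borel_lebesgueR. Qed.

End lebesgue_borel.

Section poisson_operator.
Context {R : realType}.
Notation mu := (@lebesgue_measure R).
Notation lam := (@completed_lebesgue_measure R).

(** The point a + ib lies in the cone of half-aperture 45 degrees above x or above -x.  For
    x e^(i theta) the first case is that of an angle at most pi/2, the second that of an obtuse one. *)
Definition admissible (a b : lebesgueR R -> R) : Prop :=
  [/\ measurable_fun setT a, measurable_fun setT b, forall x, 0 < b x &
      forall x, `|a x - (x : R)| <= b x \/ `|a x + (x : R)| <= b x].

Definition poisson_ext (g : R -> R) (a b : lebesgueR R -> R) (x : lebesgueR R) : R :=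
  \int[mu]_t (g t * poi (t - a x) (b x)).

Variables (a b : lebesgueR R -> R) (g : R -> R) (M : R).
Hypothesis ab : admissible a b.
Hypotheses (mg : measurable_fun setT g) (g0 : forall t, 0 <= g t) (gM : forall t, g t <= M).

Let ma : measurable_fun setT a. Proof. by case: ab. Qed.
Let mb : measurable_fun setT b. Proof. by case: ab. Qed.
Let b0 x : 0 < b x. Proof. by case: ab. Qed.

Lemma bounded_locally_integrable (f : R -> R) (N : R) : measurable_fun setT f ->
  (forall t, `|f t| <= N) -> locally_integrable setT f.
Proof.
move=> mf fN; split; [exact: mf|exact: openT|move=> K _ cK].
have mK : measurable (K : set (measurableTypeR R)) by exact: compact_measurable.
rewrite (@le_lt_trans _ _ (\int[mu]_(t in K) N%:E)%E)//.
  apply: ge0_le_integral => //.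
  - by apply/measurable_EFinP; apply: measurableT_comp => //; exact: measurable_funTS.
  - by move=> t _; rewrite lee_fin fN.
rewrite integral_cst// ltey_eq fin_numM// ge0_fin_numE ?measure_ge0//.
exact: compact_finite_measure.
Qed.

Lemma HL_maximal_le (f : R -> R) (N : R) : measurable_fun setT f -> 0 <= N ->
  (forall t, `|f t| <= N) -> forall x, (HL_maximal f x <= N%:E)%E.
Proof.
move=> mf N0 fN x; apply: ge_ereal_sup => _ [r + <-].
rewrite /= in_itv/= andbT => r0; rewrite /iavg.
have mub : mu (ball x r) = (r *+ 2)%:E by apply: lebesgue_measure_ball; exact: ltW.
have r20 : 0 < r *+ 2 by rewrite pmulrn_lgt0.
apply: (@le_trans _ _ ((mu (ball x r))^-1 * \int[mu]_(y in ball x r) N%:E)%E).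
  rewrite lee_wpmul2l ?inve_ge0//; apply: ge0_le_integral => //.
  - exact: measurable_ball.
  - by apply: measurableT_comp => //; apply/measurable_EFinP; exact: measurable_funTS.
  - by move=> t _; rewrite lee_fin.
rewrite integral_cst; last exact: measurable_ball.
rewrite /= [X in (X^-1 * (_ * X))%E]mub inver gt_eqF// -!EFinM lee_fin.
by rewrite mulrCA mulVf ?mulr1// gt_eqF.
Qed.

Let epoisson (f : R -> R) x : \bar R := (\int[mu]_t (f t * poi (t - a x) (b x))%:E)%E.

Let epoisson_le_HL (f : R -> R) (N : R) : measurable_fun setT f -> (forall t, 0 <= f t) ->
  (forall t, f t <= N) -> forall x : lebesgueR R,
  (epoisson f x <= 32%:E * HL_maximal f x \/ epoisson f x <= 32%:E * HL_maximal f (- (x : R)))%E.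
Proof.
move=> mf f0 fN x.
have lf : locally_integrable setT f.
  by apply: (@bounded_locally_integrable f N) => // t; rewrite ger0_norm.
have [_ _ _ /(_ x) [h|h]] := ab; [left|right]; apply: poisson_le_HL => //.
by rewrite opprK.
Qed.

Lemma poisson_ext_EFin x : (poisson_ext g a b x)%:E = epoisson g x.
Proof.
rewrite /poisson_ext /Rintegral fineK// ge0_fin_numE; last first.
  by apply: integral_ge0 => t _; rewrite lee_fin mulr_ge0// poi_ge0// ltW.
have M0 : 0 <= M by rewrite (le_trans (g0 0)).
have gM' t : `|g t| <= M by rewrite ger0_norm.
have H y : (32%:E * HL_maximal g y < +oo)%E.
  rewrite (@le_lt_trans _ _ (32%:E * M%:E)%E)//; last by rewrite -EFinM ltry.
  by rewrite lee_pmul2l//; exact: HL_maximal_le.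
by have [h|h] := epoisson_le_HL mg g0 gM x; exact: (le_lt_trans h (H _)).
Qed.

Lemma poisson_ext_ge0 x : 0 <= poisson_ext g a b x.
Proof. by apply: Rintegral_ge0 => t _; rewrite mulr_ge0// poi_ge0// ltW. Qed.

Lemma measurable_poisson_ext : measurable_fun setT (poisson_ext g a b).
Proof.
apply/measurable_EFinP.
rewrite (_ : EFin \o _ = epoisson g); last by apply/funext => x; exact: poisson_ext_EFin.
pose k (z : lebesgueR R * measurableTypeR R) : \bar R :=
  (g z.2 * poi (z.2 - a z.1) (b z.1))%:E.
have mk : measurable_fun setT k.
  apply/measurable_EFinP; apply: measurable_funM.
    exact: (measurableT_comp mg measurable_snd).
  apply: measurable_fun_poi.
    apply: measurable_funB; first exact: measurable_snd.
    exact: (measurableT_comp ma measurable_fst).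
  exact: (measurableT_comp mb measurable_fst).
have k0 z : (0 <= k z)%E by rewrite lee_fin mulr_ge0// poi_ge0// ltW.
exact: (measurable_fun_fubini_tonelli_F k mk k0).
Qed.

(** The part of g below l/64 has maximal function at most l/64 and contributes at most
    32 l/64 = l/2.  Where the extension exceeds l, the part of g above l/64 must therefore have
    maximal function larger than l/64, at x or at -x; the maximal inequality bounds both sets, which
    are mirror images of each other. *)
Lemma poisson_ext_weak (l : R) : 0 < l ->
  (lam [set x : lebesgueR R | (l < poisson_ext g a b x)%R] <=
   ((2 * (3 * 64)) / l)%:E * \int[mu]_(t in [set t | (64^-1 * l < g t)%R]) (g t)%:E)%E.
Proof.
move=> l0; pose E := [set t : measurableTypeR R | 64^-1 * l < g t].
have mE : measurable E by exact: (measurable_gt_fun (measurable_cst (64^-1 * l)) mg).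
pose g1 t := g t * \1_E t.
have mg1 : measurable_fun setT g1.
  by apply: measurable_funM => //; exact: measurable_indic.
have g10 t : 0 <= g1 t by rewrite mulr_ge0// indicE.
have g1M t : g1 t <= M.
  by apply: le_trans (gM t); rewrite ler_piMr// indicE; case: (_ \in _).
have lg1 : locally_integrable setT g1.
  by apply: (@bounded_locally_integrable g1 M) => // t; rewrite ger0_norm.
have gsplit t : g t <= g1 t + 64^-1 * l.
  rewrite /g1 indicE; case: (boolP (t \in E)) => [_|].
    by rewrite mulr1 lerDl mulr_ge0// ltW.
  by rewrite notin_setE /E /= => /negP; rewrite -leNgt mulr0 add0r.
have l64 : 0 <= 64^-1 * l by rewrite mulr_ge0// ltW.
pose B := [set x : R | ((64^-1 * l)%:E < HL_maximal g1 x)%E].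
have mB : measurable (B : set (measurableTypeR R)).
  rewrite /B -[X in measurable X]setTI; apply: emeasurable_fun_o_infty => //.
  exact: measurable_HL_maximal.
pose B' := [set x : R | B (- x)].
have mB' : measurable (B' : set (measurableTypeR R)).
  by have := @oppr_measurable R setT measurableT _ mB; rewrite setTI.
have key : [set x : lebesgueR R | l < poisson_ext g a b x] `<=` B `|` B'.
  move=> x /=; rewrite -lte_fin poisson_ext_EFin => lx.
  pose cst1 (t : R) : R := 64^-1 * l.
  have mc : measurable_fun setT cst1 by exact: measurable_cst.
  have T2 : (epoisson cst1 x <= (l / 2)%:E)%E.
    have cM t : cst1 t <= 64^-1 * l by [].
    have c0 t : 0 <= cst1 t by [].
    have cn t : `|cst1 t| <= 64^-1 * l by rewrite ger0_norm.
    have H y : (32%:E * HL_maximal cst1 y <= (l / 2)%:E)%E.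
      rewrite (@le_trans _ _ (32%:E * (64^-1 * l)%:E)%E)//.
        by rewrite lee_pmul2l//; exact: HL_maximal_le.
      by rewrite -EFinM lee_fin; lra.
    by have [h|h] := epoisson_le_HL mc c0 cM x; exact: (le_trans h (H _)).
  have mpoi : measurable_fun setT (fun t : R => poi (t - a x) (b x)).
    by apply: measurable_fun_poi => //; exact: measurable_funB.
  have T12 : (epoisson g x <= epoisson g1 x + epoisson cst1 x)%E.
    rewrite /epoisson -ge0_integralD//.
    - apply: ge0_le_integral => //.
      + by move=> t _; rewrite lee_fin mulr_ge0// poi_ge0// ltW.
      + by apply/measurable_EFinP; exact: measurable_funM.
      + by apply: emeasurable_funD; apply/measurable_EFinP; exact: measurable_funM.
      + move=> t _; rewrite -EFinD lee_fin -mulrDl ler_wpM2r ?poi_ge0 ?(ltW (b0 _))//.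
    - by move=> t _; rewrite lee_fin mulr_ge0// poi_ge0// ltW.
    - by apply/measurable_EFinP; exact: measurable_funM.
    - by move=> t _; rewrite lee_fin mulr_ge0// poi_ge0// ltW.
    - by apply/measurable_EFinP; exact: measurable_funM.
  have T1 : ((l / 2)%:E < epoisson g1 x)%E.
    rewrite ltNge; apply/negP => h.
    have := leeD h T2; rewrite -EFinD -splitr => /(le_trans T12).
    by rewrite leNgt lx.
  have T1' y : ((l / 2)%:E < 32%:E * HL_maximal g1 y)%E -> B y.
    rewrite /B /= => h; rewrite ltNge; apply/negP => h'.
    move: h; rewrite ltNge => /negP; apply.
    rewrite (@le_trans _ _ (32%:E * (64^-1 * l)%:E)%E)//; first by rewrite lee_pmul2l.
    by rewrite -EFinM lee_fin; lra.
  have [h|h] := epoisson_le_HL mg1 g10 g1M x; [left|right]; apply: T1'; exact: (lt_le_trans T1 h).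
have mh := measurable_gt_fun (measurable_cst l) measurable_poisson_ext.
have muB : (mu B <= ((3 * 64) / l)%:E * \int[mu]_(t in E) (g t)%:E)%E.
  have c0 : 0 < 64^-1 * l by rewrite mulr_gt0.
  apply: (le_trans (maximal_inequality lg1 c0)).
  rewrite (_ : 3 / (64^-1 * l) = (3 * 64) / l); last by field; rewrite gt_eqF.
  rewrite lee_pmul2l ?lte_fin ?divr_gt0//.
  rewrite [leRHS]integral_mkcond; apply: ge0_le_integral => //.
  - by apply: measurableT_comp => //; exact/measurable_EFinP.
  - apply/(measurable_restrictT _ _).1 => //; apply/measurable_EFinP.
    exact: measurable_funTS.
  - move=> t _; rewrite patchE abse_EFin ger0_norm// /g1 indicE.
    by case: ifP => _; rewrite ?mulr1 ?mulr0.
have muB' : mu B' = mu B := lebesgue_measureN mB.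
have mBl : measurable (B : set (lebesgueR R)) by exact: borel_lebesgueR.
have mBl' : measurable (B' : set (lebesgueR R)) by exact: borel_lebesgueR.
have mBB : measurable ((B `|` B') : set (lebesgueR R)) := measurableU _ _ mBl mBl'.
have h1 := @le_measure _ _ _ lam _ _ (mem_set mh) (mem_set mBB) key.
have h2 : (lam (B `|` B') <= mu B + mu B')%E := @measureU2 _ _ _ lam _ _ mBl mBl'.
apply: (le_trans h1); apply: (le_trans h2).
have muB'le := eq_ind_r (fun z => (z <= ((3 * 64) / l)%:E * \int[mu]_(t in E) (g t)%:E)%E) muB muB'.
apply: (le_trans (leeD muB muB'le)).
have i0 : (0 <= \int[mu]_(t in E) (g t)%:E)%E.
  by apply: integral_ge0 => t _; rewrite lee_fin.
have -> : 2 * (3 * 64) / l = 3 * 64 / l + 3 * 64 / l by rewrite -mulrA mulr_natl mulr2n.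
have : 0 <= 3 * 64 / l by rewrite divr_ge0 ?mulr_ge0 ?(ltW l0).
move: (3 * 64 / l) => w w0.
by rewrite EFinD ge0_muleDl ?lee_fin.
Qed.

End poisson_operator.

(** The constant is the same for all admissible families; this is the source of the uniformity in
    theta1 and theta2. *)
Theorem poisson_ext_bounded {R : realType} (q : R) : 1 < q -> exists2 C : R, 0 < C &
  forall (a b : lebesgueR R -> R), admissible a b ->
  forall (g : R -> R) (M : R), measurable_fun setT g -> (forall t, 0 <= g t <= M) ->
  (\int[completed_lebesgue_measure]_x (poisson_ext g a b x `^ q)%:E <=
   C%:E * \int[lebesgue_measure]_t (g t `^ q)%:E)%E.
Proof.
move=> q1; exists (q / (q - 1) * (2 * (3 * 64)) * 64^-1 `^ (1 - q)).
  by rewrite !mulr_gt0 ?powR_gt0 ?invr_gt0//; lra.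
move=> a b ab g M mg gM.
have g0 t : 0 <= g t by have /andP[] := gM t.
have gM' t : g t <= M by have /andP[] := gM t.
have hm := measurable_poisson_ext ab mg g0 gM'.
have h0 := poisson_ext_ge0 ab g0.
have c0 : 0 < 64^-1 :> R by [].
have A0 : 0 <= 2 * (3 * 64) :> R by rewrite !mulr_ge0.
have hw := poisson_ext_weak ab mg g0 gM'.
exact: (@weak_to_strong R _ (lebesgueR R) completed_lebesgue_measure _ (measurableTypeR R) lebesgue_measure _ _ _ _ _ hm mg h0 g0 A0 c0 q1 hw).
Qed.

(** * Parametric integrals and duality *)

Section parametric_integrals.
Context {R : realType}.
Context d1 (X : measurableType d1) (muX : {sigma_finite_measure set X -> \bar R}).
Context d2 (Y : measurableType d2) (muY : {sigma_finite_measure set Y -> \bar R}).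

Lemma measurable_fun_section (k : X -> Y -> R) (x : X) :
  measurable_fun setT (fun z : X * Y => k z.1 z.2) -> measurable_fun setT (k x).
Proof.
move=> mk; have -> : k x = (fun z => k z.1 z.2) \o (fun y => (x, y)) by [].
exact: (measurableT_comp mk (pair1_measurable x)).
Qed.

Lemma measurable_Rintegral_param (k : X -> Y -> R) (D : set Y) : measurable D ->
  measurable_fun setT (fun z : X * Y => k z.1 z.2) ->
  measurable_fun setT (fun x => \int[muY]_(y in D) k x y).
Proof.
move=> mD mk.
pose K (z : X * Y) : \bar R := (k z.1 z.2 * \1_D z.2)%:E.
have mK : measurable_fun setT K.
  apply/measurable_EFinP; apply: measurable_funM => //.
  by apply: (measurableT_comp (measurable_indic _)) => //; exact: measurable_snd.
have -> : (fun x => \int[muY]_(y in D) k x y) =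
    (fun x => fine (\int[muY]_y K^\+ (x, y) - \int[muY]_y K^\- (x, y))%E).
  apply/funext => x; rewrite Rintegral_mkcond /Rintegral; congr fine.
  rewrite (_ : (\int[muY]_y (_ y)%:E = \int[muY]_y K (x, y))%E); last first.
    apply: eq_integral => y _; rewrite patchE /K indicE.
    by case: (y \in D); rewrite /= ?mulr1 ?mulr0.
  by rewrite [LHS]integralE; congr (_ - _)%E; apply: eq_integral => y _;
    rewrite ?funeposE ?funenegE.
apply: (measurableT_comp (fine_measurable measurableT)); apply: emeasurable_funB.
- by apply: (measurable_fun_fubini_tonelli_F (K^\+)%E) => //; exact: measurable_funepos.
- by apply: (measurable_fun_fubini_tonelli_F (K^\-)%E) => //; exact: measurable_funeneg.
Qed.

Variables (E : set X) (D : set Y) (g : X -> R) (f : Y -> R) (k : X -> Y -> R) (M : R).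
Hypotheses (mE : measurable E) (mD : measurable D).
Hypotheses (ig : muX.-integrable E (EFin \o g)) (jf : muY.-integrable D (EFin \o f)).
Hypothesis mk : measurable_fun setT (fun z : X * Y => k z.1 z.2).
Hypothesis kM : forall x y, E x -> D y -> `|k x y| <= M.

Lemma Rintegral_exchange :
  \int[muX]_(x in E) (g x * \int[muY]_(y in D) (f y * k x y)) =
  \int[muY]_(y in D) (f y * \int[muX]_(x in E) (g x * k x y)).
Proof.
pose g' := g \_ E; pose f' := f \_ D.
have ig' : muX.-integrable setT (EFin \o g').
  by rewrite /g' -restrict_EFin; exact: (integrable_mkcond _ mE).1.
have jf' : muY.-integrable setT (EFin \o f').
  by rewrite /f' -restrict_EFin; exact: (integrable_mkcond _ mD).1.
pose F (z : X * Y) : \bar R := (g' z.1 * f' z.2 * k z.1 z.2)%:E.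
have mg' : measurable_fun setT g' by apply/measurable_EFinP; exact: measurable_int ig'.
have mf' : measurable_fun setT f' by apply/measurable_EFinP; exact: measurable_int jf'.
have mF : measurable_fun setT F.
  apply/measurable_EFinP; apply: measurable_funM => //; apply: measurable_funM.
    exact: (measurableT_comp mg' measurable_fst).
  exact: (measurableT_comp mf' measurable_snd).
have FE x y : F (x, y) = (g' x * ((fun y => f y * k x y) \_ D) y)%:E.
  rewrite /F /= [f' y]patchE [in RHS]patchE; case: (y \in D); first by rewrite mulrA.
  by rewrite /point/= mulr0 mul0r.
have FE' x y : F (x, y) = (f' y * ((fun x => g x * k x y) \_ E) x)%:E.
  rewrite /F /= [g' x]patchE [in RHS]patchE; case: (x \in E); first by congr EFin; ring.
  by rewrite /point/= mul0r mul0r mulr0.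
pose G (z : X * Y) : \bar R := (g' z.1 * (f' z.2 * M))%:E.
have mG : measurable_fun setT G.
  apply/measurable_EFinP; apply: measurable_funM.
    exact: (measurableT_comp mg' measurable_fst).
  by apply: measurable_funM => //; exact: (measurableT_comp mf' measurable_snd).
have iG : (muX \x muY)%E.-integrable setT G.
  apply/(integrable12ltyP muX muY mG).
  have jM : muY.-integrable setT (EFin \o (fun y => f' y * M)).
    by apply: (eq_integrable measurableT _ _ _ (integrableZl measurableT M jf')) => y _;
      rewrite /= -EFinM mulrC.
  have mfM : measurable_fun setT (fun y => (`|f' y * M|)%:E).
    by apply/measurable_EFinP; apply: measurableT_comp => //; exact: measurable_funM.
  have [c cE] : exists c : R, (\int[muY]_y (`|f' y * M|)%:E)%E = c%:E.
    have /integrableP[_] := jM; rewrite -ge0_fin_numE; last by apply: integral_ge0.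
    by move=> h; exists (fine (\int[muY]_y (`|f' y * M|)%:E)%E); rewrite fineK.
  have c0 : 0 <= c by rewrite -lee_fin -cE; apply: integral_ge0 => y _; rewrite lee_fin.
  have GE x : (\int[muY]_y `|G (x, y)|)%E = ((`|g' x|)%:E * c%:E)%E.
    rewrite -cE -ge0_integralZl_EFin//.
    by apply: eq_integral => y _; rewrite /G /= normrM EFinM.
  rewrite (eq_integral (fun x => (`|g' x|)%:E * c%:E)%E); last first.
    by move=> x _; exact: GE.
  rewrite ge0_integralZr//; last first.
    by apply/measurable_EFinP; exact: measurableT_comp.
  rewrite muleC lte_mul_pinfty ?lee_fin//.
  by have /integrableP[_] := ig'.
have iF : (muX \x muY)%E.-integrable setT F.
  apply: (le_integrable measurableT mF _ iG) => -[x y] _.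
  rewrite /F /G /= lee_fin.
  have [Ex|Ex] := boolP (x \in E); last first.
    by rewrite (_ : g' x = 0) ?mul0r//; rewrite /g' patchE (negbTE Ex).
  have [Dy|Dy] := boolP (y \in D); last first.
    by rewrite (_ : f' y = 0) ?(mulr0, mul0r)//; rewrite /f' patchE (negbTE Dy).
  rewrite -mulrA !normrM !ler_wpM2l//.
  by rewrite (le_trans (kM (set_mem Ex) (set_mem Dy)))// ler_norm.
have H1 x : (\int[muY]_y F (x, y) = (g' x * \int[muY]_(y in D) (f y * k x y))%:E)%E.
  under eq_integral do rewrite FE.
  have [Ex|Ex] := boolP (x \in E); last first.
    rewrite (_ : g' x = 0); last by rewrite /g' patchE (negbTE Ex).
    by rewrite mul0r; under eq_integral do rewrite mul0r; rewrite integral0.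
  have ifk : muY.-integrable D (EFin \o (fun y => f y * k x y)).
    apply: (integrable_weight mD jf (M := M)).
      by apply: measurable_funTS; exact: measurable_fun_section.
    by move=> y Dy; apply: kM => //; exact: set_mem.
  have ifk' : muY.-integrable setT (EFin \o ((fun y => f y * k x y) \_ D)).
    by rewrite -restrict_EFin; exact: (integrable_mkcond _ mD).1.
  under eq_integral do rewrite EFinM.
  rewrite (integralZl measurableT ifk') EFinM; congr (_ * _)%E.
  by rewrite Rintegral_mkcond fineK//; exact: (integrable_fin_num measurableT ifk').
have H2 y : (\int[muX]_x F (x, y) = (f' y * \int[muX]_(x in E) (g x * k x y))%:E)%E.
  under eq_integral do rewrite FE'.
  have [Dy|Dy] := boolP (y \in D); last first.
    rewrite (_ : f' y = 0); last by rewrite /f' patchE (negbTE Dy).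
    by rewrite mul0r; under eq_integral do rewrite mul0r; rewrite integral0.
  have ifk : muX.-integrable E (EFin \o (fun x => g x * k x y)).
    apply: (integrable_weight mE ig (M := M)).
      apply: measurable_funTS; exact: (measurable_fun_pair1 y mk).
    by move=> x Ex; apply: kM => //; exact: set_mem.
  have ifk' : muX.-integrable setT (EFin \o ((fun x => g x * k x y) \_ E)).
    by rewrite -restrict_EFin; exact: (integrable_mkcond _ mE).1.
  under eq_integral do rewrite EFinM.
  rewrite (integralZl measurableT ifk') EFinM; congr (_ * _)%E.
  by rewrite Rintegral_mkcond fineK//; exact: (integrable_fin_num measurableT ifk').
have := Fubini iF.
under eq_integral do rewrite H1.
under [X in _ = X -> _]eq_integral do rewrite H2.
move=> /(congr1 fine) H.
rewrite Rintegral_mkcond [RHS]Rintegral_mkcond.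
transitivity (\int[muX]_x (g' x * \int[muY]_(y in D) (f y * k x y))).
  apply: eq_Rintegral => x _; rewrite patchE [g' x]patchE; case: (x \in E) => //.
  by rewrite /point/= mul0r.
rewrite [LHS]H; apply: eq_Rintegral => y _; rewrite patchE [f' y]patchE.
by case: (y \in D) => //; rewrite /point/= mul0r.
Qed.

End parametric_integrals.

Lemma hoelder_set {R : realType} d (T : measurableType d) (mu : {measure set T -> \bar R})
    (D : set T) (u w : T -> R) (p q U W : R) :
  measurable D -> measurable_fun D u -> measurable_fun D w ->
  0 < p -> 0 < q -> p^-1 + q^-1 = 1 ->
  (\int[mu]_(x in D) (`|u x| `^ p)%:E <= U%:E)%E ->
  (\int[mu]_(x in D) (`|w x| `^ q)%:E <= W%:E)%E ->
  (\int[mu]_(x in D) `|u x * w x|%:E <= (U `^ p^-1 * W `^ q^-1)%:E)%E.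
Proof.
move=> mD mu_ mw p0 q0 pq hU hW.
have mu' : measurable_fun setT (u \_ D) by apply/(measurable_restrictT _ _).1.
have mw' : measurable_fun setT (w \_ D) by apply/(measurable_restrictT _ _).1.
have := hoelder mu mu' mw' p0 q0 pq.
have norm (v : T -> R) (r V : R) : 0 < r -> (\int[mu]_(x in D) (`|v x| `^ r)%:E <= V%:E)%E ->
    ('N[mu]_r%:E[(EFin \o (v \_ D))] <= (V `^ r^-1)%:E)%E.
  move=> r0 hV; rewrite unlock /=.
  rewrite -poweR_EFin; apply: gt0_ler_poweR.
  - by rewrite invr_ge0 ltW.
  - by rewrite in_itv/= leey andbT; apply: integral_ge0 => x _; rewrite lee_fin powR_ge0.
  - by rewrite in_itv/= leey andbT; apply: le_trans hV; apply: integral_ge0 => x _; rewrite lee_fin powR_ge0.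
  apply: le_trans hV; rewrite [leRHS]integral_mkcond le_eqVlt; apply/orP; left.
  apply/eqP; apply: eq_integral => x _; rewrite !patchE; case: (x \in D) => //=.
  by rewrite /point/= normr0 powR0 ?gt_eqF.
move=> /le_trans H; have := H _ (lee_pmul (Lnorm_ge0 _ _ _) (Lnorm_ge0 _ _ _) (norm _ _ _ p0 hU) (norm _ _ _ q0 hW)).
rewrite -EFinM; apply: le_trans.
rewrite Lnorm1 integral_mkcond le_eqVlt; apply/orP; left.
apply/eqP; apply: eq_integral => x _; rewrite /= !patchE; case: (x \in D) => //=.
by rewrite /point/= mul0r normr0.
Qed.

Lemma conjugate_exponent_minus {R : realType} (p q : R) : 0 < p -> 0 < q ->
  p^-1 + q^-1 = 1 -> (p - 1) * q = p /\ p / q = p - 1.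
Proof.
move=> p0 q0 pq.
have h : p + q = p * q.
  have := congr1 (fun z => z * (p * q)) pq; rewrite mul1r => <-; field; lra.
split; first by nra.
by apply: (mulIf (x := q)); rewrite ?gt_eqF// divfK ?gt_eqF//; nra.
Qed.

(** Solving for X: the factor X^(1/q) is absorbed in the left-hand side, as 1 - 1/q = 1/p. *)
Lemma le_powR_dual {R : realType} (p q X U C : R) : 0 < p -> 0 < q -> p^-1 + q^-1 = 1 ->
  0 <= X -> 0 <= U -> 0 < C ->
  X <= U `^ p^-1 * (C * X) `^ q^-1 -> X <= C `^ (p - 1) * U.
Proof.
move=> p0 q0 pq; have [_ pq1] := conjugate_exponent_minus p0 q0 pq.
rewrite le_eqVlt => /predU1P[<-|X0] U0 C0; first by move=> _; rewrite mulr_ge0 ?powR_ge0.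
rewrite powRM ?(ltW C0) ?(ltW X0)// => H.
have H1 : X `^ p^-1 <= U `^ p^-1 * C `^ q^-1.
  rewrite -(ler_pM2r (powR_gt0 q^-1 X0)) -mulrA; apply: le_trans H.
  by rewrite -powRD ?pq ?powRr1 ?(ltW X0)// (gt_eqF X0) implybT.
have : (X `^ p^-1) `^ p <= (U `^ p^-1 * C `^ q^-1) `^ p.
  by rewrite ge0_ler_powR ?nnegrE ?mulr_ge0 ?powR_ge0 ?(ltW p0).
rewrite powRM ?powR_ge0// -!powRrM mulVf ?gt_eqF// !powRr1 ?(ltW X0)//.
by rewrite [q^-1 * p]mulrC pq1 [X in _ <= X]mulrC.
Qed.

Section duality.
Context {R : realType}.
Context d1 (X : measurableType d1) (muX : {sigma_finite_measure set X -> \bar R}).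
Context d2 (Y : measurableType d2) (muY : {sigma_finite_measure set Y -> \bar R}).
Variables (E : set X) (D : set Y) (f : Y -> R) (M N p q C : R).
Hypotheses (mE : measurable E) (mD : measurable D).
Hypotheses (Efin : (muX E < +oo)%E) (Dfin : (muY D < +oo)%E).
Hypotheses (mf : measurable_fun setT f) (fN : forall y, 0 <= f y <= N).
Hypotheses (p1 : 1 < p) (q0 : 0 < q) (pq : p^-1 + q^-1 = 1) (C0 : 0 < C).

Let p0 : 0 < p := lt_trans ltr01 p1.

Let jf : muY.-integrable D (EFin \o f).
Proof.
apply: (bounded_integrable (M := N)) => //; first exact: measurable_funTS.
by move=> y _; have /andP[h1 h2] := fN y; rewrite ger0_norm.
Qed.

Let f0 y : D y -> 0 <= f y. Proof. by move=> _; have /andP[] := fN y. Qed.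

(** Test the hypothesis with g = h_+^(p-1), h being the integral in the conclusion.  Then
    \int h_+^p = \int f (\int g k) by Fubini, and Hoelder's inequality brings back \int h_+^p to the
    power 1/q, since (p - 1) q = p.  The positive part appears because the hypothesis speaks of
    nonnegative g. *)
Lemma duality_pos (k : X -> Y -> R) :
  measurable_fun setT (fun z : X * Y => k z.1 z.2) ->
  (forall x y, E x -> D y -> `|k x y| <= M) ->
  (forall (g : X -> R) (B : R), measurable_fun setT g -> (forall x, 0 <= g x <= B) ->
    (\int[muY]_(y in D) (`|\int[muX]_(x in E) (g x * k x y)| `^ q)%:E <=
     C%:E * \int[muX]_(x in E) (g x `^ q)%:E)%E) ->
  (\int[muX]_(x in E) (Num.max (\int[muY]_(y in D) (f y * k x y)) 0 `^ p)%:E <=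
   (C `^ (p - 1))%:E * \int[muY]_(y in D) (f y `^ p)%:E)%E.
Proof.
move=> mk kM hC; have [pq1 pq2] := conjugate_exponent_minus p0 q0 pq.
pose h x := \int[muY]_(y in D) (f y * k x y).
have mfk : measurable_fun setT (fun z : X * Y => f z.2 * k z.1 z.2).
  by apply: measurable_funM => //; exact: (measurableT_comp mf measurable_snd).
have mh : measurable_fun setT h.
  exact: (measurable_Rintegral_param muY mD (k := fun x y => f y * k x y)).
pose B := (\int[muY]_(y in D) f y) * M.
have hB x : E x -> `|h x| <= B.
  move=> Ex; apply: (norm_weight_le mD jf) => //.
    by apply: measurable_funTS; exact: measurable_fun_section.
  by move=> y Dy; exact: kM.
pose ph x := Num.max (h x) 0.
have ph0 x : 0 <= ph x by rewrite le_max lexx orbT.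
have phB x : E x -> ph x <= `|B|.
  move=> Ex; rewrite ge_max normr_ge0 andbT.
  by rewrite (le_trans (ler_norm _))// (le_trans (hB _ Ex))// ler_norm.
have mph : measurable_fun setT ph by exact: measurable_maxr.
pose g x := \1_E x * ph x `^ (p - 1).
have p10 : 0 < p - 1 by rewrite subr_gt0.
have mg : measurable_fun setT g.
  apply: measurable_funM; first exact: measurable_indic.
  exact: measurable_powR_comp.
have gE x : E x -> g x = ph x `^ (p - 1).
  by move=> Ex; rewrite /g indicE mem_set// mul1r.
have gB x : 0 <= g x <= `|B| `^ (p - 1).
  rewrite /g indicE; have [Ex|nE] := boolP (x \in E); last by rewrite mul0r lexx powR_ge0.
  rewrite mul1r powR_ge0/= ge0_ler_powR ?nnegrE ?(ltW p10)//.
  exact/phB/set_mem.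
have ig : muX.-integrable E (EFin \o g).
  apply: (bounded_integrable (M := `|B| `^ (p - 1))) => //; first exact: measurable_funTS.
  by move=> x _; have /andP[h1 h2] := gB x; rewrite ger0_norm.
have mphp : measurable_fun setT (fun x => ph x `^ p).
  exact: measurable_powR_comp.
have iph : muX.-integrable E (EFin \o (fun x => ph x `^ p)).
  apply: (bounded_integrable (M := `|B| `^ p)) => //; first exact: measurable_funTS.
  move=> x Ex; rewrite ger0_norm ?powR_ge0//.
  by rewrite ge0_ler_powR ?nnegrE ?(ltW p0)// phB.
have mfp : measurable_fun setT (fun y => f y `^ p).
  exact: measurable_powR_comp.
have ifp : muY.-integrable D (EFin \o (fun y => f y `^ p)).
  apply: (bounded_integrable (M := N `^ p)) => //; first exact: measurable_funTS.
  move=> y Dy; rewrite ger0_norm ?powR_ge0//.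
  have /andP[h1 h2] := fN y.
  by rewrite ge0_ler_powR ?nnegrE ?(ltW p0)// (le_trans h1).
pose X0 := \int[muX]_(x in E) (ph x `^ p).
pose U := \int[muY]_(y in D) (f y `^ p).
have X0E : (\int[muX]_(x in E) (ph x `^ p)%:E = X0%:E)%E.
  by rewrite /X0 /Rintegral fineK//; exact: (integrable_fin_num mE iph).
have UE : (\int[muY]_(y in D) (f y `^ p)%:E = U%:E)%E.
  by rewrite /U /Rintegral fineK//; exact: (integrable_fin_num mD ifp).
have X00 : 0 <= X0 by apply: Rintegral_ge0 => x _; exact: powR_ge0.
have U0 : 0 <= U by apply: Rintegral_ge0 => x _; exact: powR_ge0.
(* X0 is finite, because E has finite measure and h is bounded there: [le_powR_dual] applies *)
rewrite [leLHS]X0E UE -EFinM lee_fin.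
apply: (le_powR_dual p0 q0 pq) => //.
pose Sg y := \int[muX]_(x in E) (g x * k x y).
have mSg : measurable_fun setT Sg.
  apply: (measurable_Rintegral_param muX mE (k := fun y x => g x * k x y)).
  apply: measurable_funM; first exact: (measurableT_comp mg measurable_snd).
  exact: (measurableT_comp mk (@measurable_swap _ _ _ _)).
have SgC : (\int[muY]_(y in D) (`|Sg y| `^ q)%:E <= (C * X0)%:E)%E.
  rewrite (le_trans (hC _ _ mg gB))// EFinM -X0E lee_pmul2l ?lte_fin//.
  rewrite le_eqVlt; apply/orP; left; apply/eqP.
  by apply: eq_integral => x /set_mem Ex; rewrite gE// -powRrM pq1.
have key : X0 = \int[muY]_(y in D) (f y * Sg y).
  rewrite -(Rintegral_exchange mE mD ig jf mk kM) /X0.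
  apply: eq_Rintegral => x /set_mem Ex; rewrite gE// -/(h x) /ph.
  have [hx|hx] := leP (h x) 0; last by rewrite mulrC mulr_powRB1// ltW.
  by rewrite powR0 ?(gt_eqF p0)// powR0 ?mul0r// gt_eqF.
have fU : (\int[muY]_(y in D) (`|f y| `^ p)%:E <= U%:E)%E.
  rewrite -UE le_eqVlt; apply/orP; left; apply/eqP.
  by apply: eq_integral => y /set_mem Dy; rewrite ger0_norm ?f0.
have := hoelder_set mD (measurable_funTS mf) (measurable_funTS mSg) p0 q0 pq fU SgC.
move=> H.
have jfS : muY.-integrable D (EFin \o (fun y => f y * Sg y)).
  apply/integrableP; split.
    by apply: measurable_funTS; apply/measurable_EFinP; exact: measurable_funM.
  exact: le_lt_trans H (ltry _).
rewrite [leLHS]key; apply: (le_trans (ler_norm _)).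
apply: (le_trans (le_normr_Rintegral mD jfS)).
have fin : (\int[muY]_(y in D) (`|f y * Sg y|)%:E)%E \is a fin_num.
  rewrite ge0_fin_numE; first exact: le_lt_trans H (ltry _).
  by apply: integral_ge0 => y _; rewrite lee_fin.
by rewrite -lee_fin; move: H; rewrite -(fineK fin).
Qed.

Variable k : X -> Y -> R.
Hypothesis mk : measurable_fun setT (fun z : X * Y => k z.1 z.2).
Hypothesis kM : forall x y, E x -> D y -> `|k x y| <= M.
Hypothesis hC : forall (g : X -> R) (B : R), measurable_fun setT g -> (forall x, 0 <= g x <= B) ->
    (\int[muY]_(y in D) (`|\int[muX]_(x in E) (g x * k x y)| `^ q)%:E <=
     C%:E * \int[muX]_(x in E) (g x `^ q)%:E)%E.

(** |h| is h_+ or (-h)_+; [duality_pos] is applied to k and to - k. *)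
Lemma duality :
  (\int[muX]_(x in E) (`|\int[muY]_(y in D) (f y * k x y)| `^ p)%:E <=
   (2 * C `^ (p - 1))%:E * \int[muY]_(y in D) (f y `^ p)%:E)%E.
Proof.
have H1 := duality_pos mk kM hC.
have mNk : measurable_fun setT (fun z : X * Y => - k z.1 z.2) by exact: measurable_funN.
have NkM x y : E x -> D y -> `|- k x y| <= M by move=> Ex Dy; rewrite normrN kM.
have ik x : E x -> muY.-integrable D (EFin \o (fun y => f y * k x y)).
  move=> Ex; apply: (integrable_weight mD jf (M := M)) => [|y Dy]; last exact: kM.
  by apply: measurable_funTS; exact: measurable_fun_section.
have hN x : E x -> \int[muY]_(y in D) (f y * - k x y) = - \int[muY]_(y in D) (f y * k x y).
  move=> Ex; rewrite -mulN1r -(RintegralZl _ mD (ik _ Ex)).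
  by apply: eq_Rintegral => y _; rewrite mulN1r mulrN.
have ig (g : X -> R) (B : R) : measurable_fun setT g -> (forall x, 0 <= g x <= B) ->
    muX.-integrable E (EFin \o g).
  move=> mg gB; apply: (bounded_integrable (M := B)) => //; first exact: measurable_funTS.
  by move=> x _; have /andP[h1 h2] := gB x; rewrite ger0_norm.
have hNC (g : X -> R) (B : R) : measurable_fun setT g -> (forall x, 0 <= g x <= B) ->
    (\int[muY]_(y in D) (`|\int[muX]_(x in E) (g x * - k x y)| `^ q)%:E <=
     C%:E * \int[muX]_(x in E) (g x `^ q)%:E)%E.
  move=> mg gB; apply: le_trans (hC mg gB).
  rewrite le_eqVlt; apply/orP; left; apply/eqP.
  apply: eq_integral => y /set_mem Dy; congr (_ `^ _)%:E.
  have igk : muX.-integrable E (EFin \o (fun x => g x * k x y)).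
    apply: (integrable_weight mE (ig _ _ mg gB) (M := M)) => [|x Ex]; last exact: kM.
    by apply: measurable_funTS; exact: (measurable_fun_pair1 y mk).
  rewrite -[RHS]normrN -mulN1r -(RintegralZl _ mE igk); congr (`| _ |).
  by apply: eq_Rintegral => x _; rewrite mulN1r mulrN.
have H2 := duality_pos mNk NkM hNC.
have mfk : measurable_fun setT (fun z : X * Y => f z.2 * k z.1 z.2).
  by apply: measurable_funM => //; exact: (measurableT_comp mf measurable_snd).
have mh : measurable_fun setT (fun x => \int[muY]_(y in D) (f y * k x y)).
  exact: (measurable_Rintegral_param muY mD (k := fun x y => f y * k x y)).
have mfNk : measurable_fun setT (fun z : X * Y => f z.2 * - k z.1 z.2).
  by apply: measurable_funM => //; exact: (measurableT_comp mf measurable_snd).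
have mhN : measurable_fun setT (fun x => \int[muY]_(y in D) (f y * - k x y)).
  exact: (measurable_Rintegral_param muY mD (k := fun x y => f y * - k x y)).
have mpow (v : X -> R) : measurable_fun setT v -> measurable_fun E (fun x => (v x `^ p)%:E).
  move=> mv; apply/measurable_EFinP; apply: measurable_funTS.
  exact: measurable_powR_comp.
apply: (@le_trans _ _ (\int[muX]_(x in E) ((Num.max (\int[muY]_(y in D) (f y * k x y)) 0 `^ p)%:E +
   (Num.max (\int[muY]_(y in D) (f y * - k x y)) 0 `^ p)%:E))%E).
  apply: ge0_le_integral => //.
  - by apply: mpow; exact: measurableT_comp.
  - by apply: emeasurable_funD; apply: mpow; exact: measurable_maxr.
  move=> x Ex; rewrite -EFinD lee_fin hN//.
  move: (\int[muY]_(y in D) (f y * k x y)) => w.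
  have [w0|w0] := leP 0 w.
    by rewrite ger0_norm// lerDl powR_ge0.
  have Nw : 0 <= - w by rewrite oppr_ge0 ltW.
  by rewrite ltr0_norm// max_l// lerDr powR_ge0.
rewrite ge0_integralD//; last 4 first.
- by move=> x _; rewrite lee_fin powR_ge0.
- by apply: mpow; exact: measurable_maxr.
- by move=> x _; rewrite lee_fin powR_ge0.
- by apply: mpow; exact: measurable_maxr.
rewrite mulr_natl mulr2n EFinD ge0_muleDl ?lee_fin ?powR_ge0//.
exact: leeD H1 H2.
Qed.

End duality.

(** * The Poisson kernel reproduces Cauchy kernels *)

Section reproducing.
Context {R : realType}.
Notation mu := (@lebesgue_measure R).
Variables (a b c d : R).
Hypotheses (b0 : 0 < b) (d0 : 0 < d).

Let P1 (t s : R) := poi (t - a) (s + b).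
Let C1 (t s : R) := cpoi (t - a) (s + b).
Let P2 (t s : R) := poi (t - c) (s + d).
Let C2 (t s : R) := cpoi (t - c) (s + d).
Let dP1 (t s : R) := dpoi (t - a) (s + b).
Let dC1 (t s : R) := dcpoi (t - a) (s + b).
Let dP2 (t s : R) := dpoi (t - c) (s + d).
Let dC2 (t s : R) := dcpoi (t - c) (s + d).

(** The real and imaginary parts of the product of i/(t + is - (a - ib)) and
    i/(t + is - (c - id)), which is holomorphic for s >= 0 and decays like |t + is|^-2. *)
Definition prod_re (t s : R) := P1 t s * P2 t s - C1 t s * C2 t s.
Definition prod_im (t s : R) := P1 t s * C2 t s + C1 t s * P2 t s.
Let W1 (t s : R) := dP1 t s * C2 t s + P1 t s * dC2 t s + (dC1 t s * P2 t s + C1 t s * dP2 t s).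
Let W2 (t s : R) := dC1 t s * C2 t s + C1 t s * dC2 t s - (dP1 t s * P2 t s + P1 t s * dP2 t s).

Let delta := Num.min b d.
Let N := Num.max `|a| `|c|.
Let eta := delta / 2.

Let delta0 : 0 < delta. Proof. by rewrite /delta lt_min b0. Qed.
Let eta0 : 0 < eta. Proof. by rewrite /eta divr_gt0. Qed.
Let db : delta <= b. Proof. by rewrite /delta ge_min lexx. Qed.
Let dd : delta <= d. Proof. by rewrite /delta ge_min lexx orbT. Qed.
Let aN : `|a| <= N. Proof. by rewrite /N le_max lexx. Qed.
Let cN : `|c| <= N. Proof. by rewrite /N le_max lexx orbT. Qed.
Let N0 : 0 <= N. Proof. exact: le_trans aN. Qed.
Let sb_ge s : - eta < s -> eta <= s + b. Proof. by move: db delta0; rewrite /eta; lra. Qed.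
Let sd_ge s : - eta < s -> eta <= s + d. Proof. by move: dd delta0; rewrite /eta; lra. Qed.
Let sb s : - eta < s -> 0 < s + b. Proof. by move=> /sb_ge; exact: lt_le_trans. Qed.
Let sd s : - eta < s -> 0 < s + d. Proof. by move=> /sd_ge; exact: lt_le_trans. Qed.

Let dre_s t s : - eta < s -> is_derive s (1 : R) (prod_re t) (- W1 t s).
Proof.
move=> hs; have h1 := is_derive_poi2 a t (sb hs); have h2 := is_derive_poi2 c t (sd hs).
have h3 := is_derive_cpoi2 a t (sb hs); have h4 := is_derive_cpoi2 c t (sd hs).
have := is_deriveB (is_deriveM h1 h2) (is_deriveM h3 h4).
move=> /is_derive_eq; apply; rewrite /GRing.scale/= /W1 /P1 /P2 /C1 /C2 /dP1 /dC1 /dP2 /dC2; ring.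
Qed.

Let dim_s t s : - eta < s -> is_derive s (1 : R) (prod_im t) (- W2 t s).
Proof.
move=> hs; have h1 := is_derive_poi2 a t (sb hs); have h2 := is_derive_poi2 c t (sd hs).
have h3 := is_derive_cpoi2 a t (sb hs); have h4 := is_derive_cpoi2 c t (sd hs).
have := is_deriveD (is_deriveM h1 h4) (is_deriveM h3 h2).
move=> /is_derive_eq; apply; rewrite /GRing.scale/= /W2 /P1 /P2 /C1 /C2 /dP1 /dC1 /dP2 /dC2; ring.
Qed.

Let dim_t t s : - eta < s -> is_derive t (1 : R) (prod_im ^~ s) (W1 t s).
Proof.
move=> hs; have h1 := is_derive_poi1 a t (sb hs); have h2 := is_derive_poi1 c t (sd hs).
have h3 := is_derive_cpoi1 a t (sb hs); have h4 := is_derive_cpoi1 c t (sd hs).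
have := is_deriveD (is_deriveM h1 h4) (is_deriveM h3 h2).
move=> /is_derive_eq; apply; rewrite /GRing.scale/= /W1 /P1 /P2 /C1 /C2 /dP1 /dC1 /dP2 /dC2; ring.
Qed.

Let dre_t t s : - eta < s -> is_derive t (1 : R) (prod_re ^~ s) (- W2 t s).
Proof.
move=> hs; have h1 := is_derive_poi1 a t (sb hs); have h2 := is_derive_poi1 c t (sd hs).
have h3 := is_derive_cpoi1 a t (sb hs); have h4 := is_derive_cpoi1 c t (sd hs).
have := is_deriveB (is_deriveM h1 h2) (is_deriveM h3 h4).
move=> /is_derive_eq; apply; rewrite /GRing.scale/= /W2 /P1 /P2 /C1 /C2 /dP1 /dC1 /dP2 /dC2; ring.
Qed.

Let cont_factors t s : - eta < s ->
  [/\ {for t, continuous (P1 ^~ s)}, {for t, continuous (P2 ^~ s)},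
      {for t, continuous (C1 ^~ s)} & {for t, continuous (C2 ^~ s)}] /\
  [/\ {for t, continuous (dP1 ^~ s)}, {for t, continuous (dP2 ^~ s)},
      {for t, continuous (dC1 ^~ s)} & {for t, continuous (dC2 ^~ s)}].
Proof.
move=> hs; split; split.
- by apply/differentiable_continuous/derivable1_diffP; case: (is_derive_poi1 a t (sb hs)).
- by apply/differentiable_continuous/derivable1_diffP; case: (is_derive_poi1 c t (sd hs)).
- by apply/differentiable_continuous/derivable1_diffP; case: (is_derive_cpoi1 a t (sb hs)).
- by apply/differentiable_continuous/derivable1_diffP; case: (is_derive_cpoi1 c t (sd hs)).
- exact: continuous_dpoi1 (sb hs).
- exact: continuous_dpoi1 (sd hs).
- exact: continuous_dcpoi1 (sb hs).
- exact: continuous_dcpoi1 (sd hs).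
Qed.

Let cW1 s : - eta < s -> continuous (W1 ^~ s).
Proof.
move=> hs t; have [[h1 h2 h3 h4] [k1 k2 k3 k4]] := cont_factors t hs.
by apply: cvgD; apply: cvgD; apply: cvgM.
Qed.

Let cW2 s : - eta < s -> continuous (W2 ^~ s).
Proof.
move=> hs t; have [[h1 h2 h3 h4] [k1 k2 k3 k4]] := cont_factors t hs.
by apply: cvgB; apply: cvgD; apply: cvgM.
Qed.

Let K := height_bound eta.

Let bounds t s : - eta < s ->
  [/\ `|P1 t s| <= K, `|P2 t s| <= K, `|C1 t s| <= K & `|C2 t s| <= K] /\
  [/\ `|dP1 t s| <= K, `|dP2 t s| <= K, `|dC1 t s| <= K & `|dC2 t s| <= K].
Proof.
move=> hs; have h1 := sb_ge hs; have h2 := sd_ge hs.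
split; split.
- exact: poi_le_height eta0 h1.
- exact: poi_le_height eta0 h2.
- exact: cpoi_le_height eta0 h1.
- exact: cpoi_le_height eta0 h2.
- exact: dpoi_le_height eta0 h1.
- exact: dpoi_le_height eta0 h2.
- exact: dcpoi_le_height eta0 h1.
- exact: dcpoi_le_height eta0 h2.
Qed.

Let norm2M (L x1 x2 x3 x4 : R) : `|x1| <= L -> `|x2| <= L -> `|x3| <= L -> `|x4| <= L ->
  `|x1 * x2 + x3 * x4| <= 2 * L ^+ 2.
Proof.
move=> h1 h2 h3 h4; rewrite (le_trans (ler_normD _ _))// !normrM.
have : `|x1| * `|x2| <= L * L by rewrite ler_pM.
have : `|x3| * `|x4| <= L * L by rewrite ler_pM.
by rewrite expr2; lra.
Qed.

Let norm2MB (L x1 x2 x3 x4 : R) : `|x1| <= L -> `|x2| <= L -> `|x3| <= L -> `|x4| <= L ->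
  `|x1 * x2 - x3 * x4| <= 2 * L ^+ 2.
Proof. by move=> h1 h2 h3 h4; rewrite -mulNr; apply: norm2M; rewrite ?normrN. Qed.

Let W1_le t s : - eta < s -> `|W1 t s| <= 4 * K ^+ 2.
Proof.
move=> hs; have [[h1 h2 h3 h4] [k1 k2 k3 k4]] := bounds t hs.
rewrite (le_trans (ler_normD _ _))//.
have := norm2M k1 h4 h1 k4; have := norm2M k3 h2 h3 k2; rewrite /W1; lra.
Qed.

Let W2_le t s : - eta < s -> `|W2 t s| <= 4 * K ^+ 2.
Proof.
move=> hs; have [[h1 h2 h3 h4] [k1 k2 k3 k4]] := bounds t hs.
rewrite (le_trans (ler_normB _ _))//.
have := norm2M k3 h4 h3 k4; have := norm2M k1 h2 h1 k2; rewrite /W2; lra.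
Qed.

Let H := decay_const N delta.
Let decay t s : 0 <= s ->
  [/\ `|P1 t s| <= H / (1 + `|t| + s), `|P2 t s| <= H / (1 + `|t| + s),
      `|C1 t s| <= H / (1 + `|t| + s) & `|C2 t s| <= H / (1 + `|t| + s)].
Proof.
move=> s0; have hs : - eta < s by rewrite (lt_le_trans _ s0)// oppr_lt0.
have h1 := decay_sum t delta0 N0 aN db s0; have h2 := decay_sum t delta0 N0 cN dd s0.
split.
- exact: le_trans (poi_le_sum _ (sb hs)) h1.
- exact: le_trans (poi_le_sum _ (sd hs)) h2.
- exact: le_trans (cpoi_le_sum _ (sb hs)) h1.
- exact: le_trans (cpoi_le_sum _ (sd hs)) h2.
Qed.

Let sqE (t s : R) : 0 <= s ->
  2 * (H / (1 + `|t| + s)) ^+ 2 = 2 * H ^+ 2 * (1 + `|t| + s) `^ (- 2).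
Proof.
move=> s0; have X0 : 0 <= 1 + `|t| + s by rewrite !addr_ge0.
by rewrite powRN (@powR_mulrn _ _ 2)// exprMn exprVn mulrA.
Qed.

Let re_decay t s : 0 <= s -> `|prod_re t s| <= 2 * H ^+ 2 * (1 + `|t| + s) `^ (- 2).
Proof. by move=> s0; have [] := decay t s0 => ? ? ? ?; rewrite -sqE//; exact: norm2MB. Qed.

Let im_decay t s : 0 <= s -> `|prod_im t s| <= 2 * H ^+ 2 * (1 + `|t| + s) `^ (- 2).
Proof. by move=> s0; have [] := decay t s0 => ? ? ? ?; rewrite -sqE//; exact: norm2M. Qed.

Let ge0s s : 0 <= s -> - eta < s.
Proof. by move=> s0; rewrite (lt_le_trans _ s0)// oppr_lt0. Qed.

Let cre s : - eta < s -> continuous (prod_re ^~ s).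
Proof.
by move=> hs t; apply/differentiable_continuous/derivable1_diffP; case: (dre_t t hs).
Qed.

Let cim s : - eta < s -> continuous (prod_im ^~ s).
Proof.
by move=> hs t; apply/differentiable_continuous/derivable1_diffP; case: (dim_t t hs).
Qed.

(** Cauchy's theorem for the product, whose decay exponent is 2. *)
Lemma contour_re T : 0 < T ->
  `|\int[mu]_(t in `[- T, T]) prod_re t 0| <= 4 * (2 * H ^+ 2) * T * (1 + T) `^ (- 2).
Proof.
apply: (@contour_shift R prod_re prod_im W1 eta (4 * K ^+ 2) (2 * H ^+ 2) 2 eta0).
- exact: dre_s.
- by move=> t s /ge0s; exact: dim_t.
- exact: cre.
- by move=> s /ge0s; exact: cW1.
- exact: W1_le.
- exact: re_decay.
- exact: im_decay.
- by rewrite mulr_ge0 ?sqr_ge0.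
- by [].
Qed.

(** The same for the product multiplied by - i, whose real part is [prod_im]. *)
Lemma contour_im T : 0 < T ->
  `|\int[mu]_(t in `[- T, T]) prod_im t 0| <= 4 * (2 * H ^+ 2) * T * (1 + T) `^ (- 2).
Proof.
apply: (@contour_shift R prod_im (fun t s => - prod_re t s) W2 eta (4 * K ^+ 2) (2 * H ^+ 2) 2 eta0).
- exact: dim_s.
- by move=> t s /ge0s hs; rewrite -[W2 t s]opprK; exact: (is_deriveN (dre_t t hs)).
- exact: cim.
- by move=> s /ge0s; exact: cW2.
- exact: W2_le.
- exact: im_decay.
- by move=> t s s0; rewrite normrN; exact: re_decay.
- by rewrite mulr_ge0 ?sqr_ge0.
- by [].
Qed.

(** Partial fractions.  Let k(t) = i/(t - (c - id)), with parts poi and cpoi.  Then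
    k(t) - k(a + ib) vanishes at t = a + ib, and the Poisson kernel poi (t - a) b is b divided by
    (t - (a - ib)) (t - (a + ib)); so poi (t - a) b * (k(t) - k(a + ib)) is b k(a + ib) times the
    product of i/(t - (a - ib)) and k(t). *)
Lemma poi_prod (t : R) : poi (t - a) b * poi (t - c) d =
  poi (a - c) (b + d) * poi (t - a) b +
  b * (poi (a - c) (b + d) * prod_re t 0 - cpoi (a - c) (b + d) * prod_im t 0).
Proof.
rewrite /prod_re /prod_im /P1 /P2 /C1 /C2 !add0r /poi /cpoi; field.
have h1 := sqrD_gt0r (t - a) b0; have h2 := sqrD_gt0r (t - c) d0.
have h3 := sqrD_gt0r (a - c) (addr_gt0 b0 d0).
by rewrite !gt_eqF.
Qed.

Lemma cpoi_prod (t : R) : poi (t - a) b * cpoi (t - c) d =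
  cpoi (a - c) (b + d) * poi (t - a) b +
  b * (poi (a - c) (b + d) * prod_im t 0 + cpoi (a - c) (b + d) * prod_re t 0).
Proof.
rewrite /prod_re /prod_im /P1 /P2 /C1 /C2 !add0r /poi /cpoi; field.
have h1 := sqrD_gt0r (t - a) b0; have h2 := sqrD_gt0r (t - c) d0.
have h3 := sqrD_gt0r (a - c) (addr_gt0 b0 d0).
by rewrite !gt_eqF.
Qed.

Lemma continuous_prod_re0 : continuous (prod_re ^~ 0).
Proof. by apply: cre; rewrite oppr_lt0. Qed.

Lemma continuous_prod_im0 : continuous (prod_im ^~ 0).
Proof. by apply: cim; rewrite oppr_lt0. Qed.

End reproducing.

Section poisson_mass.
Context {R : realType}.
Notation mu := (@lebesgue_measure R).

Lemma continuous_poi0 (a b : R) : 0 < b -> continuous (fun t => poi (t - a) b).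
Proof.
move=> b0 t; have b0' : 0 < 0 + b by rewrite add0r.
have := is_derive_poi1 a t b0'; rewrite add0r => h.
by apply/differentiable_continuous/derivable1_diffP; case: h.
Qed.

Lemma continuous_cpoi0 (a b : R) : 0 < b -> continuous (fun t => cpoi (t - a) b).
Proof.
move=> b0 t; have b0' : 0 < 0 + b by rewrite add0r.
have := is_derive_cpoi1 a t b0'; rewrite add0r => h.
by apply/differentiable_continuous/derivable1_diffP; case: h.
Qed.

Lemma integral_poi_itv (a b T : R) : 0 < b -> 0 < T ->
  (\int[mu]_(t in `[(- T)%R, T]) (poi (t - a) b)%:E =
   (atan ((T - a) / b) - atan ((- T - a) / b))%:E)%E.
Proof.
move=> b0 T0; pose F t := atan ((t - a) / b).
have dF t : is_derive t (1 : R) F (poi (t - a) b).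
  have h1 : is_derive t (1 : R) (fun t => (t - a) / b) (b^-1).
    have h : is_derive t (1 : R) (fun t => t - a) 1 by apply: is_derive_eq; rewrite subr0.
    have := is_deriveM h (is_derive_cst (b^-1 : R) t (1 : R)).
    by move=> /is_derive_eq; apply; rewrite /cst /GRing.scale/=; ring.
  have := @is_derive1_comp R (@atan R) _ t _ _ (is_derive1_atan _) h1.
  move=> /is_derive_eq; apply; rewrite /poi; field.
  by rewrite !gt_eqF// sqrD_gt0r.
have cF : continuous F.
  by move=> t; apply/differentiable_continuous/derivable1_diffP; case: (dF t).
rewrite EFinB; apply: (@continuous_FTC2 _ (fun t => poi (t - a) b) F); first by lra.
- by apply: continuous_subspaceT => x; exact: continuous_poi0.
- split; first by move=> x _; case: (dF x).
  + by apply: cvg_at_right_filter; exact: cF.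
  + by apply: cvg_at_left_filter; exact: cF.
- by move=> x _; rewrite derive1E; have [_ ->] := dF x.
Qed.

Lemma integral_poi (a b : R) : 0 < b -> (\int[mu]_t (poi (t - a) b)%:E = pi%:E)%E.
Proof.
move=> b0.
have mp : measurable_fun setT (fun t : R => poi (t - a) b).
  by apply: continuous_measurable_fun; exact: continuous_poi0.
have p0 t : 0 <= poi (t - a) b by rewrite poi_ge0// ltW.
rewrite -(cvg_lim _ (cvg_integral_itvNn mp p0))//; apply/cvg_lim => //.
rewrite (_ : (fun _ => _) = (fun n : nat =>
   (atan ((n.+1%:R - a) / b) - atan ((- n.+1%:R - a) / b))%:E)); last first.
  by apply/funext => n; rewrite integral_poi_itv.
apply: cvg_EFin; first exact: nearW.
have cy c : (n.+1%:R - c) / b @[n --> \oo] --> +oo.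
  apply/cvgryPge => A; near=> n.
  rewrite ler_pdivlMr// lerBrDr (@le_trans _ _ n%:R)//; last by rewrite ler_nat.
  by near: n; exact: nbhs_infty_ger.
have ca c : atan ((n.+1%:R - c) / b) @[n --> \oo] --> pi / 2.
  exact: (cvg_comp _ _ (cy c) (@cvgy_atan R)).
rewrite [X in _ --> X](_ : pi = pi / 2 - - (pi / 2)); last by rewrite opprK -splitr.
apply: cvgB; first exact: ca.
rewrite (_ : (fun n : nat => _) = (fun n : nat => - atan ((n.+1%:R - - a) / b))).
  by apply: cvgN; exact: ca.
by apply/funext => n; rewrite -atanN; congr atan; rewrite -mulNr; congr (_ / _); ring.
Unshelve. all: by end_near. Qed.

End poisson_mass.

Section reproducing_formula.
Context {R : realType}.
Notation mu := (@lebesgue_measure R).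

Lemma cvg_Rintegral_itvNn (g : R -> R) : mu.-integrable setT (EFin \o g) ->
  \int[mu]_(t in `[(- n.+1%:R)%R, n.+1%:R]) g t @[n --> \oo] --> \int[mu]_t g t.
Proof.
move=> ig.
have mg : measurable_fun setT g by apply/measurable_EFinP; exact: measurable_int ig.
have ia : mu.-integrable setT (EFin \o (fun t => `|g t|)) by exact: (integrable_norm ig).
have isum : mu.-integrable setT (EFin \o (fun t => g t + `|g t|)).
  by apply: (eq_integrable measurableT _ _ _ (integrableD measurableT ig ia)) => t _.
have nn (w : R -> R) : mu.-integrable setT (EFin \o w) -> (forall t, 0 <= w t) ->
    \int[mu]_(t in `[(- n.+1%:R)%R, n.+1%:R]) w t @[n --> \oo] --> \int[mu]_t w t.
  move=> iw w0; have mw : measurable_fun setT w by apply/measurable_EFinP; exact: measurable_int iw.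
  apply: fine_cvg; rewrite fineK; first exact: cvg_integral_itvNn.
  exact: (integrable_fin_num measurableT iw).
have mI n : measurable (`[(- n.+1%:R)%R, n.+1%:R]%classic : set (measurableTypeR R)) by exact: measurable_itv.
have H (D : set (measurableTypeR R)) : measurable D ->
    \int[mu]_(t in D) g t = \int[mu]_(t in D) (g t + `|g t|) - \int[mu]_(t in D) `|g t|.
  move=> mD; rewrite -RintegralB//.
  - by apply: eq_Rintegral => t _; rewrite addrK.
  - exact: (integrableS measurableT mD _ isum).
  - exact: (integrableS measurableT mD _ ia).
rewrite (H setT measurableT).
rewrite (_ : (fun _ => _) = (fun n : nat => \int[mu]_(t in `[(- n.+1%:R)%R, n.+1%:R]) (g t + `|g t|)
   - \int[mu]_(t in `[(- n.+1%:R)%R, n.+1%:R]) `|g t|)); last by apply/funext => n; exact: H.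
apply: cvgB; apply: nn => // t.
by rewrite -lerBlDl sub0r -normrN ler_norm.
Qed.

Variables (a b c d : R).
Hypotheses (b0 : 0 < b) (d0 : 0 < d).

Lemma integrable_poi : mu.-integrable setT (EFin \o (fun t => poi (t - a) b)).
Proof.
have p0 t : 0 <= poi (t - a) b by rewrite poi_ge0// ltW.
apply/integrableP; split.
  apply/measurable_EFinP; apply: continuous_measurable_fun; exact: continuous_poi0.
under eq_integral do rewrite /= ger0_norm//.
by rewrite integral_poi// ltry.
Qed.

Lemma Rintegral_poi : \int[mu]_t poi (t - a) b = pi.
Proof. by rewrite /Rintegral integral_poi. Qed.

Lemma integrable_poi_bounded (w : R -> R) (M : R) : measurable_fun setT w ->
  (forall t, `|w t| <= M) -> mu.-integrable setT (EFin \o (fun t => poi (t - a) b * w t)).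
Proof.
move=> mw wM; exact: (integrable_weight measurableT integrable_poi mw (fun t _ => wM t)).
Qed.

Lemma contour_cvg0 (w : R -> R) (C : R) :
  (forall T, 0 < T -> `|\int[mu]_(t in `[(- T)%R, T]) w t| <= C * T * (1 + T) `^ (- 2)) ->
  \int[mu]_(t in `[(- n.+1%:R)%R, n.+1%:R]) w t @[n --> \oo] --> (0 : R).
Proof.
move=> H; apply/norm_cvg0P.
apply: (@squeeze_cvgr _ _ _ _ (cst 0) (fun n => C * n.+1%:R * (1 + n.+1%:R) `^ (- 2))).
- by apply: nearW => n; rewrite normr_ge0 H.
- exact: cvg_cst.
- by apply: cvg_decay; rewrite ltr1n.
Qed.

Let re := (fun t => prod_re a b c d t 0).
Let im := (fun t => prod_im a b c d t 0).

(** Of the two terms in the decomposition of [poi_prod] and [cpoi_prod], the first has total mass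
    pi k and the second integrates to 0. *)
Lemma reproducing (w : R -> R) (M k k1 k2 : R) : measurable_fun setT w ->
  (forall t, `|w t| <= M) ->
  (forall t, poi (t - a) b * w t = k * poi (t - a) b + b * (k1 * re t + k2 * im t)) ->
  \int[mu]_t (poi (t - a) b * w t) = pi * k.
Proof.
move=> mw wM E.
have c1 := cvg_Rintegral_itvNn (integrable_poi_bounded mw wM).
rewrite -(cvg_lim _ c1)//; apply/cvg_lim => //.
have ire T : mu.-integrable `[- T, T] (EFin \o re).
  by apply: continuous_itv_integrable; exact: continuous_prod_re0.
have iim T : mu.-integrable `[- T, T] (EFin \o im).
  by apply: continuous_itv_integrable; exact: continuous_prod_im0.
have ip T : mu.-integrable `[- T, T] (EFin \o (fun t => poi (t - a) b)).
  by apply: continuous_itv_integrable; exact: continuous_poi0.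
have mI T : measurable (`[- T, T]%classic : set (measurableTypeR R)) by exact: measurable_itv.
have iZ T (z : R) v : mu.-integrable `[- T, T] (EFin \o v) ->
    mu.-integrable `[- T, T] (EFin \o (fun t => z * v t)).
  move=> iv; apply: (eq_integrable (mI T) _ _ _ (integrableZl (mI T) z iv)) => t _.
  by rewrite /= EFinM.
have iD T v1 v2 : mu.-integrable `[- T, T] (EFin \o v1) -> mu.-integrable `[- T, T] (EFin \o v2) ->
    mu.-integrable `[- T, T] (EFin \o (fun t => v1 t + v2 t)).
  by move=> i1 i2; apply: (eq_integrable (mI T) _ _ _ (integrableD (mI T) i1 i2)) => t _.
rewrite (_ : (fun _ => _) = (fun n : nat => k * \int[mu]_(t in `[(- n.+1%:R)%R, n.+1%:R]) poi (t - a) b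
  + b * (k1 * \int[mu]_(t in `[(- n.+1%:R)%R, n.+1%:R]) re t
        + k2 * \int[mu]_(t in `[(- n.+1%:R)%R, n.+1%:R]) im t))); last first.
  apply/funext => n; set T := n.+1%:R.
  transitivity (\int[mu]_(t in `[- T, T]) (k * poi (t - a) b + b * (k1 * re t + k2 * im t))).
    by apply: eq_Rintegral => t _; rewrite E.
  have i1 := iZ T k1 _ (ire T); have i2 := iZ T k2 _ (iim T).
  rewrite (RintegralD (mI T) (iZ T k _ (ip T)) (iZ T b _ (iD T _ _ i1 i2))).
  rewrite (RintegralZl k (mI T) (ip T)) (RintegralZl b (mI T) (iD T _ _ i1 i2)).
  by rewrite (RintegralD (mI T) i1 i2) (RintegralZl k1 (mI T) (ire T)) (RintegralZl k2 (mI T) (iim T)).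
rewrite [X in _ --> X](_ : _ = k * pi + b * (k1 * 0 + k2 * 0)); last by ring.
have cp : \int[mu]_(t in `[(- n.+1%:R)%R, n.+1%:R]) poi (t - a) b @[n --> \oo] --> (pi : R).
  by rewrite -Rintegral_poi; exact: cvg_Rintegral_itvNn integrable_poi.
apply: cvgD; apply: cvgM; [exact: cvg_cst|exact: cp|exact: cvg_cst|].
apply: cvgD; apply: cvgM; [exact: cvg_cst| |exact: cvg_cst|].
- by apply: contour_cvg0 => T T0; exact: contour_re.
- by apply: contour_cvg0 => T T0; exact: contour_im.
Qed.

Lemma reproducing_poi :
  \int[mu]_t (poi (t - a) b * poi (t - c) d) = pi * poi (a - c) (b + d).
Proof.
apply: (@reproducing _ d^-1 _ (poi (a - c) (b + d)) (- cpoi (a - c) (b + d))).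
- by apply: continuous_measurable_fun; exact: continuous_poi0.
- by move=> t; exact: norm_poi_le.
- by move=> t; rewrite poi_prod// mulNr.
Qed.

Lemma reproducing_cpoi :
  \int[mu]_t (poi (t - a) b * cpoi (t - c) d) = pi * cpoi (a - c) (b + d).
Proof.
apply: (@reproducing _ d^-1 _ (cpoi (a - c) (b + d)) (poi (a - c) (b + d))).
- by apply: continuous_measurable_fun; exact: continuous_cpoi0.
- by move=> t; exact: norm_cpoi_le.
- by move=> t; rewrite cpoi_prod//; congr (_ + b * _); rewrite addrC.
Qed.

End reproducing_formula.

(** * Cauchy operators on truncated data *)

Lemma le_integral_powR {R : realType} d (T : measurableType d) (mu : {measure set T -> \bar R})
    (h P : T -> R) (c p : R) :
  measurable_fun setT h -> measurable_fun setT P -> (forall x, 0 <= P x) ->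
  0 <= c -> 0 <= p -> (forall x, `|h x| <= c * P x) ->
  (\int[mu]_x (`|h x| `^ p)%:E <= (c `^ p)%:E * \int[mu]_x (P x `^ p)%:E)%E.
Proof.
move=> mh mP P0 c0 p0 hP.
have mPp : measurable_fun setT (fun x => (P x `^ p)%:E).
  by apply/measurable_EFinP; exact: measurable_powR_comp.
rewrite -ge0_integralZl_EFin ?powR_ge0//.
- apply: ge0_le_integral => //.
  + by apply/measurable_EFinP; apply: measurable_powR_comp; exact: measurableT_comp.
  + exact: measurable_funeM.
  + move=> x _; rewrite -EFinM lee_fin -powRM//.
    by rewrite ge0_ler_powR ?nnegrE// mulr_ge0.
- by move=> x _; rewrite lee_fin powR_ge0.
Qed.

Notation kernel_part e := (e = @poi _ \/ e = @cpoi _).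

Section cauchy_operator.
Context {R : realType}.
Notation mu := (@lebesgue_measure R).
Notation lam := (@completed_lebesgue_measure R).

(** f is bounded and the points a + ib stay in a compact part of the upper half plane.  The bounds
    N, M and delta are there for convergence; no operator norm depends on them. *)
Definition truncated_data (D : set (lebesgueR R)) (f a b : lebesgueR R -> R) : Prop :=
  [/\ measurable D, (lam D < +oo)%E, measurable_fun setT f,
      exists M, forall y, 0 <= f y <= M &
      exists N delta : R, [/\ 0 <= N, 0 < delta &
        forall y, D y -> `|a y| <= N /\ delta <= b y <= N]].

(** With e = poi and cpoi: the parts of \int_D f(y) i/(z(x) - conj w(y)) dy, z = a1 + i b1,
    w = a2 + i b2. *)
Definition cauchy_op (e : R -> R -> R) (D : set (lebesgueR R))
    (f a1 b1 a2 b2 : lebesgueR R -> R) (x : lebesgueR R) : R :=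
  \int[lam]_(y in D) (f y * e (a1 x - a2 y) (b1 x + b2 y)).

Lemma measurable_kernel d (T : measurableType d) (e : R -> R -> R) (A B : T -> R) :
  kernel_part e -> measurable_fun setT A -> measurable_fun setT B ->
  measurable_fun setT (fun z => e (A z) (B z)).
Proof.
by move=> [->|->] mA mB; [exact: measurable_fun_poi|exact: measurable_fun_cpoi].
Qed.

Lemma measurable_kernel_pair d1 (X : measurableType d1) d2 (Y : measurableType d2)
    (e : R -> R -> R) (a1 b1 : X -> R) (a2 b2 : Y -> R) :
  kernel_part e -> measurable_fun setT a1 -> measurable_fun setT b1 ->
  measurable_fun setT a2 -> measurable_fun setT b2 ->
  measurable_fun setT (fun z : X * Y => e (a1 z.1 - a2 z.2) (b1 z.1 + b2 z.2)).
Proof.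
move=> he ma1 mb1 ma2 mb2; apply: measurable_kernel => //.
  apply: measurable_funB; first exact: (measurableT_comp ma1 measurable_fst).
  exact: (measurableT_comp ma2 measurable_snd).
apply: measurable_funD; first exact: (measurableT_comp mb1 measurable_fst).
exact: (measurableT_comp mb2 measurable_snd).
Qed.

Lemma measurable_kernel_section (e : R -> R -> R) (a1 b1 a2 b2 : lebesgueR R -> R) x :
  kernel_part e -> measurable_fun setT a2 -> measurable_fun setT b2 ->
  measurable_fun setT (fun y => e (a1 x - a2 y) (b1 x + b2 y)).
Proof.
move=> he ma mb; apply: (measurable_kernel he); first exact: measurable_funB.
exact: measurable_funD.
Qed.

Lemma norm_kernel_le (e : R -> R -> R) (A B delta : R) :
  kernel_part e -> 0 < delta -> delta <= B -> `|e A B| <= delta^-1.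
Proof.
move=> he d0 dB; have B0 : 0 < B by exact: lt_le_trans dB.
rewrite (@le_trans _ _ B^-1)//; last by rewrite lef_pV2 ?posrE.
by case: he => ->; [exact: norm_poi_le|exact: norm_cpoi_le].
Qed.

Lemma truncated_data_integrable D f a b : truncated_data D f a b -> lam.-integrable D (EFin \o f).
Proof.
move=> [mD Dfin mf [M fM] _].
apply: (bounded_integrable mD Dfin (M := M)); first exact: measurable_funTS.
by move=> y _; have /andP[h1 h2] := fM y; rewrite ger0_norm.
Qed.

Lemma transform_bounded (e : R -> R -> R) D f a b : kernel_part e ->
  measurable_fun setT a -> measurable_fun setT b -> truncated_data D f a b ->
  exists2 K, measurable_fun setT (fun t => transform lam D f a b e t 0) &
     forall t, `|transform lam D f a b e t 0| <= K.
Proof.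
move=> he ma mb nd; have jf := truncated_data_integrable nd.
have [mD Dfin mf [M fM] [N [delta [N0 d0 abN]]]] := nd.
exists ((\int[lam]_(y in D) f y) * delta^-1).
  apply: (measurable_Rintegral_param (X := measurableTypeR R) lam mD
    (k := fun t y => f y * e (t - a y) (0 + b y))).
  apply: measurable_funM; first exact: (measurableT_comp mf measurable_snd).
  exact: (measurable_kernel_pair he (@measurable_id _ (measurableTypeR R) setT)
    (measurable_cst (0 : R)) ma mb).
move=> t; apply: (norm_weight_le mD jf).
- apply: measurable_funTS.
  have mA : measurable_fun setT (fun y => t - a y) by exact: measurable_funB.
  have mB : measurable_fun setT (fun y => 0 + b y) by exact: measurable_funD.
  exact: (measurable_kernel he mA mB).
- by move=> y _; have /andP[] := fM y.
- move=> y Dy; have [_ /andP[h _]] := abN y Dy.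
  by apply: norm_kernel_le => //; rewrite add0r.
Qed.

(** The value at z(x) of the Cauchy integral is recovered from its boundary values on the line:
    this is the reproducing formula under the integral sign. *)
Lemma cauchy_op_reproducing (e : R -> R -> R) D f a1 b1 a2 b2 x : kernel_part e ->
  (forall x, 0 < b1 x) -> measurable_fun setT a2 -> measurable_fun setT b2 ->
  truncated_data D f a2 b2 ->
  pi * cauchy_op e D f a1 b1 a2 b2 x =
  \int[mu]_t (poi (t - a1 x) (b1 x) * transform lam D f a2 b2 e t 0).
Proof.
move=> he b10 ma mb nd; have jf := truncated_data_integrable nd.
have [mD Dfin mf [M fM] [N [delta [N0 d0 abN]]]] := nd.
have mk : measurable_fun setT (fun z : measurableTypeR R * lebesgueR R => e (z.1 - a2 z.2) (0 + b2 z.2)).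
  exact: (measurable_kernel_pair he (@measurable_id _ (measurableTypeR R) setT)
    (measurable_cst (0 : R)) ma mb).
have kM (t : measurableTypeR R) y : [set: measurableTypeR R] t -> D y ->
    `|e (t - a2 y) (0 + b2 y)| <= delta^-1.
  move=> _ Dy; have [_ /andP[h _]] := abN y Dy.
  by apply: norm_kernel_le => //; rewrite add0r.
have ip := integrable_poi (a1 x) (b10 x).
have := @Rintegral_exchange _ _ (measurableTypeR R) mu _ (lebesgueR R) lam setT D
  (fun t => poi (t - a1 x) (b1 x)) f (fun t y => e (t - a2 y) (0 + b2 y)) delta^-1
  measurableT mD ip jf mk kM.
rewrite /transform => ->.
have ifk : lam.-integrable D (EFin \o (fun y => f y * e (a1 x - a2 y) (b1 x + b2 y))).
  apply: (integrable_weight mD jf (M := (b1 x)^-1)).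
    by apply: measurable_funTS; exact: (measurable_kernel_section a1 b1 x he ma mb).
  move=> y Dy; have [_ /andP[h _]] := abN y Dy.
  by apply: norm_kernel_le => //; rewrite lerDl (le_trans _ h)// ltW.
rewrite /cauchy_op -(RintegralZl pi mD ifk); apply: eq_Rintegral => y /set_mem Dy.
have [_ /andP[h _]] := abN y Dy.
have b20 : 0 < b2 y by exact: lt_le_trans h.
rewrite mulrCA; congr (_ * _); rewrite add0r.
by case: he => ->; rewrite ?reproducing_poi ?reproducing_cpoi.
Qed.

Lemma norm_cauchy_op_le (e : R -> R -> R) D f a1 b1 a2 b2 x : kernel_part e ->
  (forall x, 0 < b1 x) -> measurable_fun setT a2 -> measurable_fun setT b2 ->
  truncated_data D f a2 b2 ->
  `|cauchy_op e D f a1 b1 a2 b2 x| <=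
   pi^-1 * poisson_ext (fun t => `|transform lam D f a2 b2 e t 0|) a1 b1 x.
Proof.
move=> he b10 ma mb nd; have pi0 := pi_gt0 R.
have [K mw wK] := transform_bounded he ma mb nd.
have E := cauchy_op_reproducing a1 x he b10 ma mb nd.
have -> : cauchy_op e D f a1 b1 a2 b2 x = pi^-1 * (pi * cauchy_op e D f a1 b1 a2 b2 x).
  by rewrite mulKf// gt_eqF.
rewrite E normrM (gtr0_norm (_ : 0 < pi^-1)) ?invr_gt0// ler_wpM2l ?invr_ge0 ?(ltW pi0)//.
have iw := integrable_poi_bounded (a1 x) (b10 x) mw wK.
rewrite (le_trans (le_normr_Rintegral measurableT iw))// le_eqVlt; apply/orP; left; apply/eqP.
apply: eq_Rintegral => t _; rewrite normrM mulrC; congr (_ * _).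
by rewrite ger0_norm// poi_ge0// ltW.
Qed.

Lemma measurable_cauchy_op (e : R -> R -> R) D f a1 b1 a2 b2 : kernel_part e ->
  measurable D -> measurable_fun setT f ->
  measurable_fun setT a1 -> measurable_fun setT b1 ->
  measurable_fun setT a2 -> measurable_fun setT b2 ->
  measurable_fun setT (cauchy_op e D f a1 b1 a2 b2).
Proof.
move=> he mD mf ma1 mb1 ma2 mb2.
apply: (measurable_Rintegral_param lam mD
  (k := fun x y => f y * e (a1 x - a2 y) (b1 x + b2 y))).
apply: measurable_funM; first exact: (measurableT_comp mf measurable_snd).
exact: (measurable_kernel_pair he ma1 mb1 ma2 mb2).
Qed.

Lemma cauchy_op_transform (p C : R) (e : R -> R -> R) D f a1 b1 a2 b2 :
  kernel_part e -> 1 < p ->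
  admissible a1 b1 -> admissible a2 b2 -> truncated_data D f a2 b2 ->
  (forall (g : R -> R) (M : R), measurable_fun setT g -> (forall t, 0 <= g t <= M) ->
    (\int[lam]_x (poisson_ext g a1 b1 x `^ p)%:E <= C%:E * \int[mu]_t (g t `^ p)%:E)%E) ->
  (\int[lam]_x (`|cauchy_op e D f a1 b1 a2 b2 x| `^ p)%:E <=
   (pi `^ (- p) * C)%:E * \int[mu]_t (`|transform lam D f a2 b2 e t 0| `^ p)%:E)%E.
Proof.
move=> he p1 ad1 ad2 nd HC.
have [ma1 mb1 b10 _] := ad1; have [ma2 mb2 b20 _] := ad2.
have [K mw wK] := transform_bounded he ma2 mb2 nd.
set w := fun t => `|transform lam D f a2 b2 e t 0|.
have mw' : measurable_fun setT w by exact: measurableT_comp.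
have w0 t : 0 <= w t by exact: normr_ge0.
have wK' t : 0 <= w t <= K by rewrite w0 wK.
have mP := measurable_poisson_ext ad1 mw' w0 (fun t => wK t).
have P0 := poisson_ext_ge0 ad1 w0.
have pi0 := pi_gt0 R.
have pV0 : 0 <= pi^-1 :> R by rewrite invr_ge0 ltW.
have p0 : 0 <= p by rewrite ltW// (lt_trans ltr01 p1).
have [mD _ mf _ _] := nd.
have mh := measurable_cauchy_op he mD mf ma1 mb1 ma2 mb2.
have hP x := norm_cauchy_op_le a1 x he b10 ma2 mb2 nd.
have L := le_integral_powR lam mh mP P0 pV0 p0 hP.
apply: (le_trans L).
have -> : (pi^-1) `^ p = pi `^ (- p) :> R.
  by rewrite -(powR_inv1 (ltW pi0)) -powRrM mulN1r.
by rewrite EFinM -muleA lee_pmul2l ?lte_fin ?powR_gt0//; exact: (HC w K).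
Qed.

End cauchy_operator.

Section truncated_bounds.
Context {R : realType}.
Notation mu := (@lebesgue_measure R).
Notation lam := (@completed_lebesgue_measure R).

Lemma subset_integral_powR d (T : measurableType d) (m : {measure set T -> \bar R})
    (D : set T) (h : T -> R) (p : R) : measurable D -> measurable_fun setT h ->
  (\int[m]_(x in D) (`|h x| `^ p)%:E <= \int[m]_x (`|h x| `^ p)%:E)%E.
Proof.
move=> mD mh; apply: ge0_subset_integral => //.
by apply/measurable_EFinP; apply: measurable_powR_comp; exact: measurableT_comp.
Qed.

Lemma conjugate_exponentP (p : R) : 1 < p ->
  let q := p / (p - 1) in [/\ 1 < q, 0 < q & p^-1 + q^-1 = 1].
Proof.
move=> p1 q; have p10 : 0 < p - 1 by rewrite subr_gt0.
have p0 : 0 < p by exact: lt_trans p1.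
split; first by rewrite /q ltr_pdivlMr// mul1r; lra.
  by rewrite divr_gt0.
by rewrite /q; field; rewrite !gt_eqF.
Qed.

(** The adjoint of f -> transform poi, restricted to D and E, is the Poisson extension of g 1_E. *)
Lemma poisson_ext_test (q C : R) (a b : lebesgueR R -> R) (D : set (lebesgueR R)) (E : set R)
    (g : R -> R) (B : R) :
  0 < q -> admissible a b -> measurable D -> measurable (E : set (measurableTypeR R)) ->
  (forall (g : R -> R) (M : R), measurable_fun setT g -> (forall t, 0 <= g t <= M) ->
    (\int[lam]_x (poisson_ext g a b x `^ q)%:E <= C%:E * \int[mu]_t (g t `^ q)%:E)%E) ->
  measurable_fun setT g -> (forall t, 0 <= g t <= B) ->
  (\int[lam]_(y in D) (`|\int[mu]_(t in E) (g t * poi (t - a y) (0 + b y))| `^ q)%:E <=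
   C%:E * \int[mu]_(t in E) (g t `^ q)%:E)%E.
Proof.
move=> q0 ad mD mE HC mg gB; have [ma mb b0 _] := ad.
pose g' t := g t * \1_E t.
have mg' : measurable_fun setT g'.
  by apply: measurable_funM => //; exact: measurable_indic.
have g'B t : 0 <= g' t <= B.
  have /andP[h1 h2] := gB t; rewrite /g' indicE.
  by case: (t \in E); rewrite ?mulr1 ?h1 ?h2// mulr0 lexx (le_trans h1).
have g'0 t : 0 <= g' t by have /andP[] := g'B t.
have g'B' t : g' t <= B by have /andP[] := g'B t.
have PE y : \int[mu]_(t in E) (g t * poi (t - a y) (0 + b y)) = poisson_ext g' a b y.
  rewrite /poisson_ext Rintegral_mkcond; apply: eq_Rintegral => t _.
  rewrite patchE /g' indicE add0r; case: (t \in E); first by rewrite mulr1.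
  by rewrite mulr0 mul0r.
have P0 := poisson_ext_ge0 ad g'0.
have mP := measurable_poisson_ext ad mg' g'0 g'B'.
have -> : (\int[mu]_(t in E) (g t `^ q)%:E = \int[mu]_t (g' t `^ q)%:E)%E.
  rewrite integral_mkcond; apply: eq_integral => t _.
  rewrite patchE /g' indicE; case: (t \in E); first by rewrite mulr1.
  by rewrite mulr0 powR0// gt_eqF.
apply: le_trans (HC g' B mg' g'B).
rewrite (eq_integral (fun y => (`|poisson_ext g' a b y| `^ q)%:E)); last first.
  by move=> y _; rewrite PE.
apply: (le_trans (subset_integral_powR lam q mD mP)).
rewrite le_eqVlt; apply/orP; left; apply/eqP.
by apply: eq_integral => y _; rewrite ger0_norm.
Qed.

Lemma poi_transform_bound (p : R) : 1 < p -> exists2 C : R, 0 < C &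
  forall D f a b, admissible a b -> truncated_data D f a b ->
  (\int[mu]_t (`|transform lam D f a b (@poi R) t 0| `^ p)%:E <=
   C%:E * \int[lam]_(y in D) (f y `^ p)%:E)%E.
Proof.
move=> p1; have := conjugate_exponentP p1.
set q := p / (p - 1) => -[q1 q0 pq].
have [Cq Cq0 HC] := poisson_ext_bounded q1.
exists (2 * Cq `^ (p - 1)); first by rewrite mulr_gt0 ?powR_gt0.
move=> D f a b ad nd; have [ma mb b0 _] := ad.
have [mD Dfin mf [M fM] [N [delta [N0 d0 abN]]]] := nd.
have [K mu_ uK] := transform_bounded (or_introl erefl) ma mb nd.
have mup : measurable_fun setT (fun t => `|transform lam D f a b (@poi R) t 0| `^ p).
  by apply: measurable_powR_comp; exact: measurableT_comp.
have up0 t : 0 <= `|transform lam D f a b (@poi R) t 0| `^ p by exact: powR_ge0.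
have ce0 : (fun _ : nat => 0 : R) n @[n --> \oo] --> (0 : R) by exact: cvg_cst.
apply: (le_cvg_error (cvg_integral_itvNn mup up0) ce0) => n; rewrite adde0.
have mE : measurable (`[- n.+1%:R, n.+1%:R]%classic : set (measurableTypeR R)) by exact: measurable_itv.
have Efin : (mu (`[(- n.+1%:R)%R, n.+1%:R]%classic : set R) < +oo)%E.
  by rewrite [X in (X < _)%E]lebesgue_measure_itv/= -EFinD; case: ifP; rewrite ltry.
have mk : measurable_fun setT (fun z : measurableTypeR R * lebesgueR R => poi (z.1 - a z.2) (0 + b z.2)).
  exact: (measurable_kernel_pair (or_introl erefl) (@measurable_id _ (measurableTypeR R) setT)
    (measurable_cst (0 : R)) ma mb).
have kM (t : measurableTypeR R) y : `[- n.+1%:R, n.+1%:R]%classic t -> D y ->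
    `|poi (t - a y) (0 + b y)| <= delta^-1.
  move=> _ Dy; have [_ /andP[h _]] := abN y Dy.
  by apply: norm_kernel_le => //; [left|rewrite add0r].
have hC (g : measurableTypeR R -> R) (B : R) : measurable_fun setT g -> (forall t, 0 <= g t <= B) ->
  (\int[lam]_(y in D) (`|\int[mu]_(t in `[(- n.+1%:R)%R, n.+1%:R]) (g t * poi (t - a y) (0 + b y))| `^ q)%:E <=
   Cq%:E * \int[mu]_(t in `[(- n.+1%:R)%R, n.+1%:R]) (g t `^ q)%:E)%E.
  move=> mg gB; exact: (poisson_ext_test q0 ad mD mE (HC a b ad) mg gB).
exact: (@duality R _ (measurableTypeR R) mu _ (lebesgueR R) lam _ D f delta^-1 M p q Cq
  mE mD Efin Dfin mf fM p1 q0 pq Cq0 (fun t y => poi (t - a y) (0 + b y)) mk kM hC).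
Qed.

Lemma cpoi_transform_bound (p : R) : 1 < p <= 2 -> exists2 C : R, 0 < C &
  forall D f a b, admissible a b -> truncated_data D f a b ->
  (\int[mu]_t (`|transform lam D f a b (@cpoi R) t 0| `^ p)%:E <=
   C%:E * \int[lam]_(y in D) (f y `^ p)%:E)%E.
Proof.
move=> p12; have /andP[p1 _] := p12.
have [C C0 HC] := poi_transform_bound p1.
have [A [B [A0 B0 AB]]] := essen_inequality p12.
exists (A * C); first by rewrite mulr_gt0.
move=> D f a b ad nd; have [ma mb b0 _] := ad.
have jf := truncated_data_integrable nd.
have [mD Dfin mf [M fM] [N [delta [N0 d0 abN]]]] := nd.
have f0 y : D y -> 0 <= f y by move=> _; have /andP[] := fM y.
have aN y : D y -> `|a y| <= N by move=> /abN[].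
have bN y : D y -> delta <= b y <= N by move=> /abN[].
have H := conjugate_transform_le mD jf f0 (measurable_funTS ma) (measurable_funTS mb) aN bN N0 d0 p12 A0 B0 AB.
apply: (le_trans H); rewrite EFinM -muleA lee_pmul2l ?lte_fin//.
apply: le_trans (HC D f a b ad nd).
rewrite le_eqVlt; apply/orP; left; apply/eqP; apply: eq_integral => t _.
rewrite ger0_norm// /transform; apply: Rintegral_ge0 => y Dy.
by rewrite mulr_ge0 ?f0// poi_ge0// add0r ltW.
Qed.

(** The operators factor through the line: transform with kernel e, then Poisson extension. *)
Lemma truncated_bound_le2 (p : R) : 1 < p <= 2 -> exists2 C : R, 0 < C &
  forall e D f a1 b1 a2 b2, kernel_part e ->
  admissible a1 b1 -> admissible a2 b2 -> truncated_data D f a2 b2 ->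
  (\int[lam]_x (`|cauchy_op e D f a1 b1 a2 b2 x| `^ p)%:E <=
   C%:E * \int[lam]_(y in D) (f y `^ p)%:E)%E.
Proof.
move=> p12; have /andP[p1 _] := p12.
have [C1 C10 H1] := poi_transform_bound p1.
have [C2 C20 H2] := cpoi_transform_bound p12.
have [Cp Cp0 HC] := poisson_ext_bounded p1.
have pi0 := pi_gt0 R.
exists (pi `^ (- p) * Cp * (C1 + C2)).
  exact: mulr_gt0 (mulr_gt0 (powR_gt0 _ pi0) Cp0) (addr_gt0 C10 C20).
move=> e D f a1 b1 a2 b2 he ad1 ad2 nd.
apply: (le_trans (cauchy_op_transform he p1 ad1 ad2 nd (HC a1 b1 ad1))).
rewrite [X in (_ <= X * _)%E]EFinM -muleA lee_pmul2l ?lte_fin ?mulr_gt0 ?powR_gt0//.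
have i0 : (0 <= \int[lam]_(y in D) (f y `^ p)%:E)%E.
  by apply: integral_ge0 => y _; rewrite lee_fin powR_ge0.
case: he => ->.
  apply: (le_trans (H1 D f a2 b2 ad2 nd)).
  by apply: lee_wpmul2r => //; rewrite lee_fin lerDl ltW.
apply: (le_trans (H2 D f a2 b2 ad2 nd)).
by apply: lee_wpmul2r => //; rewrite lee_fin lerDr ltW.
Qed.

(** For p > 2 the adjoint acts on L^q with q < 2 and has the same form, with the two families
    interchanged: the kernels are even (poi) or odd (cpoi) in A. *)
Lemma truncated_bound (p : R) : 1 < p -> exists2 C : R, 0 < C &
  forall e D E f a1 b1 a2 b2, kernel_part e ->
  admissible a1 b1 -> admissible a2 b2 -> truncated_data D f a2 b2 ->
  truncated_data E (cst 0) a1 b1 ->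
  (\int[lam]_(x in E) (`|cauchy_op e D f a1 b1 a2 b2 x| `^ p)%:E <=
   C%:E * \int[lam]_(y in D) (f y `^ p)%:E)%E.
Proof.
move=> p1; have [p2|p2] := leP p 2.
  have p12 : 1 < p <= 2 by rewrite p1.
  have [C C0 H] := truncated_bound_le2 p12; exists C => // e D E f a1 b1 a2 b2 he ad1 ad2 nd ndE.
  apply: le_trans (H e D f a1 b1 a2 b2 he ad1 ad2 nd).
  have [mD _ mf _ _] := nd; have [mE _ _ _ _] := ndE.
  have [ma1 mb1 _ _] := ad1; have [ma2 mb2 _ _] := ad2.
  have mh := measurable_cauchy_op he mD mf ma1 mb1 ma2 mb2.
  exact: (subset_integral_powR lam p mE mh).
have := conjugate_exponentP p1.
set q := p / (p - 1) => -[q1 q0 pq].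
have q2 : q <= 2 by rewrite /q ler_pdivrMr ?subr_gt0//; lra.
have q12 : 1 < q <= 2 by rewrite q1.
have [Cq Cq0 HC] := truncated_bound_le2 q12.
exists (2 * Cq `^ (p - 1)); first by rewrite mulr_gt0 ?powR_gt0.
move=> e D E f a1 b1 a2 b2 he ad1 ad2 nd ndE.
have [ma1 mb1 b10 _] := ad1; have [ma2 mb2 b20 _] := ad2.
have [mD Dfin mf [M fM] [N [delta [N0 d0 abN]]]] := nd.
have [mE Efin _ _ nE] := ndE.
have mk := measurable_kernel_pair he ma1 mb1 ma2 mb2.
have kM x y : E x -> D y -> `|e (a1 x - a2 y) (b1 x + b2 y)| <= delta^-1.
  move=> _ Dy; have [_ /andP[h _]] := abN y Dy.
  by apply: norm_kernel_le => //; rewrite (le_trans h)// lerDr ltW.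
have hC (g : lebesgueR R -> R) (B : R) : measurable_fun setT g -> (forall t, 0 <= g t <= B) ->
  (\int[lam]_(y in D) (`|\int[lam]_(x in E) (g x * e (a1 x - a2 y) (b1 x + b2 y))| `^ q)%:E <=
   Cq%:E * \int[lam]_(x in E) (g x `^ q)%:E)%E.
  move=> mg gB.
  have ndg : truncated_data E g a1 b1 by split => //; exists B.
  apply: le_trans (HC e E g a2 b2 a1 b1 he ad2 ad1 ndg).
  have mh := measurable_cauchy_op he mE mg ma2 mb2 ma1 mb1.
  rewrite (eq_integral (fun y => (`|cauchy_op e E g a2 b2 a1 b1 y| `^ q)%:E)); last first.
    move=> y _; congr (_ `^ _)%:E; rewrite /cauchy_op.
    case: he => ->.
      congr (`| _ |); apply: eq_Rintegral => x _; congr (_ * _).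
      by rewrite /poi -(sqrrN (a1 x - a2 y)) opprB (addrC (b1 x)).
    rewrite -normrN -mulN1r -RintegralZl//.
      congr (`| _ |); apply: eq_Rintegral => x _; rewrite mulN1r -mulrN; congr (_ * _).
      by rewrite /cpoi -mulNr opprB -(sqrrN (a1 x - a2 y)) opprB (addrC (b1 x)).
    have ig := truncated_data_integrable ndg.
    have [N' [delta' [_ d0' abE]]] := nE.
    apply: (integrable_weight mE ig (M := delta'^-1)).
      apply: measurable_funTS; apply: measurable_fun_cpoi; [exact: measurable_funB|exact: measurable_funD].
    move=> x Ex; have [_ /andP[h _]] := abE x Ex.
    by apply: norm_kernel_le; [right|exact: d0'|rewrite (le_trans h)// lerDl ltW].
  exact: (subset_integral_powR lam q mD mh).
exact: (@duality R _ (lebesgueR R) lam _ (lebesgueR R) lam E D f delta^-1 M p q Cq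
  mE mD Efin Dfin mf fM p1 q0 pq Cq0 (fun x y => e (a1 x - a2 y) (b1 x + b2 y)) mk kM hC).
Qed.

End truncated_bounds.

(** * Removing the truncation *)

Lemma cvg_powR {R : realType} (u : nat -> R) (v p : R) : 0 < p ->
  (forall n, 0 <= u n) -> u n @[n --> \oo] --> v -> u n `^ p @[n --> \oo] --> v `^ p.
Proof.
move=> p0 u0 uv.
have v0 : 0 <= v.
  rewrite -(cvg_lim (@norm_hausdorff _ _) uv).
  by apply: limr_ge; [exact: cvgP uv|exact: nearW].
have [v_eq|vN0] := eqVneq v 0.
  rewrite v_eq powR0 ?gt_eqF//; apply/cvgrPdist_le => e e0.
  have e0' : 0 < e `^ p^-1 by exact: powR_gt0.
  near=> n; rewrite sub0r normrN ger0_norm ?powR_ge0//.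
  have h : u n <= e `^ p^-1.
    have : `|v - u n| <= e `^ p^-1.
      by near: n; move/cvgrPdist_le : uv; exact.
    by rewrite v_eq sub0r normrN ger0_norm.
  have := ge0_ler_powR (ltW p0) (u0 n) (powR_ge0 _ _) h.
  by rewrite -powRrM mulVf ?gt_eqF// powRr1// ltW.
have vp : 0 < v by rewrite lt_neqAle eq_sym vN0.
have cw : expR (p * ln (u n)) @[n --> \oo] --> v `^ p.
  have cl : p * ln (u n) @[n --> \oo] --> p * ln v.
    by apply: cvgM; [exact: cvg_cst|apply: (cvg_comp _ _ uv); exact: continuous_ln].
  by rewrite /powR gt_eqF//; apply: (cvg_comp _ _ cl); exact: continuous_expR.
apply: cvg_trans cw; apply: near_eq_cvg; near=> n.
rewrite /powR gt_eqF//.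
near: n; exact: (cvgr_gt v uv).
Unshelve. all: by end_near. Qed.

Lemma fatou_bound {R : realType} d (T : measurableType d) (mu : {measure set T -> \bar R})
    (F : nat -> T -> \bar R) (G : T -> \bar R) (B : \bar R) :
  (forall n, measurable_fun setT (F n)) -> (forall n x, 0 <= F n x)%E ->
  (forall x, F n x @[n --> \oo] --> G x) ->
  (forall n, \int[mu]_x F n x <= B)%E -> (\int[mu]_x G x <= B)%E.
Proof.
move=> mF F0 FG FB.
have -> : (\int[mu]_x G x = \int[mu]_x limn_einf (F ^~ x))%E.
  apply: eq_integral => x _; rewrite is_cvg_limn_einfE; first by rewrite (cvg_lim _ (FG x)).
  by apply/cvg_ex; exists (G x); exact: FG.
apply: (le_trans (fatou mu measurableT mF (fun n x _ => F0 n x))).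
rewrite limn_einf_lim; apply: lime_le; first exact: is_cvg_einfs.
apply: nearW => n; apply: le_trans (FB n).
by apply: ereal_inf_lbound; exists n => /=.
Qed.

Section kernel_integrability.
Context {R : realType}.
Notation mu := (@lebesgue_measure R).
Notation lam := (@completed_lebesgue_measure R).

Lemma ratio_le_weight (b c w S : R) : 0 < b -> 0 <= c -> 0 <= w -> 0 < S ->
  b <= S -> w <= c + S -> 2 / S <= 2 * (1 + c + b) / b * (1 + w)^-1.
Proof.
move=> b0 c0 w0 S0 h1 h2.
have w1 : 0 < 1 + w by rewrite ltr_pwDl.
have bw : 0 < b * (1 + w) by exact: mulr_gt0.
rewrite -mulrA -invfM ler_pdivrMr// mulrAC ler_pdivlMr//.
rewrite -mulrA ler_pM2l//.
have h3 : 0 <= c * (S - b) by rewrite mulr_ge0// subr_ge0.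
have h4 : 0 <= b * (c + S - w) by rewrite mulr_ge0 ?subr_ge0// ltW.
have -> : (1 + c + b) * S = b * (1 + w) + ((S - b) + c * (S - b) + b * (c + S - w)) by ring.
by rewrite lerDl; apply: addr_ge0 h4; apply: addr_ge0 h3; rewrite subr_ge0.
Qed.

(** Since w(y) is in a cone above y or -y, |z(x) - conj w(y)| is at least comparable with 1 + |y|,
    for fixed x. *)
Lemma kernel_le_weight (e : R -> R -> R) (a1 b1 a2 b2 : lebesgueR R -> R) x y :
  kernel_part e -> admissible a1 b1 -> admissible a2 b2 ->
  `|e (a1 x - a2 y) (b1 x + b2 y)| <=
    2 * (1 + `|a1 x| + b1 x) / b1 x * (1 + `|(y : R)|)^-1.
Proof.
move=> he [_ _ b10 _] [_ _ b20 ad2].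
have B1 := b10 x; have B2 := b20 y.
have B0 : 0 < b1 x + b2 y by exact: addr_gt0.
have yle : `|(y : R)| <= `|a2 y| + b2 y.
  have [h|h] := ad2 y.
    have E : (y : R) = a2 y - (a2 y - y) by rewrite opprB addrC subrK.
    by rewrite {1}E (le_trans (ler_normB _ _))// lerD2l.
  have E : (y : R) = (a2 y + y) - a2 y by rewrite addrAC subrr add0r.
  by rewrite {1}E (le_trans (ler_normB _ _))// addrC lerD2l.
have a2le : `|a2 y| <= `|a1 x - a2 y| + `|a1 x|.
  have E : a2 y = - (a1 x - a2 y) + a1 x by rewrite opprB subrK.
  by rewrite {1}E (le_trans (ler_normD _ _))// normrN.
have n1 := normr_ge0 (a1 x); have n2 := normr_ge0 (y : R).
have n3 := normr_ge0 (a1 x - a2 y).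
have S0 : 0 < `|a1 x - a2 y| + (b1 x + b2 y) by rewrite ltr_wpDl.
apply: (@le_trans _ _ (2 / (`|a1 x - a2 y| + (b1 x + b2 y)))).
  by case: he => ->; [exact: poi_le_sum|exact: cpoi_le_sum].
have h1 : b1 x <= `|a1 x - a2 y| + (b1 x + b2 y) by rewrite addrCA lerDl addr_ge0// ltW.
have h2 : `|(y : R)| <= `|a1 x| + (`|a1 x - a2 y| + (b1 x + b2 y)) by lra.
exact: (ratio_le_weight B1 n1 n2 S0 h1 h2).
Qed.

Lemma poi_ge_in_cone (A B : R) : 0 < B -> `|A| <= B -> 2^-1 * B^-1 <= poi A B.
Proof.
move=> B0 AB; have B2 : 0 < B ^+ 2 by exact: exprn_gt0.
have S0 : 0 < A ^+ 2 + B ^+ 2 by rewrite ltr_wpDl ?sqr_ge0.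
have A2 : A ^+ 2 <= B ^+ 2.
  by rewrite -(ger0_norm (sqr_ge0 A)) normrX ler_sqr ?nnegrE// ltW.
rewrite /poi ler_pdivlMr// -invfM mulrC ler_pdivrMr ?mulr_gt0//.
by rewrite mulrCA -expr2; lra.
Qed.

Lemma measurable_weight :
  measurable_fun setT (fun y : lebesgueR R => (1 + `|(y : R)|)^-1).
Proof.
have mn : measurable_fun setT ((@Num.norm R R) : measurableTypeR R -> R) by exact: normr_measurable.
have m1 := measurableT_comp mn (@measurable_id_lebesgueR R).
have mc : measurable_fun setT (cst (1 : R) : lebesgueR R -> R) by exact: measurable_cst.
exact: (measurable_funV (measurable_funD mc m1)).
Qed.

(** The family x + i(1 + |x|) is admissible, and the Poisson extension along it of the indicator of
    [-1, 1] is at least 1/(1 + |x|); so this is a case of [poisson_ext_bounded]. *)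
Lemma integral_weight_lty (q : R) : 1 < q ->
  (\int[lam]_y (((1 + `|(y : R)|)^-1) `^ q)%:E < +oo)%E.
Proof.
move=> q1; have q0 : 0 < q by exact: lt_trans q1.
have [C C0 HC] := poisson_ext_bounded q1.
pose a (x : lebesgueR R) : R := x; pose b (x : lebesgueR R) : R := 1 + `|(x : R)|.
pose E : set (measurableTypeR R) := `[(-1)%R, 1%R]%classic.
have mE : measurable E by exact: measurable_itv.
have b0 x : 0 < b x by rewrite ltr_wpDr.
have mn : measurable_fun setT ((@Num.norm R R) : measurableTypeR R -> R) by exact: normr_measurable.
have m1 := measurableT_comp mn (@measurable_id_lebesgueR R).
have mc : measurable_fun setT (cst (1 : R) : lebesgueR R -> R) by exact: measurable_cst.
have ad : admissible a b.
  split; [exact: measurable_id_lebesgueR|exact: (measurable_funD mc m1)|exact: b0|].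
  by move=> x; left; rewrite /a subrr normr0 (ltW (b0 x)).
pose g : R -> R := \1_E.
have mg : measurable_fun setT g by exact: measurable_indic.
have gM t : 0 <= g t <= 1 by rewrite /g indicE ler0n/=; case: (t \in E).
have muE : mu E = (1 + 1)%:E.
  by rewrite [LHS]lebesgue_measure_itv/= ifT ?lte_fin ?gtrN ?ltr01// -EFinD opprK.
have wP y : (1 + `|(y : R)|)^-1 <= poisson_ext g a b y.
  have iE : mu.-integrable E (EFin \o (cst (2^-1 * (b y)^-1))).
    apply: measurable_bounded_integrable => //; first by rewrite [X in (X < _)%E]muE ltry.
    exists `|2^-1 * (b y)^-1|; split; first exact: num_real.
    by move=> M hM t _ /=; exact: ltW.
  have ip : mu.-integrable E (EFin \o (fun t => poi (t - a y) (b y))).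
    by apply: integrableS (integrable_poi (a y) (b0 y)).
  have -> : poisson_ext g a b y = \int[mu]_(t in E) poi (t - a y) (b y).
    rewrite /poisson_ext [RHS]Rintegral_mkcond; apply: eq_Rintegral => t _.
    by rewrite patchE /g indicE; case: (t \in E); rewrite ?mul1r ?mul0r.
  have -> : (1 + `|(y : R)|)^-1 = \int[mu]_(t in E) (2^-1 * (b y)^-1).
    rewrite Rintegral_cst// [X in _ * X]/= muE/= mulrC mulrA.
    by rewrite mulfV ?mul1r//; lra.
  apply: le_Rintegral => // t; rewrite /E/= in_itv/= => tE.
  have tb : `|t - a y| <= b y.
    by rewrite (le_trans (ler_normB _ _))// lerD2r ler_norml.
  exact: poi_ge_in_cone.
have g0 t : 0 <= g t by have /andP[] := gM t.
have g1 t : g t <= 1 by have /andP[] := gM t.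
have mP := measurable_poisson_ext ad mg g0 g1.
have w0 y : 0 <= (1 + `|(y : R)|)^-1 by rewrite invr_ge0 ltW// b0.
have L : (\int[lam]_y (((1 + `|(y : R)|)^-1) `^ q)%:E <=
    (1 `^ q)%:E * \int[lam]_y (poisson_ext g a b y `^ q)%:E)%E.
  have wP1 y : `|(1 + `|(y : R)|)^-1| <= 1 * poisson_ext g a b y.
    by rewrite mul1r ger0_norm.
  have E1 : (\int[lam]_y (((1 + `|(y : R)|)^-1) `^ q)%:E =
      \int[lam]_y (`|(1 + `|(y : R)|)^-1| `^ q)%:E)%E.
    by apply: eq_integral => y _; rewrite (ger0_norm (w0 y)).
  rewrite E1.
  exact: (le_integral_powR lam measurable_weight mP (poisson_ext_ge0 ad g0) ler01 (ltW q0) wP1).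
apply: (le_lt_trans L); rewrite powR1 mul1e.
apply: (le_lt_trans (HC a b ad g 1 mg gM)).
have -> : (\int[mu]_t (g t `^ q)%:E = mu E)%E.
  rewrite -[in RHS](setIT E) -(integral_indic mu measurableT mE).
  apply: eq_integral => t _; rewrite /g indicE.
  by case: (t \in E); rewrite ?powR1 ?powR0// gt_eqF.
by rewrite muE -EFinM ltry.
Qed.
End kernel_integrability.

(** Young's inequality bounds f w by f^p/p + w^q/q. *)
Lemma young_integrable {R : realType} d (T : measurableType d) (nu : {measure set T -> \bar R})
    (f w h : T -> R) (p q K : R) :
  0 < p -> 0 < q -> p^-1 + q^-1 = 1 -> 0 <= K ->
  measurable_fun setT f -> measurable_fun setT w -> measurable_fun setT h ->
  (forall y, 0 <= w y) -> (forall y, `|h y| <= `|f y| * (K * w y)) ->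
  (\int[nu]_y (`|f y| `^ p)%:E < +oo)%E -> (\int[nu]_y (w y `^ q)%:E < +oo)%E ->
  nu.-integrable setT (EFin \o h).
Proof.
move=> p0 q0 pq K0 mf mw mh w0 hK fp wq.
have int (g : T -> R) (r : R) : measurable_fun setT g -> (\int[nu]_y (g y `^ r)%:E < +oo)%E ->
    nu.-integrable setT (fun y => (g y `^ r)%:E).
  move=> mg gr; apply/integrableP; split.
    by apply/measurable_EFinP; exact: measurable_powR_comp.
  rewrite (eq_integral (fun y => (g y `^ r)%:E))// => y _.
  by rewrite /= ger0_norm// powR_ge0.
have mnf : measurable_fun setT (fun y => `|f y|) by exact: measurableT_comp.
have i1 := int _ _ mnf fp; have i2 := int _ _ mw wq.
have := integrableD measurableT (integrableZl measurableT (K / p) i1)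
  (integrableZl measurableT (K / q) i2).
apply: le_integrable => //; first exact/measurable_EFinP.
move=> y _; rewrite lee_fin (le_trans (hK y))//.
have f0 := normr_ge0 (f y).
rewrite [leRHS]ger0_norm; last by rewrite addr_ge0// mulr_ge0 ?powR_ge0// divr_ge0// ltW.
have Y := conjugate_powR f0 (w0 y) p0 q0 pq.
rewrite mulrCA (le_trans (ler_wpM2l K0 Y))//.
by rewrite le_eqVlt; apply/orP; left; apply/eqP; ring.
Qed.

Section truncation.
Context {R : realType}.
Notation mu := (@lebesgue_measure R).
Notation lam := (@completed_lebesgue_measure R).

Lemma measurable_le_cst d (T : measurableType d) (h : T -> R) (c : R) :
  measurable_fun setT h -> measurable [set y | h y <= c].
Proof.
move=> mh; have := mh measurableT _ (measurable_itv `]-oo, c]).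
by rewrite setTI; congr measurable; apply/seteqP; split => y; rewrite /= in_itv.
Qed.

Lemma measurable_ge_cst d (T : measurableType d) (h : T -> R) (c : R) :
  measurable_fun setT h -> measurable [set y | c <= h y].
Proof.
move=> mh; have := mh measurableT _ (measurable_itv `[c, +oo[).
by rewrite setTI; congr measurable; apply/seteqP; split => y; rewrite /= in_itv/= andbT.
Qed.

(** These sets exhaust the line, because b > 0 everywhere. *)
Definition truncation (a b : lebesgueR R -> R) (n : nat) : set (lebesgueR R) :=
  [set y | `|(y : R)| <= n%:R] `&` ([set y | `|a y| <= n%:R] `&`
  ([set y | b y <= n%:R] `&` [set y | n.+1%:R^-1 <= b y])).

Lemma measurable_truncation a b n : measurable_fun setT a -> measurable_fun setT b ->
  measurable (truncation a b n).
Proof.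
move=> ma mb.
have mn : measurable_fun setT ((@Num.norm R R) : measurableTypeR R -> R) by exact: normr_measurable.
have mn1 := measurableT_comp mn (@measurable_id_lebesgueR R).
have mn2 := measurableT_comp mn ma.
apply: measurableI; first exact: (measurable_le_cst n%:R mn1).
apply: measurableI; first exact: (measurable_le_cst n%:R mn2).
apply: measurableI; first exact: (measurable_le_cst n%:R mb).
exact: (measurable_ge_cst n.+1%:R^-1 mb).
Qed.

Lemma truncation_lty a b n : measurable_fun setT a -> measurable_fun setT b ->
  (lam (truncation a b n) < +oo)%E.
Proof.
move=> ma mb.
pose I : set (measurableTypeR R) := `[(- n%:R)%R, n%:R]%classic.
have mI : measurable I by exact: measurable_itv.
have sI : truncation a b n `<=` (I : set (lebesgueR R)).
  by move=> y [/= + _]; rewrite /I /= in_itv/= ler_norml.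
have mI' : measurable (I : set (lebesgueR R)) by exact: borel_lebesgueR.
have muI : (mu I < +oo)%E.
  by rewrite [X in (X < _)%E]lebesgue_measure_itv/= -EFinD; case: ifP; rewrite ltry.
have mtr := measurable_truncation n ma mb.
apply: le_lt_trans (muI : (lam (I : set (lebesgueR R)) < +oo)%E).
by apply: le_measure; rewrite ?inE.
Qed.

Lemma near_truncation a b y : 0 < b y -> \forall n \near \oo, truncation a b n y.
Proof.
move=> b0; near=> n; split; [|split; [|split]] => /=.
- by near: n; exact: nbhs_infty_ger.
- by near: n; exact: nbhs_infty_ger.
- by near: n; exact: nbhs_infty_ger.
- have h : (b y)^-1 <= n%:R by near: n; exact: nbhs_infty_ger.
  rewrite -[leRHS]invrK lef_pV2 ?posrE ?invr_gt0// (le_trans h)// ler_nat.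
  exact: leqnSn.
Unshelve. all: by end_near. Qed.

Lemma truncated_data_truncation (f a b : lebesgueR R -> R) n : measurable_fun setT f -> (forall y, 0 <= f y) ->
  measurable_fun setT a -> measurable_fun setT b ->
  truncated_data (truncation a b n) (fun y => Num.min (f y) n%:R) a b.
Proof.
move=> mf f0 ma mb; have mD := measurable_truncation n ma mb; split.
- exact: mD.
- exact: truncation_lty.
- by apply: measurable_minr => //; exact: measurable_cst.
- by exists n%:R => y; rewrite le_min f0 ler0n ge_min lexx orbT.
- exists n%:R, n.+1%:R^-1; split; rewrite ?invr_gt0//.
  by move=> y [_ [/= h1 [h2 h3]]]; rewrite h1 h2 h3.
Qed.
End truncation.

Lemma truncated_Rintegral_cvg {R : realType} d (T : measurableType d)
    (nu : {measure set T -> \bar R}) (f k : T -> R) (D : nat -> set T) :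
  measurable_fun setT f -> measurable_fun setT k -> (forall y, 0 <= f y) ->
  (forall n, measurable (D n)) -> (forall y, \forall n \near \oo, D n y) ->
  nu.-integrable setT (EFin \o (fun y => f y * k y)) ->
  \int[nu]_(y in D n) (Num.min (f y) n%:R * k y) @[n --> \oo] --> \int[nu]_y (f y * k y).
Proof.
move=> mf mk f0 mD nD ifk.
pose psi n := (fun y => Num.min (f y) n%:R * k y) \_ (D n).
have mpsi n : measurable_fun setT (psi n).
  apply/(measurable_restrictT _ (mD n)).1; apply: measurable_funTS.
  apply: measurable_funM => //; apply: measurable_minr => //; exact: measurable_cst.
have cpsi y : [set: T] y -> (psi n y)%:E @[n --> \oo] --> (f y * k y)%:E.
  move=> _; apply: cvg_near_cst; near=> n.
  rewrite /psi patchE ifT; last by rewrite inE; near: n; exact: nD.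
  rewrite min_l//; near: n; exact: nbhs_infty_ger.
have dom n y : [set: T] y -> (`|(psi n y)%:E| <= `|(f y * k y)%:E|)%E.
  move=> _; rewrite /psi patchE/= lee_fin; case: ifP => _; last by rewrite /point/= normr0.
  rewrite !normrM ler_wpM2r// !ger0_norm// ?ge_min ?lexx//.
  by rewrite le_min f0 ler0n.
have ifk' := integrable_abse ifk.
have mpsi' n : measurable_fun setT (EFin \o psi n) by exact/measurable_EFinP.
have gfin y : [set: T] y -> (abse \o (EFin \o (fun y => f y * k y))) y \is a fin_num by [].
have := dominated_cvg measurableT mpsi' cpsi gfin ifk' dom.
have fin := integrable_fin_num measurableT ifk.
have E n : fine (\int[nu]_(y in D n) (Num.min (f y) n%:R * k y)%:E) = fine (\int[nu]_y (EFin \o psi n) y).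
  congr fine; rewrite integral_mkcond; apply: eq_integral => y _.
  by rewrite /psi /= !patchE; case: ifP.
rewrite -(fineK fin) => /fine_cvg; rewrite /Rintegral.
apply: cvg_trans; apply: near_eq_cvg; apply: nearW => n /=.
by rewrite E.
Unshelve. all: by end_near. Qed.

Section general_bound.
Context {R : realType}.
Notation lam := (@completed_lebesgue_measure R).

Lemma cauchy_op_integrable (p : R) (e : R -> R -> R) (a1 b1 a2 b2 f : lebesgueR R -> R) x :
  1 < p -> kernel_part e -> admissible a1 b1 -> admissible a2 b2 ->
  measurable_fun setT f -> (\int[lam]_y (`|f y| `^ p)%:E < +oo)%E ->
  lam.-integrable setT (EFin \o (fun y => f y * e (a1 x - a2 y) (b1 x + b2 y))).
Proof.
move=> p1 he ad1 ad2 mf fp; have p0 : 0 < p by exact: lt_trans p1.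
have [q1 q0 pq] := conjugate_exponentP p1.
have [ma2 mb2 _ _] := ad2; have [_ _ b10 _] := ad1.
have mk := measurable_kernel_section a1 b1 x he ma2 mb2.
have mh := measurable_funM mf mk.
have K0 : 0 <= 2 * (1 + `|a1 x| + b1 x) / b1 x.
  rewrite divr_ge0 ?(ltW (b10 x))// mulr_ge0//; apply: addr_ge0; last exact: ltW.
  exact: addr_ge0.
have w0 (y : lebesgueR R) : 0 <= (1 + `|(y : R)|)^-1 by rewrite invr_ge0 addr_ge0.
have hK y : `|f y * e (a1 x - a2 y) (b1 x + b2 y)| <=
    `|f y| * (2 * (1 + `|a1 x| + b1 x) / b1 x * (1 + `|(y : R)|)^-1).
  by rewrite normrM ler_wpM2l//; exact: (kernel_le_weight x y he ad1 ad2).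
exact: (young_integrable p0 q0 pq K0 mf (@measurable_weight R) mh w0 hK fp (integral_weight_lty q1)).
Qed.

(** Truncate f at height n and restrict x and y to the n-th truncation sets.  The operators converge
    at every x by dominated convergence, and Fatou's lemma passes to the limit in the norms. *)
Lemma cauchy_op_nonneg_bound (p : R) : 1 < p -> exists2 C : R, 0 < C &
  forall e (f a1 b1 a2 b2 : lebesgueR R -> R), kernel_part e ->
  admissible a1 b1 -> admissible a2 b2 -> measurable_fun setT f -> (forall y, 0 <= f y) ->
  (\int[lam]_y (`|f y| `^ p)%:E < +oo)%E ->
  (\int[lam]_x (`|cauchy_op e setT f a1 b1 a2 b2 x| `^ p)%:E <=
   C%:E * \int[lam]_y (`|f y| `^ p)%:E)%E.
Proof.
move=> p1; have p0 : 0 < p by exact: lt_trans p1.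
have [C C0 HC] := truncated_bound p1; exists C => // e f a1 b1 a2 b2 he ad1 ad2 mf f0 fp.
have [ma1 mb1 b10 _] := ad1; have [ma2 mb2 b20 _] := ad2.
pose fn n y := Num.min (f y) n%:R.
have nd n : truncated_data (truncation a2 b2 n) (fn n) a2 b2 by exact: truncated_data_truncation.
have ndE n : truncated_data (truncation a1 b1 n) (cst 0) a1 b1.
  have [mE Efin _ _ nE] := truncated_data_truncation n mf f0 ma1 mb1.
  by split => //; exists 0 => y; rewrite lexx.
have mE n : measurable (truncation a1 b1 n) by exact: measurable_truncation.
have mD n : measurable (truncation a2 b2 n) by exact: measurable_truncation.
pose hn n := cauchy_op e (truncation a2 b2 n) (fn n) a1 b1 a2 b2.
pose h := cauchy_op e setT f a1 b1 a2 b2.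
have mhn n : measurable_fun setT (hn n).
  by have [_ _ mfn _ _] := nd n; exact: measurable_cauchy_op.
have ch x : hn n x @[n --> \oo] --> h x.
  exact: (truncated_Rintegral_cvg mf (measurable_kernel_section a1 b1 x he ma2 mb2) f0 mD
    (fun y => near_truncation a2 (b20 y)) (cauchy_op_integrable x p1 he ad1 ad2 mf fp)).
have Hn n : (\int[lam]_(x in truncation a1 b1 n) (`|hn n x| `^ p)%:E <=
    C%:E * \int[lam]_y (`|f y| `^ p)%:E)%E.
  apply: (le_trans (HC e _ _ (fn n) a1 b1 a2 b2 he ad1 ad2 (nd n) (ndE n))).
  rewrite lee_pmul2l ?lte_fin//.
  have [_ _ mfn _ _] := nd n.
  apply: (@le_trans _ _ (\int[lam]_(y in truncation a2 b2 n) (`|f y| `^ p)%:E)%E).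
    apply: ge0_le_integral.
    - exact: mD.
    - by move=> y _; rewrite lee_fin powR_ge0.
    - by apply/measurable_EFinP; apply: measurable_powR_comp; exact: measurable_funTS.
    - by apply/measurable_EFinP; apply: measurable_powR_comp; apply: measurable_funTS; exact: measurableT_comp.
    - move=> y _; rewrite lee_fin ge0_ler_powR ?nnegrE ?(ltW p0)// /fn.
        by rewrite le_min f0 ler0n.
      by rewrite (ger0_norm (f0 y)) ge_min lexx.
  exact: (subset_integral_powR lam p (mD n) mf).
move: (C%:E * _)%E Hn => B Hn.
have -> : (\int[lam]_x (`|cauchy_op e setT f a1 b1 a2 b2 x| `^ p)%:E = \int[lam]_x (`|h x| `^ p)%:E)%E by [].
move: h ch => h ch; move: hn mhn ch Hn => hn mhn ch Hn.
apply: (@fatou_bound R _ (lebesgueR R) lam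
  (fun n => (fun x => (`|hn n x| `^ p)%:E) \_ (truncation a1 b1 n))).
- move=> n; apply/(measurable_restrictT _ (mE n)).1; apply: measurable_funTS.
  by apply/measurable_EFinP; apply: measurable_powR_comp; exact: measurableT_comp.
- by move=> n x; rewrite patchE; case: ifP => // _; rewrite lee_fin powR_ge0.
- move=> x; have c1 : (`|hn n x| `^ p)%:E @[n --> \oo] --> (`|h x| `^ p)%:E.
    apply: cvg_EFin; first exact: nearW.
    by apply: cvg_powR => //; apply: cvg_norm.
  apply: cvg_trans c1; apply: near_eq_cvg; near=> n.
  rewrite patchE ifT// inE; near: n; exact: near_truncation.
- by move=> n; rewrite -integral_mkcond; exact: (Hn n).
Unshelve. all: by end_near. Qed.

End general_bound.

Lemma powR_add_le {R : realType} (u v p : R) : 0 <= u -> 0 <= v -> 0 <= p ->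
  (u + v) `^ p <= 2 `^ p * (u `^ p + v `^ p).
Proof.
move=> u0 v0 p0.
wlog uv : u v u0 v0 / u <= v.
  move=> H; have [uv|vu] := leP u v; first exact: H.
  by rewrite addrC [u `^ p + _]addrC H// ltW.
apply: (@le_trans _ _ ((2 * v) `^ p)).
  by rewrite ge0_ler_powR ?nnegrE ?addr_ge0 ?mulr_ge0//; lra.
by rewrite powRM// ler_wpM2l ?powR_ge0// lerDr powR_ge0.
Qed.

Lemma integral_powR_le_add {R : realType} d (T : measurableType d) (nu : {measure set T -> \bar R})
    (h u v : T -> R) (p : R) : 0 <= p ->
  measurable_fun setT h -> measurable_fun setT u -> measurable_fun setT v ->
  (forall x, `|h x| <= `|u x| + `|v x|) ->
  (\int[nu]_x (`|h x| `^ p)%:E <=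
   (2 `^ p)%:E * (\int[nu]_x (`|u x| `^ p)%:E + \int[nu]_x (`|v x| `^ p)%:E))%E.
Proof.
move=> p0 mh mu_ mv huv.
have mp (g : T -> R) : measurable_fun setT g -> measurable_fun setT (fun x => (`|g x| `^ p)%:E).
  by move=> mg; apply/measurable_EFinP; apply: measurable_powR_comp; exact: measurableT_comp.
have ge0 (g : T -> R) x : [set: T] x -> (0 <= (`|g x| `^ p)%:E)%E by rewrite lee_fin powR_ge0.
have m1 := mp _ mu_; have m2 := mp _ mv.
rewrite -(ge0_integralD nu measurableT (ge0 u) m1 (ge0 v) m2).
rewrite -ge0_integralZl_EFin ?powR_ge0//.
- apply: ge0_le_integral => //.
  + exact: mp.
  + by apply: measurable_funeM; exact: emeasurable_funD.
  + move=> x _; rewrite -EFinD -EFinM lee_fin.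
    apply: le_trans (powR_add_le (normr_ge0 _) (normr_ge0 _) p0).
    by rewrite ge0_ler_powR ?nnegrE// addr_ge0.
- by move=> x _; rewrite adde_ge0// lee_fin powR_ge0.
- exact: emeasurable_funD.
Qed.

Section signed_bound.
Context {R : realType}.
Notation lam := (@completed_lebesgue_measure R).

Lemma le_integral_norm_powR d (T : measurableType d) (nu : {measure set T -> \bar R})
    (f g : T -> R) (p : R) : 0 <= p -> measurable_fun setT f -> measurable_fun setT g ->
  (forall x, `|f x| <= `|g x|) ->
  (\int[nu]_x (`|f x| `^ p)%:E <= \int[nu]_x (`|g x| `^ p)%:E)%E.
Proof.
move=> p0 mf mg fg.
have := @le_integral_powR R d T nu f (fun x => `|g x|) 1 p mf _ _ ler01 p0.
rewrite powR1 mul1e; apply => //; first exact: measurableT_comp.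
by move=> x; rewrite mul1r.
Qed.

(** The positive and the negative part of f are treated separately. *)
Lemma cauchy_op_bound (p : R) : 1 < p -> exists2 C : R, 0 < C &
  forall e (f a1 b1 a2 b2 : lebesgueR R -> R), kernel_part e ->
  admissible a1 b1 -> admissible a2 b2 -> measurable_fun setT f ->
  (\int[lam]_y (`|f y| `^ p)%:E < +oo)%E ->
  (\int[lam]_x (`|cauchy_op e setT f a1 b1 a2 b2 x| `^ p)%:E <=
   C%:E * \int[lam]_y (`|f y| `^ p)%:E)%E.
Proof.
move=> p1; have p0 : 0 <= p by rewrite ltW// (lt_trans ltr01 p1).
have [C C0 HC] := cauchy_op_nonneg_bound p1.
exists (2 `^ p * (C + C)); first exact: mulr_gt0 (powR_gt0 _ (ltr0Sn _ 1)) (addr_gt0 C0 C0).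
move=> e f a1 b1 a2 b2 he ad1 ad2 mf fp.
have [ma1 mb1 _ _] := ad1; have [ma2 mb2 _ _] := ad2.
pose g1 y := Num.max (f y) 0; pose g2 y := Num.max (- f y) 0.
have mg1 : measurable_fun setT g1 by apply: measurable_maxr => //; exact: measurable_cst.
have mg2 : measurable_fun setT g2.
  by apply: measurable_maxr; [exact: measurable_funN|exact: measurable_cst].
have g10 y : 0 <= g1 y by rewrite le_max lexx orbT.
have g20 y : 0 <= g2 y by rewrite le_max lexx orbT.
have g1f y : `|g1 y| <= `|f y|.
  by rewrite ger0_norm// ge_max ler_norm normr_ge0.
have g2f y : `|g2 y| <= `|f y|.
  by rewrite ger0_norm// ge_max -normrN ler_norm normr_ge0.
have L1 := le_integral_norm_powR lam p0 mg1 mf g1f.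
have L2 := le_integral_norm_powR lam p0 mg2 mf g2f.
have fin1 := le_lt_trans L1 fp; have fin2 := le_lt_trans L2 fp.
have fE y : f y = g1 y - g2 y.
  rewrite /g1 /g2; case/orP: (le_total 0 (f y)) => h.
    by rewrite max_l// max_r ?subr0// oppr_le0.
  by rewrite max_r// max_l ?oppr_ge0// opprK add0r.
pose h1 := cauchy_op e setT g1 a1 b1 a2 b2; pose h2 := cauchy_op e setT g2 a1 b1 a2 b2.
have hE x : cauchy_op e setT f a1 b1 a2 b2 x = h1 x - h2 x.
  have i1 := cauchy_op_integrable x p1 he ad1 ad2 mg1 fin1.
  have i2 := cauchy_op_integrable x p1 he ad1 ad2 mg2 fin2.
  rewrite /h1 /h2 /cauchy_op -(RintegralB measurableT i1 i2).
  by apply: eq_Rintegral => y _; rewrite (fE y) mulrBl.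
have mh := measurable_cauchy_op he measurableT mf ma1 mb1 ma2 mb2.
have mh1 := measurable_cauchy_op he measurableT mg1 ma1 mb1 ma2 mb2.
have mh2 := measurable_cauchy_op he measurableT mg2 ma1 mb1 ma2 mb2.
have hle x : `|cauchy_op e setT f a1 b1 a2 b2 x| <= `|h1 x| + `|h2 x|.
  by rewrite hE ler_normB.
apply: (le_trans (integral_powR_le_add lam p0 mh mh1 mh2 hle)).
rewrite EFinM -muleA; apply: lee_wpmul2l; first by rewrite lee_fin powR_ge0.
have H1 := HC e g1 a1 b1 a2 b2 he ad1 ad2 mg1 g10 fin1.
have H2 := HC e g2 a1 b1 a2 b2 he ad1 ad2 mg2 g20 fin2.
have C0' : (0 <= C%:E)%E by rewrite lee_fin ltW.
rewrite EFinD (ge0_muleDl _ C0' C0').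
exact: leeD (le_trans H1 (lee_wpmul2l C0' L1)) (le_trans H2 (lee_wpmul2l C0' L2)).
Qed.

End signed_bound.

Local Open Scope complex_scope.

(** * Polar coordinates on the half line *)

Section polar.
Context {R : realType}.

Lemma norm_Re_le_normc (z : R[i]) : `|complex.Re z| <= ComplexField.Normc.normc z.
Proof.
case: z => x y /=; rewrite -(ger0_norm (sqrtr_ge0 _)) -ler_sqr ?nnegrE//.
by rewrite -!normrX sqr_sqrtr ?addr_ge0 ?sqr_ge0// !ger0_norm ?addr_ge0 ?sqr_ge0// lerDl sqr_ge0.
Qed.

Lemma norm_Im_le_normc (z : R[i]) : `|complex.Im z| <= ComplexField.Normc.normc z.
Proof.
case: z => x y /=; rewrite -(ger0_norm (sqrtr_ge0 _)) -ler_sqr ?nnegrE//.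
by rewrite -!normrX sqr_sqrtr ?addr_ge0 ?sqr_ge0// !ger0_norm ?addr_ge0 ?sqr_ge0// lerDr sqr_ge0.
Qed.

Lemma normc_ge0 (z : R[i]) : 0 <= ComplexField.Normc.normc z.
Proof. by case: z => x y /=; exact: sqrtr_ge0. Qed.

Lemma normc_le_Re_Im (z : R[i]) :
  ComplexField.Normc.normc z <= `|complex.Re z| + `|complex.Im z|.
Proof.
case: z => x y /=; have s0 : 0 <= `|x| + `|y| by exact: addr_ge0.
rewrite -ler_sqr ?nnegrE ?sqrtr_ge0// sqr_sqrtr ?addr_ge0 ?sqr_ge0//.
rewrite sqrrD !real_normK ?num_real// addrAC lerDl mulrn_wge0// mulr_ge0//.
Qed.

Lemma measurable_Rplus : measurable (Rplus R).
Proof.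
have : measurable (`]0, +oo[%classic : set (measurableTypeR R)) by exact: measurable_itv.
move/borel_lebesgueR; congr measurable; apply/seteqP; split => x; rewrite /Rplus /= in_itv/= andbT//.
Qed.

(** x e^(i theta(x)) on the half line, continued by x + i elsewhere: this gives an admissible family
    over the whole line, and the integrands will vanish outside the half line. *)
Definition polar_re (theta : lebesgueR R -> R) (x : lebesgueR R) : R :=
  if 0 < (x : R) then (x : R) * cos (theta x) else x.

Definition polar_im (theta : lebesgueR R -> R) (x : lebesgueR R) : R :=
  if 0 < (x : R) then (x : R) * sin (theta x) else 1.

Lemma measurable_if_Rplus (f g : lebesgueR R -> R) :
  measurable_fun (Rplus R) f -> measurable_fun setT g ->
  measurable_fun setT (fun x : lebesgueR R => if 0 < (x : R) then f x else g x).
Proof.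
move=> mf mg; have mRp := measurable_Rplus; have mC := measurableC mRp.
rewrite -(setUv (Rplus R)); apply/(measurable_funU _ mRp mC); split.
  by apply: eq_measurable_fun mf => x /set_mem xp; rewrite ifT.
apply: (@eq_measurable_fun _ _ _ _ _ g); last exact: measurable_funTS.
by move=> x /set_mem /negP xp; rewrite ifN.
Qed.

Lemma continuous_measurable_comp d (T : measurableType d) (D : set T) (f : T -> R) (h : R -> R) :
  continuous h -> measurable_fun D f -> measurable_fun D (fun x => h (f x)).
Proof.
by move=> ch mf; exact: (measurableT_comp (continuous_measurable_fun ch) mf).
Qed.

(** If c >= 0 then (1 - c)^2 <= (1 - c)(1 + c) = s^2; if c < 0 the same holds with - c. *)
Lemma unit_circle_cone (c s : R) : c ^+ 2 + s ^+ 2 = 1 -> 0 < s ->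
  `|c - 1| <= s \/ `|c + 1| <= s.
Proof.
move=> cs s0; have := ltW s0; have sq (u : R) : u ^+ 2 <= s ^+ 2 -> `|u| <= s.
  by move=> h; rewrite -ler_sqr ?nnegrE ?(ltW s0)// real_normK ?num_real.
have c1 : c ^+ 2 <= 1 by rewrite -cs lerDl sqr_ge0.
have /andP[cl cu] : -1 <= c <= 1.
  by rewrite -ler_norml -(ler_sqr (_ : _ \in Num.nneg)) ?nnegrE// real_normK ?num_real ?expr1n.
move=> _; case: (leP 0 c) => c0; [left|right]; apply: sq; nra.
Qed.

Lemma admissible_polar (theta : lebesgueR R -> R) : angle theta ->
  admissible (polar_re theta) (polar_im theta).
Proof.
move=> [mt t0].
have mid : measurable_fun setT (fun x : lebesgueR R => (x : R)) by exact: measurable_id_lebesgueR.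
have mid' : measurable_fun (Rplus R) (fun x : lebesgueR R => (x : R)) by exact: measurable_funTS.
split.
- apply: measurable_if_Rplus mid; apply: (measurable_funM mid').
  exact: (continuous_measurable_comp (@continuous_cos R) mt).
- apply: measurable_if_Rplus; last exact: measurable_cst.
  apply: (measurable_funM mid').
  exact: (continuous_measurable_comp (@continuous_sin R) mt).
- move=> x; rewrite /polar_im; case: ifP => // x0.
  by rewrite mulr_gt0// sin_gt0_pi// t0.
- move=> x; rewrite /polar_im /polar_re; case: ifP => x0; last first.
    by left; rewrite subrr normr0.
  have s0 : 0 < sin (theta x) by rewrite sin_gt0_pi// t0.
  have [h|h] := unit_circle_cone (cos2Dsin2 (theta x)) s0; [left|right].
    by rewrite -[X in _ * cos _ - X]mulr1 -mulrBr normrM gtr0_norm// ler_pM2l.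
  by rewrite -[X in _ * cos _ + X]mulr1 -mulrDr normrM gtr0_norm// ler_pM2l.
Qed.

(** (u + iv)(cpoi - i poi) = (u cpoi + v poi) + i (v cpoi - u poi). *)
Lemma integrandE (theta1 theta2 : lebesgueR R -> R) (f : lebesgueR R -> R[i]) x y :
  let A := polar_re theta1 x - polar_re theta2 y in
  let B := polar_im theta1 x + polar_im theta2 y in
  Rplus R x -> Rplus R y ->
  complex.Re (integrand theta1 theta2 f x y) =
    complex.Re (f y) * cpoi A B + complex.Im (f y) * poi A B /\
  complex.Im (integrand theta1 theta2 f x y) =
    complex.Im (f y) * cpoi A B - complex.Re (f y) * poi A B.
Proof.
move=> A B x0 y0.
have -> : integrand theta1 theta2 f x y = f y * (A +i* B)^-1.
  rewrite /integrand /expi cosN sinN; congr (_ * _^-1).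
  rewrite /A /B /polar_re /polar_im !ifT//.
  by apply/eqP; rewrite eq_complex /= !mul0r !subr0 !addr0 mulrN opprK !eqxx.
case: (f y) => u v; rewrite /poi /cpoi /=.
by split; rewrite ?mulrN ?opprK ?mulrA// addrC.
Qed.
End polar.

(** * The operator on the half line *)

Lemma integral_powR_le_add_bound {R : realType} d (T : measurableType d)
    (nu : {measure set T -> \bar R}) (h u v : T -> R) (p : R) (B : \bar R) : 0 <= p ->
  measurable_fun setT h -> measurable_fun setT u -> measurable_fun setT v ->
  (forall x, `|h x| <= `|u x| + `|v x|) ->
  (\int[nu]_x (`|u x| `^ p)%:E <= B)%E -> (\int[nu]_x (`|v x| `^ p)%:E <= B)%E ->
  (\int[nu]_x (`|h x| `^ p)%:E <= (2 `^ p)%:E * (B + B))%E.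
Proof.
move=> p0 mh mu_ mv huv Bu Bv.
have q0 : (0 <= (2 `^ p)%:E)%E by rewrite lee_fin powR_ge0.
exact: (le_trans (integral_powR_le_add nu p0 mh mu_ mv huv) (lee_wpmul2l q0 (leeD Bu Bv))).
Qed.

Notation part_of_complex part := (part = @complex.Re _ \/ part = @complex.Im _).

Section assembly.
Context {R : realType} (p : R) (p1 : 1 < p).
Notation lam := (@completed_lebesgue_measure R).
Notation modulus := (@ComplexField.Normc.normc R).

Let p0 : 0 < p. Proof. exact: lt_trans p1. Qed.

Definition half_line (g : lebesgueR R -> R) : lebesgueR R -> R := g \_ (Rplus R).

(** The p-th power of the norm. *)
Definition energy (f : lebesgueR R -> R[i]) : \bar R :=
  (\int[lam]_x (`|half_line (modulus \o f) x| `^ p)%:E)%E.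

Lemma LpnormE f : Lpnorm p f = (energy f `^ p^-1)%E.
Proof.
rewrite /Lpnorm unlock /energy; congr (_ `^ _)%E; apply: eq_integral => x _.
by rewrite /half_line !patchE; case: ifP => _ //=; rewrite /point/= ?normr0.
Qed.

Lemma energy_ge0 f : (0 <= energy f)%E.
Proof. by apply: integral_ge0 => x _; rewrite lee_fin powR_ge0. Qed.

Lemma Lpnorm_lty f : (Lpnorm p f < +oo)%E <-> (energy f < +oo)%E.
Proof.
rewrite LpnormE; split; first by apply: lty_poweRy; rewrite invr_neq0// gt_eqF.
exact: poweR_lty.
Qed.

Lemma measurable_half_line (g : lebesgueR R -> R) : measurable_fun (Rplus R) g ->
  measurable_fun setT (half_line g).
Proof. by move=> mg; apply/(measurable_restrictT _ measurable_Rplus).1. Qed.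

Lemma measurable_normc (f : lebesgueR R -> R[i]) : cmeasurable (Rplus R) f ->
  measurable_fun (Rplus R) (modulus \o f).
Proof.
move=> [mr mi].
have -> : modulus \o f =
    (fun x => (complex.Re (f x) ^+ 2 + complex.Im (f x) ^+ 2) `^ 2^-1).
  apply/funext => x /=; case: (f x) => a b /=.
  by rewrite powR12_sqrt// addr_ge0 ?sqr_ge0.
by apply: measurable_powR_comp; apply: measurable_funD; exact: measurable_funX.
Qed.

Lemma part_energy (part : R[i] -> R) (f : lebesgueR R -> R[i]) :
  part_of_complex part -> inLp p f ->
  measurable_fun setT (half_line (part \o f)) /\
  (\int[lam]_x (`|half_line (part \o f) x| `^ p)%:E <= energy f)%E.
Proof.
move=> hpart [mf _].
have mp : measurable_fun setT (half_line (part \o f)).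
  by apply: measurable_half_line; case: hpart mf => -> [].
have mn := measurable_half_line (measurable_normc mf).
split=> //; apply: (le_integral_norm_powR lam (ltW p0) mp mn) => x.
rewrite /half_line !patchE; case: ifP => _; last by rewrite /point/=.
rewrite [leRHS]ger0_norm /=; last exact: normc_ge0.
by case: hpart => ->; [exact: norm_Re_le_normc|exact: norm_Im_le_normc].
Qed.

Section operator.
Variables (theta1 theta2 : lebesgueR R -> R).
Hypotheses (an1 : angle theta1) (an2 : angle theta2).

Definition half_line_op (e : R -> R -> R) (g : lebesgueR R -> R) : lebesgueR R -> R :=
  cauchy_op e setT (half_line g) (polar_re theta1) (polar_im theta1)
    (polar_re theta2) (polar_im theta2).

Let ker e (x y : lebesgueR R) : R :=
  e (polar_re theta1 x - polar_re theta2 y) (polar_im theta1 x + polar_im theta2 y).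

Lemma half_line_op_integrable e (part : R[i] -> R) f x :
  kernel_part e -> part_of_complex part -> inLp p f ->
  lam.-integrable (Rplus R) (EFin \o (fun y => part (f y) * ker e x y)).
Proof.
move=> he hpart fL; have [mf le] := part_energy hpart fL.
have fin : (energy f < +oo)%E by apply/Lpnorm_lty; case: fL.
have := cauchy_op_integrable x p1 he (admissible_polar an1) (admissible_polar an2) mf
  (le_lt_trans le fin).
move=> i; apply/(integrable_mkcond _ measurable_Rplus).
apply: eq_integrable i => // y _; rewrite /half_line /= !patchE.
by case: ifP => //= _; rewrite /point/= mul0r.
Qed.

Lemma half_line_opE e g x :
  half_line_op e g x = \int[lam]_(y in Rplus R) (g y * ker e x y).
Proof.
rewrite /half_line_op /cauchy_op [RHS]Rintegral_mkcond; apply: eq_Rintegral => y _.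
by rewrite /half_line !patchE; case: ifP => //= _; rewrite /point/= mul0r.
Qed.

Lemma integrand_integrable f x : inLp p f -> Rplus R x ->
  [/\ lam.-integrable (Rplus R) (fun y => (complex.Re (integrand theta1 theta2 f x y))%:E) &
      lam.-integrable (Rplus R) (fun y => (complex.Im (integrand theta1 theta2 f x y))%:E)].
Proof.
move=> fL x0; have mRp := @measurable_Rplus R.
have i1 := half_line_op_integrable x (or_intror erefl) (or_introl erefl) fL.
have i2 := half_line_op_integrable x (or_introl erefl) (or_intror erefl) fL.
have i3 := half_line_op_integrable x (or_intror erefl) (or_intror erefl) fL.
have i4 := half_line_op_integrable x (or_introl erefl) (or_introl erefl) fL.
split.
  apply: eq_integrable (integrableD mRp i1 i2) => // y /set_mem y0.
  by have [-> _] := integrandE theta1 theta2 f x0 y0.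
apply: eq_integrable (integrableB mRp i3 i4) => // y /set_mem y0.
by have [_ ->] := integrandE theta1 theta2 f x0 y0.
Qed.

Lemma Re_Sop f x : inLp p f -> Rplus R x ->
  complex.Re (Sop theta1 theta2 f x) =
  half_line_op (@cpoi R) (@complex.Re R \o f) x + half_line_op (@poi R) (@complex.Im R \o f) x.
Proof.
move=> fL x0; have mRp := @measurable_Rplus R.
have i1 := half_line_op_integrable x (or_intror erefl) (or_introl erefl) fL.
have i2 := half_line_op_integrable x (or_introl erefl) (or_intror erefl) fL.
rewrite !half_line_opE -(RintegralD mRp i1 i2); apply: eq_Rintegral => y /set_mem y0.
by have [-> _] := integrandE theta1 theta2 f x0 y0.
Qed.

Lemma Im_Sop f x : inLp p f -> Rplus R x ->
  complex.Im (Sop theta1 theta2 f x) =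
  half_line_op (@cpoi R) (@complex.Im R \o f) x - half_line_op (@poi R) (@complex.Re R \o f) x.
Proof.
move=> fL x0; have mRp := @measurable_Rplus R.
have i3 := half_line_op_integrable x (or_intror erefl) (or_intror erefl) fL.
have i4 := half_line_op_integrable x (or_introl erefl) (or_introl erefl) fL.
rewrite !half_line_opE -(RintegralB mRp i3 i4); apply: eq_Rintegral => y /set_mem y0.
by have [_ ->] := integrandE theta1 theta2 f x0 y0.
Qed.

Lemma measurable_half_line_op e part f :
  kernel_part e -> part_of_complex part -> inLp p f ->
  measurable_fun setT (half_line_op e (part \o f)).
Proof.
move=> he hpart fL; have [mf _] := part_energy hpart fL.
have [ma1 mb1 _ _] := admissible_polar an1; have [ma2 mb2 _ _] := admissible_polar an2.
exact: (measurable_cauchy_op he measurableT mf ma1 mb1 ma2 mb2).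
Qed.

Lemma cmeasurable_Sop f : inLp p f -> cmeasurable (Rplus R) (Sop theta1 theta2 f).
Proof.
move=> fL.
have m1 := measurable_half_line_op (or_intror erefl) (or_introl erefl) fL.
have m2 := measurable_half_line_op (or_introl erefl) (or_intror erefl) fL.
have m3 := measurable_half_line_op (or_intror erefl) (or_intror erefl) fL.
have m4 := measurable_half_line_op (or_introl erefl) (or_introl erefl) fL.
split.
  apply: eq_measurable_fun (measurable_funTS (measurable_funD m1 m2)) => x /set_mem x0.
  by rewrite (Re_Sop fL x0).
apply: eq_measurable_fun (measurable_funTS (measurable_funB m3 m4)) => x /set_mem x0.
by rewrite (Im_Sop fL x0).
Qed.

(** Each of the two parts of the image is a combination of two real operators, each bounded by C; the
    triangle inequality in L^p, in the form |u + v|^p <= 2^p (|u|^p + |v|^p), is used twice. *)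
Lemma energy_Sop_le (C : R) : 0 < C ->
  (forall e (f a1 b1 a2 b2 : lebesgueR R -> R), kernel_part e ->
    admissible a1 b1 -> admissible a2 b2 -> measurable_fun setT f ->
    (\int[lam]_y (`|f y| `^ p)%:E < +oo)%E ->
    (\int[lam]_x (`|cauchy_op e setT f a1 b1 a2 b2 x| `^ p)%:E <=
     C%:E * \int[lam]_y (`|f y| `^ p)%:E)%E) ->
  forall f, inLp p f ->
  (energy (Sop theta1 theta2 f) <= (4 * (2 `^ p * 2 `^ p * C))%:E * energy f)%E.
Proof.
move=> C0 HC f fL; have fin : (energy f < +oo)%E by apply/Lpnorm_lty; case: fL.
have bd e part : kernel_part e -> part_of_complex part ->
    (\int[lam]_x (`|half_line_op e (part \o f) x| `^ p)%:E <= C%:E * energy f)%E.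
  move=> he hpart; have [mf le] := part_energy hpart fL.
  have C0' : (0 <= C%:E)%E by rewrite lee_fin ltW.
  exact: (le_trans (HC e _ _ _ _ _ he (admissible_polar an1) (admissible_polar an2) mf
    (le_lt_trans le fin)) (lee_wpmul2l C0' le)).
have m1 := measurable_half_line_op (or_intror erefl) (or_introl erefl) fL.
have m2 := measurable_half_line_op (or_introl erefl) (or_intror erefl) fL.
have m3 := measurable_half_line_op (or_intror erefl) (or_intror erefl) fL.
have m4 := measurable_half_line_op (or_introl erefl) (or_introl erefl) fL.
have b1 := bd _ _ (or_intror erefl) (or_introl erefl).
have b2 := bd _ _ (or_introl erefl) (or_intror erefl).
have b3 := bd _ _ (or_intror erefl) (or_intror erefl).
have b4 := bd _ _ (or_introl erefl) (or_introl erefl).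
have SU := Re_Sop fL; have SV := Im_Sop fL.
have mS := measurable_half_line (measurable_normc (cmeasurable_Sop fL)).
rewrite [X in (X <= _)%E]/energy.
move: (half_line_op _ _) (half_line_op _ _) (half_line_op _ _) (half_line_op _ _)
  m1 m2 m3 m4 b1 b2 b3 b4 SU SV => h4 h3 h2 h1 m1 m2 m3 m4 b1 b2 b3 b4 SU SV.
have mU := measurable_funD m1 m2; have mV := measurable_funB m3 m4.
have tU x : `|(h1 \+ h2) x| <= `|h1 x| + `|h2 x| by exact: ler_normD.
have tV x : `|(h3 \- h4) x| <= `|h3 x| + `|h4 x| by exact: ler_normB.
have bU := integral_powR_le_add_bound (ltW p0) mU m1 m2 tU b1 b2.
have bV := integral_powR_le_add_bound (ltW p0) mV m3 m4 tV b3 b4.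
have hS x : `|half_line (modulus \o Sop theta1 theta2 f) x| <= `|(h1 \+ h2) x| + `|(h3 \- h4) x|.
  rewrite /half_line patchE; case: ifPn => [/set_mem x0|_]; last first.
    by rewrite /point/= normr0 addr_ge0.
  rewrite ger0_norm; last exact: normc_ge0.
  by apply: (le_trans (normc_le_Re_Im _)); rewrite (SU _ x0) (SV _ x0).
apply: (le_trans (integral_powR_le_add_bound (ltW p0) mS mU mV hS bU bV)).
have efin : energy f \is a fin_num by rewrite ge0_fin_numE ?energy_ge0.
rewrite -(fineK efin) -!(EFinM, EFinD) lee_fin le_eqVlt; apply/orP; left; apply/eqP.
by ring.
Qed.

Lemma Sop_linear (a : R[i]) f g x : inLp p f -> inLp p g -> Rplus R x ->
  Sop theta1 theta2 (fun y => a * f y + g y) x =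
  a * Sop theta1 theta2 f x + Sop theta1 theta2 g x.
Proof.
move=> fL gL x0; have mRp := @measurable_Rplus R.
have [f1 f2] := integrand_integrable fL x0; have [g1 g2] := integrand_integrable gL x0.
case: a => u v.
have E y : integrand theta1 theta2 (fun y => (u +i* v) * f y + g y) x y =
    (u +i* v) * integrand theta1 theta2 f x y + integrand theta1 theta2 g x y.
  by rewrite /integrand mulrDl mulrA.
have lin (F G H : lebesgueR R -> R) (s t : R) :
    lam.-integrable (Rplus R) (EFin \o F) -> lam.-integrable (Rplus R) (EFin \o G) ->
    lam.-integrable (Rplus R) (EFin \o H) ->
    \int[lam]_(y in Rplus R) (s * F y + t * G y + H y) =
    s * \int[lam]_(y in Rplus R) F y + t * \int[lam]_(y in Rplus R) G y +
    \int[lam]_(y in Rplus R) H y.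
  move=> iF iG iH.
  have isF : lam.-integrable (Rplus R) (EFin \o (fun y => s * F y)) by exact: (integrableZl mRp s iF).
  have itG : lam.-integrable (Rplus R) (EFin \o (fun y => t * G y)) by exact: (integrableZl mRp t iG).
  have isum : lam.-integrable (Rplus R) (EFin \o (fun y => s * F y + t * G y)) by exact: (integrableD mRp isF itG).
  by rewrite (RintegralD mRp isum iH) (RintegralD mRp isF itG) (RintegralZl s mRp iF) (RintegralZl t mRp iG).
apply/eqP; rewrite eq_complex; apply/andP; split; apply/eqP.
  have := lin _ _ _ u (- v) f1 f2 g1; rewrite mulNr /Sop /cintegral /= => <-.
  apply: eq_Rintegral => y _; rewrite E.
  by case: (integrand theta1 theta2 f x y) (integrand theta1 theta2 g x y) => a b [c d] /=; rewrite mulNr.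
have := lin _ _ _ u v f2 f1 g2; rewrite /Sop /cintegral /= => <-.
apply: eq_Rintegral => y _; rewrite E.
by case: (integrand theta1 theta2 f x y) (integrand theta1 theta2 g x y) => a b [c d].
Qed.

End operator.

Lemma Lpnorm_le (K : R) (f g : lebesgueR R -> R[i]) : 0 <= K ->
  (energy g <= K%:E * energy f)%E -> (Lpnorm p g <= (K `^ p^-1)%:E * Lpnorm p f)%E.
Proof.
move=> K0 gf; have pV : 0 <= p^-1 by rewrite invr_ge0 ltW.
rewrite !LpnormE -poweR_EFin -poweRM ?energy_ge0//.
by apply: gt0_ler_poweR => //; rewrite in_itv/= leey ?energy_ge0// mule_ge0// energy_ge0.
Qed.

End assembly.

Theorem theorem5 (R : realType) (p : R) (hp : 1 < p) :
  (forall theta1 theta2 : lebesgueR R -> R, angle theta1 -> angle theta2 ->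
     (forall f, inLp p f -> forall x, Rplus R x ->
        cintegrable (Rplus R) (integrand theta1 theta2 f x)) /\
     bounded_operator_Lp p (Sop theta1 theta2)) /\
  (exists K5 : R,
     forall theta1 theta2 : lebesgueR R -> R, angle theta1 -> angle theta2 ->
     forall f, inLp p f ->
       (Lpnorm p (Sop theta1 theta2 f) <= K5%:E * Lpnorm p f)%E).
Proof.
have [C C0 HC] := cauchy_op_bound hp.
set K := 4 * (2 `^ p * 2 `^ p * C).
have K0 : 0 <= K.
  have C' := ltW C0; have P0 := powR_ge0 (2 : R) p.
  exact: mulr_ge0 (ler0n _ 4) (mulr_ge0 (mulr_ge0 P0 P0) C').
have bound theta1 theta2 : angle theta1 -> angle theta2 -> forall f, inLp p f ->
    (Lpnorm p (Sop theta1 theta2 f) <= (K `^ p^-1)%:E * Lpnorm p f)%E.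
  move=> an1 an2 f fL; apply: (Lpnorm_le hp K0).
  exact: (energy_Sop_le hp an1 an2 C0 HC fL).
split; last by exists (K `^ p^-1).
move=> theta1 theta2 an1 an2; split.
  by move=> f fL x x0; have [] := integrand_integrable hp an1 an2 fL x0.
split.
- move=> f fL; split; first exact: (cmeasurable_Sop hp an1 an2 fL).
  apply: (le_lt_trans (bound _ _ an1 an2 f fL)).
  have [_ fin] := fL; have : Lpnorm p f \is a fin_num.
    by rewrite ge0_fin_numE// LpnormE poweR_ge0.
  by move=> /fineK <-; rewrite -EFinM ltry.
- by move=> a f g fL gL; apply: nearW => x x0; exact: (Sop_linear hp an1 an2 a fL gL x0).
- by exists (K `^ p^-1) => f fL; exact: bound.
Qed.
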